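(* Let $K$ be a prime knot. For any quandle $3$-cycle $c\in C_3^{\mathrm Q}(Q(K);\mathbb{Z})$ of the knot quandle $Q(K)$, there exist a link $L$ and a quandle homomorphism $f:Q(L)\to Q(K)$ such that $[c]=f_\ast[L_{\mathrm{sh}}]$ in $H_3^{\mathrm Q}(Q(K);\mathbb{Z})$, where $[L_{\mathrm{sh}}]\in H_3^{\mathrm Q}(Q(L);\mathbb{Z})$ is one of the shadow fundamental classes of $L$.
   Context: A quandle is a non-empty set $Q$ with binary operations $\lhd,\blacktriangleleft$ (also written $\lhd^{+1},\lhd^{-1}$) such that $(a\lhd b)\blacktriangleleft b=a=(a\blacktriangleleft b)\lhd b$, $(a\lhd b)\lhd c=(a\lhd c)\lhd(b\lhd c)$ and $a\lhd a=a=a\blacktriangleleft a$. A homomorphism is a map with $f(a\lhd b)=f(a)\lhd f(b)$. Homology: $C^{\mathrm R}_n(Q)=\mathbb{Z}[Q^n]$ with, for $n\ge 2$, $\partial_n(x_1,\dots,x_n)=\sum_{i=1}^n(-1)^{n-i}\{(x_1\lhd x_i,\dots,x_{i-1}\lhd x_i,x_{i+1},\dots,x_n)-(x_1,\dots,x_{i-1},x_{i+1},\dots,x_n)\}$. Its homology is the rack homology $H^{\mathrm R}_*(Q;\mathbb{Z})$. $C^{\mathrm D}_n(Q)\subset C^{\mathrm R}_n(Q)$ is the subcomplex generated by tuples with $x_i=x_{i+1}$ for some $i$; the homology of $C^{\mathrm Q}_*=C^{\mathrm R}_*/C^{\mathrm D}_*$ is the quandle homology $H^{\mathrm Q}_*(Q;\mathbb{Z})$,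 and $\rho_*:H^{\mathrm R}_*\to H^{\mathrm Q}_*$ is induced by the projection. A homomorphism $f$ induces $f_*$ on these homologies by acting on each entry of a tuple. Link diagrams: a diagram $D$ of an oriented link lies on the oriented sphere $\mathbb{S}^2$, with a basepoint in the complement of $D$. Arcs are the components of $D$ after cutting the lower strand at each crossing; regions are the components of $\mathbb{S}^2\setminus D$; the base-region contains the basepoint. Every arc has a normal vector pointing to the left of its orientation. For a non-crossing point $p$ on an arc $c_p$, $r_p^{\mathrm{ini}}$ and $r_p^{\mathrm{ter}}$ are the adjacent regions, the normal vector pointing from $r_p^{\mathrm{ini}}$ to $r_p^{\mathrm{ter}}$. At a crossing $p$, $o_p$ is the over-arc and $u_p^{\mathrm{ini}},u_p^{\mathrm{ter}}$ are the under-arcs, the normal of $o_p$ pointing to the side of $u_p^{\mathrm{ter}}$; $r_p^{\mathrm{ini}}$ is the region adjacent to $p$ that is the initial region of all the arcs adjacent to both $p$ and that region; $\epsilon_p=\pm1$ is the usual sign of the crossing. Knot quandle: $Q(L)$ is the quandle generated by the arcs of a diagram $D$ of $L$ with relations $u_p^{\mathrm{ini}}\lhd o_p=u_p^{\mathrm{ter}}$ for every crossing $p$; up to canonical isomorphism it is independent of $D$. The canonical colouring $C$ of $D$ sends each arc to the corresponding generator of $Q(L)$. Shadow fundamental classes: for $\alpha\in Q(L)$ there is a unique map $C'$ from the regions of $D$ to $Q(L)$ with $C'=\alpha$ on the base-region and $C'(r_p^{\mathrm{ini}})\lhd C(c_p)=C'(r_p^{\mathrm{ter}})$ for every non-crossing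 point $p\in D$; $D_\alpha$ denotes $D$ with the pair $(C,C')$. The chain $\langle D_\alpha\rangle=\sum_p\epsilon_p\,(C'(r_p^{\mathrm{ini}}),C(u_p^{\mathrm{ini}}),C(o_p))$, summed over the crossings $p$, is a rack 3-cycle, with class $[D_\alpha]\in H^{\mathrm R}_3(Q(L);\mathbb{Z})$. The image $\rho_*[D_\alpha]\in H^{\mathrm Q}_3(Q(L);\mathbb{Z})$ is called a shadow fundamental class of $L$ (for any diagram $D$ of $L$ and any $\alpha\in Q(L)$). *)

(* Defs.v *)
From HB Require Import structures.
From mathcomp Require Import all_boot all_order all_algebra.
From mathcomp Require Import generic_quotient ring_quotient.
From mathcomp Require Import zify.
From mathcomp Require Import freeg.
From mathcomp Require Import all_classical all_reals all_analysis.

Set Implicit Arguments.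
Unset Strict Implicit.
Unset Printing Implicit Defensive.

Import Order.TTheory GRing.Theory Num.Theory.
Import numFieldNormedType.Exports.

Local Open Scope classical_set_scope.
Local Open Scope ring_scope.
Local Open Scope quotient_scope.

HB.mixin Record isQuandle Q of Choice Q := {
  qinhabited : inhabited Q;
  qop : Q -> Q -> Q;
  qopV : Q -> Q -> Q;
  qopK : forall a b, qopV (qop a b) b = a;
  qopVK : forall a b, qop (qopV a b) b = a;
  qopD : forall a b c, qop (qop a b) c = qop (qop a c) (qop b c);
  qopxx : forall a, qop a a = a;
  qopVxx : forall a, qopV a a = a }.

#[short(type="quandleType")]
HB.structure Definition Quandle := {Q of isQuandle Q & Choice Q}.

Declare Scope quandle_scope.
Delimit Scope quandle_scope with Q.
Local Open Scope quandle_scope.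
Notation "a ◁ b" := (qop a b) (at level 45, left associativity) : quandle_scope.
Notation "a ◀ b" := (qopV a b) (at level 45, left associativity) : quandle_scope.

HB.mixin Record isQuandleHom (Q Q' : quandleType) (f : Q -> Q') := {
  qhomE : forall a b, f (a ◁ b) = f a ◁ f b }.

#[short(type="quandleHom")]
HB.structure Definition QuandleHom (Q Q' : quandleType) :=
  {f of isQuandleHom Q Q' f}.

Inductive qterm (A : Type) : Type :=
| QGen of A
| QOp of qterm A & qterm A
| QOpV of qterm A & qterm A.

HB.instance Definition _ (A : Type) := gen_eqMixin (qterm A).
HB.instance Definition _ (A : Type) := gen_choiceMixin (qterm A).

Section Presentation.
Variables (A : pointedType) (rel : qterm A -> qterm A -> Prop).

Inductive qcong : qterm A -> qterm A -> Prop :=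
| qcong_rel s t : rel s t -> qcong s t
| qcong_refl t : qcong t t
| qcong_sym s t : qcong s t -> qcong t s
| qcong_trans s t u : qcong s t -> qcong t u -> qcong s u
| qcong_op s s' t t' : qcong s s' -> qcong t t' -> qcong (QOp s t) (QOp s' t')
| qcong_opV s s' t t' :
    qcong s s' -> qcong t t' -> qcong (QOpV s t) (QOpV s' t')
| qcong_opK s t : qcong (QOpV (QOp s t) t) s
| qcong_opVK s t : qcong (QOp (QOpV s t) t) s
| qcong_opD s t u :
    qcong (QOp (QOp s t) u) (QOp (QOp s u) (QOp t u))
| qcong_opxx t : qcong (QOp t t) t
| qcong_opVxx t : qcong (QOpV t t) t.

Definition qcongb (s t : qterm A) : bool := `[< qcong s t >].

Lemma qcongb_equiv : equiv_class_of qcongb.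
Proof.
split=> [t|s t|t s u]; first exact/asboolP/qcong_refl.
  by apply/asboolP/asboolP; exact: qcong_sym.
by move=> /asboolP st /asboolP tu; exact/asboolP/(qcong_trans st).
Qed.
Canonical qcongb_equiv_rel := EquivRelPack qcongb_equiv.
Canonical qcongb_encModRel := defaultEncModRel qcongb.

Definition presented := {eq_quot qcongb}.
HB.instance Definition _ := Choice.on presented.
HB.instance Definition _ : EqQuotient _ qcongb presented :=
  EqQuotient.on presented.

Definition pgen (a : A) : presented := \pi_presented (QGen a).
Definition pop (x y : presented) : presented := \pi_presented (QOp (repr x) (repr y)).
Definition popV (x y : presented) : presented := \pi_presented (QOpV (repr x) (repr y)).

Lemma pi_qcong s t : (\pi_presented s = \pi_presented t) <-> qcong s t.
Proof.
split=> [/eqP|st]; first by rewrite piE => /asboolP.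
by apply/eqP; rewrite piE; exact/asboolP.
Qed.

Lemma repr_qcong s : qcong (repr (\pi_presented s)) s.
Proof. by apply/pi_qcong; rewrite reprK. Qed.

Lemma popE s t :
  pop (\pi_presented s) (\pi_presented t) = \pi_presented (QOp s t).
Proof. by apply/pi_qcong/qcong_op; exact: repr_qcong. Qed.

Lemma popVE s t :
  popV (\pi_presented s) (\pi_presented t) = \pi_presented (QOpV s t).
Proof. by apply/pi_qcong/qcong_opV; exact: repr_qcong. Qed.

Lemma popK x y : popV (pop x y) y = x.
Proof.
elim/quotW: x => s; elim/quotW: y => t; rewrite popE popVE.
exact/pi_qcong/qcong_opK.
Qed.

Lemma popVK x y : pop (popV x y) y = x.
Proof.
elim/quotW: x => s; elim/quotW: y => t; rewrite popVE popE.
exact/pi_qcong/qcong_opVK.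
Qed.

Lemma popD x y z : pop (pop x y) z = pop (pop x z) (pop y z).
Proof.
elim/quotW: x => s; elim/quotW: y => t; elim/quotW: z => u.
rewrite (popE s t) (popE s u) (popE t u) !popE.
exact/pi_qcong/qcong_opD.
Qed.

Lemma popxx x : pop x x = x.
Proof. elim/quotW: x => s; rewrite popE; exact/pi_qcong/qcong_opxx. Qed.

Lemma popVxx x : popV x x = x.
Proof. elim/quotW: x => s; rewrite popVE; exact/pi_qcong/qcong_opVxx. Qed.

HB.instance Definition _ :=
  isQuandle.Build presented (inhabits (pgen point)) popK popVK popD popxx popVxx.

End Presentation.

Section RackChains.
Variable Q : quandleType.
Implicit Types n : nat.

Definition rack_chain n := {freeg n.-tuple Q}.

Definition face n (x : n.+1.-tuple Q) (i : 'I_n.+1) : n.-tuple Q :=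
  [tuple tnth x (fintype.lift i j) | j < n].

Definition face_act n (x : n.+1.-tuple Q) (i : 'I_n.+1) : n.-tuple Q :=
  [tuple if (j < i)%N then tnth x (fintype.lift i j) ◁ tnth x i else tnth x (fintype.lift i j)
  | j < n].

(* Positions are counted from 0 here, hence the sign (-1)^(n - i) in the
   boundary of an (n+1)-tuple. *)
Definition rack_boundary_gen n (x : n.+1.-tuple Q) : rack_chain n :=
  \sum_(i < n.+1) (-1) ^+ (n - i) *: (<< face_act x i >> - << face x i >>).

Definition rack_boundary n (c : rack_chain n.+1) : rack_chain n :=
  fglift (@rack_boundary_gen n) c.

(* Some two consecutive entries are equal. *)
Definition degenerate_tuple n (x : n.-tuple Q) : bool :=
  ~~ sorted (fun a b => a != b) x.

(* The span of the degenerate tuples: the support consists of such tuples. *)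
Definition degenerate n : {pred rack_chain n} :=
  fun c => all (@degenerate_tuple n) (dom c).

Lemma degenerate_zmod n : zmod_closed (@degenerate n).
Proof.
split=> [|c d /allP cD /allP dD]; first by rewrite unfold_in dom0.
apply/allP => x /domB; rewrite mem_cat => /orP[]; [exact: cD|exact: dD].
Qed.
HB.instance Definition _ n :=
  GRing.isZmodClosed.Build (rack_chain n) (@degenerate n) (degenerate_zmod n).

Definition quandle_chain n := {ideal_quot (@degenerate n)}.

Definition rho n (c : rack_chain n) : quandle_chain n := \pi c.

(* The choice of the representative is immaterial: see quandle_boundary_rho,
   and quandle_push_rho and class_push_class for the induced maps. *)
Definition quandle_boundary n (c : quandle_chain n.+1) : quandle_chain n :=
  rho (rack_boundary (repr c)).

Definition boundaries n : {pred quandle_chain n} :=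
  fun c => `[< exists b : quandle_chain n.+1, c = quandle_boundary b >].

Lemma rack_boundary_additive n : additive (@rack_boundary n).
Proof. exact: lift_is_additive. Qed.
HB.instance Definition _ n :=
  GRing.isAdditive.Build _ _ (@rack_boundary n) (@rack_boundary_additive n).

Lemma degenerateZ n (a : int) (c : rack_chain n) :
  c \in @degenerate n -> a *: c \in @degenerate n.
Proof. by move=> /allP cD; apply/allP => x /domZ_subset; exact: cD. Qed.

Lemma degenerateU n (x : n.-tuple Q) :
  degenerate_tuple x -> << x >> \in @degenerate n.
Proof. by move=> xD; apply/allP => y; rewrite domU1 inE => /eqP ->. Qed.

Lemma degenerate_tupleP n (x : n.-tuple Q) :
  reflect (exists i j : 'I_n, j = i.+1 :> nat /\ tnth x i = tnth x j)
          (degenerate_tuple x).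
Proof.
have x0 (i : 'I_n) : Q by exact: tnth x i.
apply: (iffP idP) => [|[i [j [ij xij]]]].
  case: n x {x0} => [|n] x; first by rewrite /degenerate_tuple tuple0.
  move=> xD; apply: contrapT => xN; move/negP: xD; apply.
  have [a _] : exists a : Q, True by exists (tnth x ord0).
  apply/(sortedP a) => i; rewrite size_tuple => i1.
  apply/negP => /eqP xi; apply: xN.
  exists (Ordinal (ltnW i1)), (Ordinal i1); split => //.
  by rewrite !(tnth_nth a).
apply/negP => /(sortedP (x0 i)) /(_ i); rewrite size_tuple -ij ltn_ord.
by move=> /(_ isT); rewrite -!tnth_nth xij eqxx.
Qed.

Lemma rack_boundary_gen_degenerate n (x : n.+1.-tuple Q) :
  degenerate_tuple x -> rack_boundary_gen x \in @degenerate n.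
Proof.
move=> /degenerate_tupleP[k [k' [kk' xk]]].
have kNk' : k' != k by rewrite -val_eqE /= kk' neq_ltn ltnSn orbT.
rewrite /rack_boundary_gen (bigD1 k)//= (bigD1 k')//= addrA rpredD//.
  set d := (X in X \in _); suff -> : d = 0 by rewrite rpred0.
  have kn : (k < n)%N by rewrite -ltnS -kk' ltn_ord.
  have liftE (j : 'I_n) : (j != k :> nat /\ fintype.lift k j = fintype.lift k' j)
      \/ [/\ j = k :> nat, fintype.lift k j = k' & fintype.lift k' j = k].
    have [jk|jk] := eqVneq (j : nat) k; [right|left]; split => //;
      apply: val_inj; rewrite /= /bump.
    - by case: (leqP k j) => /=; lia.
    - by case: (leqP k' j) => /=; lia.
    - by case: (leqP k j); case: (leqP k' j) => /=; lia.
  have fE : face x k = face x k'.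
    apply: eq_from_tnth => j; rewrite !tnth_mktuple.
    by have [[_ ->]|[_ -> ->]] := liftE j.
  have gE : face_act x k = face_act x k'.
    apply: eq_from_tnth => j; rewrite !tnth_mktuple kk' xk.
    have [[jk ->]|[jk -> ->]] := liftE j; last by rewrite jk ltnn leqnn xk qopxx.
    by rewrite [(j < k.+1)%N]ltnS [(j <= k)%N]leq_eqVlt (negbTE jk).
  by rewrite /d fE gE kk' -(subnSK kn) -scalerDl exprS mulN1r addNr scale0r.
apply: rpred_sum => i /andP[ik ik'].
have iNk : i != k :> nat by rewrite val_eqE.
have iNk' : i != k.+1 :> nat by rewrite -kk' val_eqE.
have [j [j' [jj' jk jk']]] : exists j j' : 'I_n,
    [/\ j' = j.+1 :> nat, fintype.lift i j = k & fintype.lift i j' = k'].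
  have /unlift_some[j jk _] := ik; have /unlift_some[j' jk' _] := ik'.
  exists j, j'; split => //.
  have := congr1 val jk; have := congr1 val jk'; rewrite /= /bump kk'.
  move: iNk iNk'; clear; case: (leqP i j); case: (leqP i j') => /=; lia.
have jij' : (j < i)%N = (j' < i)%N.
  have := congr1 val jk; have := congr1 val jk'; rewrite /= /bump kk' jj'.
  move: iNk iNk'; clear; case: (leqP i j); case: (leqP i j.+1) => /=; lia.
apply: degenerateZ; rewrite rpredB// degenerateU//; apply/degenerate_tupleP;
  exists j, j'; split => //; rewrite !tnth_mktuple jk jk'.
- by rewrite jij' xk.
- exact: xk.
Qed.

Lemma rack_boundary_degenerate n (c : rack_chain n.+1) :
  c \in @degenerate n.+1 -> rack_boundary c \in @degenerate n.
Proof.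
move=> /allP cD; rewrite -[c]freeg_sumE raddf_sum big_seq.
apply: rpred_sum => x /cD xD; rewrite /= /rack_boundary liftU.
exact/degenerateZ/rack_boundary_gen_degenerate.
Qed.

Lemma rho_eq n (c d : rack_chain n) :
  c - d \in @degenerate n -> rho c = rho d.
Proof. by rewrite Quotient.idealrBE => /eqP. Qed.

Lemma rho_repr n (c : rack_chain n) : repr (rho c) - c \in @degenerate n.
Proof. by rewrite Quotient.idealrBE reprK. Qed.

Lemma rhoK n (c : quandle_chain n) : rho (repr c) = c.
Proof. exact: reprK. Qed.

Lemma rhoB n : {morph @rho n : c d / c - d}.
Proof. by move=> c d; rewrite /rho !piE. Qed.

Lemma quandle_boundary_rho n (c : rack_chain n.+1) :
  quandle_boundary (rho c) = rho (rack_boundary c).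
Proof.
by apply: rho_eq; rewrite -raddfB; exact/rack_boundary_degenerate/rho_repr.
Qed.

Lemma quandle_boundaryB n : {morph @quandle_boundary n : c d / c - d}.
Proof.
move=> c d; rewrite -[c]rhoK -[d]rhoK.
by rewrite -rhoB !quandle_boundary_rho raddfB rhoB.
Qed.

Lemma boundaries_zmod n : zmod_closed (@boundaries n).
Proof.
split=> [|c d /asboolP[b ->] /asboolP[b' ->]]; apply/asboolP.
  by exists 0; rewrite -[0 in RHS](subrr 0) quandle_boundaryB subrr.
by exists (b - b'); rewrite quandle_boundaryB.
Qed.
HB.instance Definition _ n :=
  GRing.isZmodClosed.Build (quandle_chain n) (@boundaries n) (boundaries_zmod n).

(* Chains modulo boundaries: H^Q_n is the subgroup of the classes [c] of the
   cycles c. *)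
Definition chain_class_group n := {ideal_quot (@boundaries n)}.

Definition chain_class n (c : quandle_chain n) : chain_class_group n := \pi c.

End RackChains.

Section Induced.
Variables (Q Q' : quandleType) (f : quandleHom Q Q').
Implicit Types n : nat.

Definition rack_push n (c : rack_chain Q n) : rack_chain Q' n :=
  fglift (fun x => << map_tuple f x >>) c.

Definition quandle_push n (c : quandle_chain Q n) : quandle_chain Q' n :=
  rho (rack_push (repr c)).

(* f_* on H^Q_n is the restriction of this map to the classes of cycles. *)
Definition class_push n (h : chain_class_group Q n) : chain_class_group Q' n :=
  chain_class (quandle_push (repr h)).

Lemma rack_push_additive n : additive (@rack_push n).
Proof. exact: lift_is_additive. Qed.
HB.instance Definition _ n :=
  GRing.isAdditive.Build _ _ (@rack_push n) (@rack_push_additive n).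

Lemma rack_pushU n (x : n.-tuple Q) : rack_push << x >> = << map_tuple f x >>.
Proof. by rewrite /rack_push liftU scale1r. Qed.

Lemma rack_pushZ n (a : int) (c : rack_chain Q n) :
  rack_push (a *: c) = a *: rack_push c.
Proof. by rewrite -[a]intz !scaler_int raddfMz. Qed.

Lemma rack_push_degenerate n (c : rack_chain Q n) :
  c \in @degenerate Q n -> rack_push c \in @degenerate Q' n.
Proof.
move=> /allP cD; rewrite -[c]freeg_sumE raddf_sum big_seq.
apply: rpred_sum => x /cD /degenerate_tupleP[i [j [ij xij]]].
rewrite /= /rack_push liftU; apply/degenerateZ/degenerateU/degenerate_tupleP.
by exists i, j; rewrite !tnth_map xij.
Qed.

Lemma quandle_push_rho n (c : rack_chain Q n) :
  quandle_push (rho c) = rho (rack_push c).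
Proof.
by apply: rho_eq; rewrite -raddfB; exact/rack_push_degenerate/rho_repr.
Qed.

Lemma rack_push_boundary n (c : rack_chain Q n.+1) :
  rack_push (rack_boundary c) = rack_boundary (rack_push c).
Proof.
rewrite -[c]freeg_sumE !raddf_sum; apply: eq_bigr => x _ /=.
rewrite {1}/rack_boundary {2}/rack_push !liftU.
rewrite rack_pushZ -[coeff x c]intz !scaler_int raddfMz; congr (_ *~ _).
rewrite /= /rack_boundary !liftU scale1r raddf_sum; apply: eq_bigr => i _.
rewrite /= rack_pushZ raddfB /= !rack_pushU; congr (_ *: (<< _ >> - << _ >>));
  apply: eq_from_tnth => j; rewrite !(tnth_map, tnth_mktuple)//.
by case: ifP => // _; rewrite qhomE.
Qed.

Lemma quandle_push_boundary n (c : quandle_chain Q n.+1) :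
  quandle_push (quandle_boundary c) = quandle_boundary (quandle_push c).
Proof.
rewrite -[c]rhoK quandle_push_rho !quandle_boundary_rho.
by rewrite quandle_push_rho rack_push_boundary.
Qed.

Lemma quandle_pushB n : {morph @quandle_push n : c d / c - d}.
Proof.
move=> c d; rewrite -[c]rhoK -[d]rhoK.
by rewrite -rhoB !quandle_push_rho raddfB rhoB.
Qed.

Lemma class_push_class n (c : quandle_chain Q n) :
  class_push (chain_class c) = chain_class (quandle_push c).
Proof.
apply/eqP; rewrite -Quotient.idealrBE -quandle_pushB.
set d := _ - c; have /asboolP[b ->] : d \in @boundaries Q n.
  by rewrite /d Quotient.idealrBE reprK.
by apply/asboolP; exists (quandle_push b); rewrite quandle_push_boundary.
Qed.

End Induced.

Section PolygonalLinks.
Variable R : realType.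

(* A polygon is the cyclic sequence of its vertices; the edges and the
   orientation follow the order of the sequence. *)
Definition polygon := seq 'rV[R]_3.
Definition edge := ('rV[R]_3 * 'rV[R]_3)%type.

Definition edges (p : polygon) : seq edge := zip p (rot 1 p).
Definition link_edges (L : seq polygon) : seq edge := flatten (map edges L).

Definition segment (e : edge) : set 'rV[R]_3 :=
  [set (1 - t) *: e.1 + t *: e.2 | t in [set t : R | 0 <= t <= 1]].
Definition half_open_segment (e : edge) : set 'rV[R]_3 :=
  [set (1 - t) *: e.1 + t *: e.2 | t in [set t : R | 0 <= t < 1]].
Definition open_segment (e : edge) : set 'rV[R]_3 :=
  [set (1 - t) *: e.1 + t *: e.2 | t in [set t : R | 0 < t < 1]].

Definition link_set (L : seq polygon) : set 'rV[R]_3 :=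
  \bigcup_(e in [set` link_edges L]) segment e.

(* A half-open edge contains its initial but not its terminal vertex, so that
   disjointness says that the polygons are simple closed curves and
   that distinct polygons do not meet. *)
Definition is_link (L : seq polygon) : Prop :=
  [/\ L != [::], all (fun p : polygon => (2 < size p)%N) L &
      trivIset [set i | (i < size (link_edges L))%N]
        (fun i => half_open_segment (nth (0, 0) (link_edges L) i))].

Definition is_knot (p : polygon) : Prop := is_link [:: p].

Definition triangle (a b c : 'rV[R]_3) : set 'rV[R]_3 :=
  [set x | exists r s t : R, [/\ 0 <= r, 0 <= s, 0 <= t, r + s + t = 1 &
                                x = r *: a + s *: b + t *: c]].

(* Isotopy of oriented polygonal knots, generated by Reidemeister's triangle
   moves. The triangle may be flat, which gives the subdivision of an edge. *)
Inductive isotopic : polygon -> polygon -> Prop :=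
| isotopic_refl p : isotopic p p
| isotopic_sym p q : isotopic p q -> isotopic q p
| isotopic_trans p q r : isotopic p q -> isotopic q r -> isotopic p r
| isotopic_rot n p : isotopic p (rot n p)
| isotopic_triangle a b c s :
    is_knot [:: a, b & s] -> is_knot [:: a, c, b & s] ->
    triangle a c b `&` link_set [:: [:: a, b & s]] = segment (a, b) ->
    isotopic [:: a, b & s] [:: a, c, b & s].

Definition trivial_knot (p : polygon) : Prop :=
  exists a b c, is_knot [:: a; b; c] /\ isotopic p [:: a; b; c].

(* The plane x_0 = 0 meets the polygon p :: s ++ q :: t in the vertices p and
   q only, and cuts it into two arcs; the summands are obtained by closing
   these with the segment between p and q in that plane. *)
Definition connected_sum (k1 k2 k : polygon) : Prop :=
  exists (p q : 'rV[R]_3) (s t : seq 'rV[R]_3),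
    [/\ p 0 0 = 0, q 0 0 = 0, forall x, x \in s -> 0 < x 0 0 &
        forall x, x \in t -> x 0 0 < 0] /\
    [/\ k = p :: s ++ q :: t, k1 = p :: rcons s q & k2 = q :: rcons t p].

Definition prime_knot (k : polygon) : Prop :=
  [/\ is_knot k, ~ trivial_knot k &
      forall k1 k2 k', is_knot k1 -> is_knot k2 -> is_knot k' ->
        connected_sum k1 k2 k' -> isotopic k k' ->
        trivial_knot k1 \/ trivial_knot k2].

(* The projection to the plane of the diagram, and the height over it. *)
Definition proj (p : 'rV[R]_3) : 'rV[R]_2 := \row_(j < 2) p 0 (inord j).
Definition height (p : 'rV[R]_3) : R := p 0 (inord 2).

(* At most two points of the link have the same projection, and none of two
   such points is a vertex. Consequently edges project injectively, and the
   double points are finite in number and are transverse crossings. *)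
Definition regular (L : seq polygon) : Prop :=
  (forall x y z, link_set L x -> link_set L y -> link_set L z ->
     proj x = proj y -> proj y = proj z -> [\/ x = y, y = z | x = z]) /\
  (forall p v x, p \in L -> v \in p -> link_set L x -> proj x = proj v ->
     x = v).

Record diagram := Diagram {
  diagram_link :> seq polygon;
  diagram_is_link : is_link diagram_link;
  diagram_regular : regular diagram_link }.

Definition diagram_of_knot (k : polygon) (D : diagram) : Prop :=
  exists2 k', diagram_link D = [:: k'] & isotopic k k'.

Definition det2 (v w : 'rV[R]_2) : R := v 0 0 * w 0 1 - v 0 1 * w 0 0.

Definition left_normal (v : 'rV[R]_2) : 'rV[R]_2 :=
  \row_(j < 2) (if j == 0 then - v 0 1 else v 0 0).

Definition direction (e : edge) : 'rV[R]_3 := e.2 - e.1.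

End PolygonalLinks.

Section Components.
Variables (T : topologicalType) (A : set T).

Record component := Component {
  component_set : set T;
  component_prop :
    exists2 x, A x & component_set = connected_component A x }.

HB.instance Definition _ := gen_eqMixin component.
HB.instance Definition _ := gen_choiceMixin component.

End Components.

Section Diagrams.
Variables (R : realType) (D : diagram R).

Definition under_points : set 'rV[R]_3 :=
  [set u | link_set D u /\
     exists o, [/\ link_set D o, proj o = proj u & height u < height o]].

(* The arcs are taken on the link itself, so that cutting the lower strand at
   a crossing is removing the lower of the two points over the crossing. *)
Definition arc := component (link_set D `\` under_points).
HB.instance Definition _ := Choice.on arc.

Lemma arc_exists : exists a : arc, True.
Proof.
have [D0 /allP D3 _] := diagram_is_link D.
have [_ reg] := diagram_regular D.
case DE: (diagram_link D) D0 D3 => [|p L]// _ /(_ p); rewrite mem_head.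
move=> /(_ isT); case: p DE => [|v [|w s]]// DE _.
have vD : link_set D v.
  rewrite /link_set DE; exists (v, w); first by rewrite /= mem_head.
  by exists 0; rewrite /= ?lexx ?ler01// subr0 scale1r scale0r addr0.
have vN : (link_set D `\` under_points) v.
  split => // -[_ [y [yD yv]]].
  by rewrite (reg [:: v, w & s] v y) ?ltxx// ?DE ?mem_head.
by exists (Component (ex_intro2 _ _ v vN erefl)).
Qed.

HB.instance Definition _ := isPointed.Build arc (projT1 (cid arc_exists)).

(* The sphere is the plane with a point at infinity, which lies off the diagram
   and is dropped from its region, the unbounded one. *)
Definition region := component (~` (@proj R @` link_set D)).
HB.instance Definition _ := Choice.on region.

Definition arc_at (x : 'rV[R]_3) : arc := xget point [set a : arc | component_set a x].

(* The arc, resp. the region, containing g t for all small t > 0; such an arc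
   always exists in the uses below, and likewise such a region, so that the
   default values are immaterial. *)
Definition arc_near (g : R -> 'rV[R]_3) : arc :=
  xget point [set a : arc | \forall t \near 0^'+, component_set a (g t)].
Definition region_near (r0 : region) (g : R -> 'rV[R]_2) : region :=
  xget r0 [set r : region | \forall t \near 0^'+, component_set r (g t)].

(* The pair (e, e') is a crossing at which e is the upper edge and e' the lower
   one, and o and u are the points of e and e' over the crossing. *)
Definition crosses_at (c : edge R * edge R) (o u : 'rV[R]_3) : Prop :=
  [/\ segment c.1 o, segment c.2 u, proj o = proj u & height u < height o].

Definition crossings : seq (edge R * edge R) :=
  [seq c <- [seq (e, e') | e <- link_edges D, e' <- link_edges D]
  | `[< exists o u, crosses_at c o u >]].

Section Crossing.
Variable c : edge R * edge R.

Definition crossing_points : 'rV[R]_3 * 'rV[R]_3 :=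
  xget (0, 0) [set x | crosses_at c x.1 x.2].
Definition over_point := crossing_points.1.
Definition under_point := crossing_points.2.

(* Positive when the normal of the upper edge points to the side to which the
   lower edge is heading. *)
Definition crossing_det : R :=
  det2 (proj (direction c.1)) (proj (direction c.2)).
Definition crossing_sign : int := sgz crossing_det.

Definition over_arc : arc := arc_at over_point.

(* The points of the lower edge near the crossing are on the side of the normal
   of the upper edge after a positive, and before a negative crossing. *)
Definition under_ini : arc :=
  arc_near (fun t => under_point - (t * crossing_det) *: direction c.2).
Definition under_ter : arc :=
  arc_near (fun t => under_point + (t * crossing_det) *: direction c.2).

(* With v the difference of the projected directions of the upper and lower
   edges, crossing_det *: v is to the right of both edges. *)
Definition region_ini (r0 : region) : region :=
  region_near r0 (fun t => proj under_point +
    (t * crossing_det) *: (proj (direction c.1) - proj (direction c.2))).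

End Crossing.

Definition knot_quandle_rel (s t : qterm arc) : Prop :=
  exists2 c, c \in crossings &
    s = QOp (QGen (under_ini c)) (QGen (over_arc c)) /\
    t = QGen (under_ter c).

Definition knot_quandle : quandleType := presented knot_quandle_rel.

Definition canonical_colouring (a : arc) : knot_quandle :=
  pgen knot_quandle_rel a.

Definition is_region_colouring (r0 : region) (alpha : knot_quandle)
    (C' : region -> knot_quandle) : Prop :=
  C' r0 = alpha /\
  forall e x, e \in link_edges D -> open_segment e x ->
    (forall y, link_set D y -> proj y = proj x -> y = x) ->
    let n := left_normal (proj (direction e)) in
    C' (region_near r0 (fun t => proj x - t *: n)) ◁
      canonical_colouring (arc_at x) =
    C' (region_near r0 (fun t => proj x + t *: n)).

Definition shadow_chain (r0 : region) (C' : region -> knot_quandle) :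
    rack_chain knot_quandle 3 :=
  \sum_(c <- crossings) crossing_sign c *:
    << [tuple C' (region_ini c r0); canonical_colouring (under_ini c);
              canonical_colouring (over_arc c)] >>.

(* The base-region r0 and alpha are arbitrary. *)
Definition shadow_fundamental_class
    (h : chain_class_group knot_quandle 3) : Prop :=
  exists (r0 : region) (alpha : knot_quandle) (C' : region -> knot_quandle),
    is_region_colouring r0 alpha C' /\
    h = chain_class (rho (shadow_chain r0 C')).

End Diagrams.

(* Main.v *)
From HB Require Import structures.
From mathcomp Require Import all_boot all_order all_algebra all_classical all_reals all_analysis.
From mathcomp Require Import generic_quotient lra ring zify freeg.
Require Import Defs.
Set Implicit Arguments.
Unset Strict Implicit.
Unset Printing Implicit Defensive.
Import Order.TTheory GRing.Theory Num.Theory numFieldNormedType.Exports.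
Local Open Scope classical_set_scope.
Local Open Scope ring_scope.
Local Open Scope quandle_scope.

(** The horizontal sections of a coloured diagram are words: a strand that
    crosses the section line is a letter (a, s), where a is its colour and s
    tells whether its normal points to the right, and with alpha the colour of
    the region at the left end of the line, the region colour at any other
    point is obtained from alpha by letting the letters to its left act. When
    the line moves upwards, the word changes by events, each of which is a
    horizontal piece of the link that joins two vertical strands and passes
    under at most one strand between them. Minima, maxima and crossings are of
    this form, and each crossing contributes its signed triple of colours to
    the chain of the movie. Conversely, a movie from the empty word to the empty
    word can be drawn as a link diagram, layer by layer, and the homomorphism
    that carries the generators of the knot quandle of this link to the colours
    of the movie carries a shadow fundamental class to the class of the chain of
    the movie ([movie_realises]). So it is enough to find, for a quandle cycle c
    of degree 3, a movie from the empty word to itself with the chain c up to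
    degenerate chains ([cycle_movie]).

    A single triple (y, a, b) is the chain of a movie from the empty word to a
    conjugate of the boundary word of a crossing. Doing this for all the terms
    of c yields a movie with the chain c from the empty word to a word W which
    is closed, that is, it fixes alpha. It remains to undo W at no cost. Read
    from alpha, the word W is a loop in the graph with the edges from y to
    y ◁ a, and the chain of the edges it runs through is minus the boundary of
    c. This chain is degenerate; so W is equivalent to a product of based loops
    around single edges, in which each edge that is not degenerate occurs
    equally often in both directions, and the degenerate edges, whose loops are
    all equivalent to the letter alpha, are balanced as well because W has as
    many positive as negative letters ([movd_null]). The loops cancel if
    closed words commute up to movies with degenerate chains.

    They do for the quandle of a knot. By a theorem of Joyce, the stabiliser of
    the generator alpha of an arc is generated by alpha and by the longitude,
    the word of the over-arcs that are met on one tour around the knot from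
    that arc ([stabiliser_peripheral]). The letter alpha commutes with every
    closed word, since a letter can be dragged through a word, and as long as
    its colour is that of the region next to it each crossing on its way
    contributes a degenerate triple ([movie_drag]). Hence closed words in alpha
    and the longitude commute. Two arbitrary closed words are led to such words
    by two movies; playing these forwards, exchanging the words, and
    playing the movies backwards costs nothing ([closed_comm]).

    To see Joyce's theorem, attach to each arc the word of the over-arcs that
    are met on the way to it from the base arc: it carries alpha to the
    generator of the arc. It is determined up to a power of the longitude on
    its left, and the relation at a crossing holds for these words, up to
    peripheral words on the left. Every equation in the knot quandle follows
    from these relations and the quandle axioms, and the words of
    the two sides of an axiom are equivalent, apart from idempotency, where
    they differ by a letter alpha on the left. *)

(** * Movies of sections *)

Section Words.
Variable Q : quandleType.
Implicit Types (y a b : Q).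

Lemma qop_inj b : injective (fun a : Q => a ◁ b).
Proof. by move=> x y /= xy; rewrite -[x](qopK x b) xy qopK. Qed.

Lemma qopDV a b c : (a ◀ b) ◁ c = (a ◁ c) ◀ (b ◁ c).
Proof. by apply: (@qop_inj (b ◁ c)); rewrite /= qopVK -qopD qopVK. Qed.

Lemma qopVD a b c : (a ◁ b) ◀ c = (a ◀ c) ◁ (b ◀ c).
Proof. by apply: (@qop_inj c); rewrite /= qopVK qopD !qopVK. Qed.

Lemma qopVV a b c : (a ◀ b) ◀ c = (a ◀ c) ◀ (b ◀ c).
Proof. by apply: (@qop_inj c); rewrite /= qopVK qopDV !qopVK. Qed.

(** A strand crossing a horizontal line: its colour, and whether its normal
    points to the right. *)
Definition letter := (Q * bool)%type.
Implicit Types (l : letter) (u v w : seq letter).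

Definition act y l : Q := if l.2 then y ◁ l.1 else y ◀ l.1.
Definition acts : Q -> seq letter -> Q := foldl act.
Definition linv l : letter := (l.1, ~~ l.2).
Definition winv w : seq letter := rev (map linv w).

Lemma acts_cat y u v : acts y (u ++ v) = acts (acts y u) v.
Proof. exact: foldl_cat. Qed.

Lemma linvK : involutive linv.
Proof. by case=> a s; rewrite /linv /= negbK. Qed.

Lemma actK y l : act (act y l) (linv l) = y.
Proof. by case: l => b []; rewrite /act /= ?qopK ?qopVK. Qed.

Lemma winvK : involutive winv.
Proof. by move=> w; rewrite /winv map_rev revK mapK//; exact: linvK. Qed.

Lemma winv_cat u v : winv (u ++ v) = winv v ++ winv u.
Proof. by rewrite /winv map_cat rev_cat. Qed.

Lemma winv_rcons u l : winv (rcons u l) = linv l :: winv u.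
Proof. by rewrite /winv map_rcons rev_rcons. Qed.

Lemma winv_cons u l : winv (l :: u) = rcons (winv u) (linv l).
Proof. by rewrite /winv /= rev_cons. Qed.

Lemma acts_winv y w : acts (acts y w) (winv w) = y.
Proof.
elim/last_ind: w => [|w l IH]//.
by rewrite winv_rcons -cats1 acts_cat /= actK.
Qed.

Lemma act_act y l l' : act (act y l) l' = act (act y l') (act l.1 l', l.2).
Proof.
case: l l' => [a []] [b []]; rewrite /act /=.
- exact: qopD.
- exact: qopVD.
- exact: qopDV.
- exact: qopVV.
Qed.

Lemma act_self a s : act a (a, s) = a.
Proof. by case: s; rewrite /act /= ?qopxx ?qopVxx. Qed.

(** A row joins the ends of two columns and passes under at most one column
    between them, whose letter is [ev_over]. The row runs to the right or to the
    left; the columns at its ends die in the movie if they lie below the row, and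
    are born if they lie above. One shape thus covers minima, maxima and
    crossings, with all orientations. The colour is that of the left column. *)
Record event := Event {
  ev_right : bool; ev_dieL : bool; ev_dieR : bool;
  ev_colour : Q; ev_over : option letter }.

Definition left_letter (e : event) : letter :=
  (ev_colour e, ev_dieL e (+) ev_right e).
Definition right_colour (e : event) : Q :=
  if ev_over e is Some l then act (ev_colour e) l else ev_colour e.
Definition right_letter (e : event) : letter :=
  (right_colour e, ev_dieR e == ev_right e).

Definition below_word (e : event) : seq letter :=
  let: Event _ dl dr _ m := e in
  nseq dl (left_letter e) ++ seq_of_opt m ++ nseq dr (right_letter e).
Definition above_word (e : event) : seq letter :=
  let: Event _ dl dr _ m := e in
  nseq (~~ dl) (left_letter e) ++ seq_of_opt m ++ nseq (~~ dr) (right_letter e).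

(** With [y] the colour to the left of the event, [z] is the colour on the
    initial side of the row near its left end. The initial side of the
    over-strand is its left one if [s], and then the left half of the row is the
    initial under-arc. The boolean is the sign of the crossing. *)
Definition crossing_tuple y (e : event) : option (3.-tuple Q * bool) :=
  if ev_over e is Some (b, s) then
    let a := ev_colour e in
    let z := if ev_right e == ev_dieL e then y ◀ a else y in
    Some (if s then [tuple z; a; b] else [tuple z ◀ b; a ◀ b; b],
          s == ev_right e)
  else None.

Definition event_chain y (e : event) : rack_chain Q 3 :=
  if crossing_tuple y e is Some (x, s) then
    if s then << x >> else - << x >>
  else 0.

Lemma acts_event y e : acts y (below_word e) = acts y (above_word e).
Proof.
case: e => r dl dr a [l|]; rewrite /below_word /above_word /left_letter
  /right_letter /right_colour /=.
  have E y' s : act (act y' (a, s)) l = act (act y' l) (act a l, s).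
    by rewrite act_act.
  have N y' b : act (act y' (b, true)) (b, false) = y'.
    by rewrite (actK y' (b, true)).
  have N' y' b : act (act y' (b, false)) (b, true) = y'.
    by rewrite (actK y' (b, false)).
  by case: r; case: dl; case: dr; rewrite /= ?E ?N ?N'.
have N y' b : act (act y' (b, true)) (b, false) = y'.
  by rewrite (actK y' (b, true)).
have N' y' b : act (act y' (b, false)) (b, true) = y'.
  by rewrite (actK y' (b, false)).
by case: r; case: dl; case: dr; rewrite /= ?N ?N'.
Qed.

Inductive movie (al : Q) : seq letter -> seq letter -> rack_chain Q 3 -> Prop :=
| movie_nil w : movie al w w 0
| movie_step u e v w d :
    movie al (u ++ above_word e ++ v) w d ->
    movie al (u ++ below_word e ++ v) w (event_chain (acts al u) e + d).

Lemma movie_trans al u v w c d :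
  movie al u v c -> movie al v w d -> movie al u w (c + d).
Proof.
elim=> [{}v|{}u e v' {}v {}c _ IH] vw; first by rewrite add0r.
by rewrite -addrA; apply: movie_step; exact: IH.
Qed.

Lemma movie1 al u e v :
  movie al (u ++ below_word e ++ v) (u ++ above_word e ++ v)
    (event_chain (acts al u) e).
Proof. by rewrite -[X in movie _ _ _ X]addr0; exact/movie_step/movie_nil. Qed.

Lemma movie_ctx al u v w w' d :
  movie (acts al u) w w' d -> movie al (u ++ w ++ v) (u ++ w' ++ v) d.
Proof.
elim=> [{}w|u' e v' {}w' {}d _ IH]; first exact: movie_nil.
have E x : u ++ (u' ++ x ++ v') ++ v = (u ++ u') ++ x ++ (v' ++ v).
  by rewrite !catA.
by move: IH; rewrite !E -acts_cat; exact: movie_step.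
Qed.

Lemma movie_acts al y w w' d : movie al w w' d -> acts y w = acts y w'.
Proof.
elim=> // u e v {}w' {}d _ <-; rewrite !acts_cat; congr acts.
exact: acts_event.
Qed.

(** A reflection in a horizontal line together with the reversal of all
    orientations preserves the letters of the columns, exchanges below and above,
    and changes the signs of the crossings. *)
Definition event_rev (e : event) : event :=
  Event (~~ ev_right e) (~~ ev_dieL e) (~~ ev_dieR e) (ev_colour e) (ev_over e).

Lemma below_word_rev e : below_word (event_rev e) = above_word e.
Proof. by case: e => [[] [] []]. Qed.
Lemma above_word_rev e : above_word (event_rev e) = below_word e.
Proof. by case: e => [[] [] []]. Qed.

Lemma event_chain_rev y e : event_chain y (event_rev e) = - event_chain y e.
Proof.
rewrite /event_chain /crossing_tuple.
by case: e => [[] [] [] a [[b []]|]] //=; rewrite ?opprK ?oppr0.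
Qed.

Lemma movie_rev al w w' d : movie al w w' d -> movie al w' w (- d).
Proof.
elim=> [{}w|u e v {}w' {}d _ IH]; first by rewrite oppr0; exact: movie_nil.
rewrite opprD addrC; apply: movie_trans IH _.
by have := movie1 al u (event_rev e) v; rewrite below_word_rev above_word_rev
  event_chain_rev.
Qed.

(** A minimum is an event without a crossing. *)
Lemma movie_create al u v l : movie al (u ++ v) (u ++ l :: linv l :: v) 0.
Proof.
have := movie1 al u (Event l.2 false false l.1 None) v.
rewrite /below_word /above_word /left_letter /right_letter /right_colour /=.
by rewrite /event_chain /=; case: l => a [].
Qed.

Lemma movie_createw al u v w : movie al (u ++ v) (u ++ w ++ winv w ++ v) 0.
Proof.
elim/last_ind: w u v => [|w l IH] u v; first exact: movie_nil.
rewrite -[X in movie _ _ _ X]addr0.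
apply: movie_trans (IH u v) _; rewrite winv_rcons -cats1 -!catA /=.
by rewrite !(catA u w); exact: movie_create.
Qed.

Lemma movie_cancelw al u v w : movie al (u ++ w ++ winv w ++ v) (u ++ v) 0.
Proof. by rewrite -oppr0; exact/movie_rev/movie_createw. Qed.

Lemma movie_cancelVw al u v w : movie al (u ++ winv w ++ w ++ v) (u ++ v) 0.
Proof. by have := movie_cancelw al u v (winv w); rewrite winvK. Qed.

(** The strands met around a crossing with under-arc [a] and over-arc [b]. *)
Definition square_word a b : seq letter :=
  [:: (a, true); (b, true); (a ◁ b, false); (b, false)].

(** Two nested minima yield a, b and their inverses in the opposite order, and
    then the inverse of a passes under that of b. *)
Lemma movie_square al u v a b y : acts al u = y ->
  movie al (u ++ v) (u ++ square_word a b ++ v) << [tuple y; a; b] >>.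
Proof.
move=> uy; rewrite -[X in movie _ _ _ X]add0r.
apply: (movie_trans (movie_create al u v (a, true))).
rewrite -[X in movie _ _ _ X]add0r.
have := movie_create al (u ++ [:: (a, true)]) ((a, false) :: v) (b, true).
rewrite -!catA /= => /movie_trans; apply.
have := movie1 al (u ++ [:: (a, true); (b, true)])
  (Event false false true (a ◁ b) (Some (b, false))) v.
rewrite /below_word /above_word /event_chain /left_letter /right_letter
  /right_colour /= -!catA /= acts_cat uy.
by rewrite -[true == false]/false /= /act /= qopD [_ ◀ (a ◁ b)]qopK !qopK.
Qed.

(** The letter passes under the letters of [u] one by one. Before each passage
    its colour is that of the region on its left, so that the first two entries
    of the triple agree. *)
Lemma movie_drag al u v s : exists2 d, d \in @degenerate Q 3 &
  movie al (u ++ (acts al u, s) :: v) ((al, s) :: u ++ v) d.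
Proof.
elim/last_ind: u v => [|u l IH] v.
  by exists 0; [exact: rpred0|exact: movie_nil].
have [d dD dM] := IH (l :: v).
pose e := Event s false true (acts al u) (Some l).
exists (event_chain (acts al u) e + d).
  rewrite rpredD// /event_chain /crossing_tuple /e /=.
  set a := acts al u; case: l {IH dM e} => b t /=.
  have -> : (if s == false then a ◀ a else a) = a by case: s; rewrite ?qopVxx.
  by case: t; case: s => /=; rewrite ?rpredN; apply: degenerateU;
    rewrite /degenerate_tuple /= eqxx.
have Es : (true == s) = s by case: (s).
have := movie1 al u e v; rewrite /below_word /above_word /e /left_letter
  /right_letter /right_colour /= Es -!cats1 -!catA /= acts_cat /=.
move=> /movie_trans; apply.
exact: dM.
Qed.

End Words.

(** * Filling closed words *)

Section Fillings.
Variables (Q : quandleType) (al : Q).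
Implicit Types (y a b : Q) (u v w p : seq (letter Q)).

Definition movd w w' (c : rack_chain Q 3) : Prop :=
  exists2 d, movie al w w' d & d - c \in @degenerate Q 3.

Lemma movie_movd w w' c : movie al w w' c -> movd w w' c.
Proof. by move=> wc; exists c => //; rewrite subrr rpred0. Qed.

Lemma movd_refl w : movd w w 0.
Proof. exact/movie_movd/movie_nil. Qed.

Lemma movd_trans u v w c d : movd u v c -> movd v w d -> movd u w (c + d).
Proof.
move=> [c' uv cc] [d' vw dd]; exists (c' + d'); first exact: movie_trans vw.
by rewrite opprD addrACA rpredD.
Qed.

Lemma movd_trans0 u v w : movd u v 0 -> movd v w 0 -> movd u w 0.
Proof. by move=> uv vw; rewrite -[0]addr0; exact: movd_trans vw. Qed.

Lemma movd_sym u v c : movd u v c -> movd v u (- c).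
Proof.
move=> [c' uv cc]; exists (- c'); first exact: movie_rev.
by rewrite -opprD rpredN.
Qed.

Lemma movd_sym0 u v : movd u v 0 -> movd v u 0.
Proof. by move=> /movd_sym; rewrite oppr0. Qed.

Lemma movd_ctx u v w w' c : acts al u = al -> movd w w' c ->
  movd (u ++ w ++ v) (u ++ w' ++ v) c.
Proof.
by move=> ua [c' ww cc]; exists c' => //; apply: movie_ctx; rewrite ua.
Qed.

Lemma movd_catl u w w' c : acts al u = al -> movd w w' c ->
  movd (u ++ w) (u ++ w') c.
Proof. by move=> ua /(movd_ctx [::] ua); rewrite !cats0. Qed.

Lemma movd_catr v w w' c : movd w w' c -> movd (w ++ v) (w' ++ v) c.
Proof. by move=> /(movd_ctx v (erefl : acts al [::] = al)). Qed.

Lemma closed_cat u v : acts al u = al -> acts al v = al -> acts al (u ++ v) = al.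
Proof. by rewrite acts_cat => ->. Qed.

Lemma closed_winv u : acts al u = al -> acts al (winv u) = al.
Proof. by move=> ua; rewrite -{1}ua acts_winv. Qed.

Definition comm u v : Prop := movd (u ++ v) (v ++ u) 0.

Lemma comm_sym u v : comm u v -> comm v u.
Proof. exact: movd_sym0. Qed.

Lemma comm_nil u : comm u [::].
Proof. by rewrite /comm cats0; exact: movd_refl. Qed.

Lemma comm_cat u v v' : acts al v = al ->
  comm u v -> comm u v' -> comm u (v ++ v').
Proof.
move=> va uv uv'; rewrite /comm catA.
apply: movd_trans0 (movd_catr v' uv) _.
by rewrite -!catA; apply: movd_catl.
Qed.

Lemma comm_winv u v : acts al v = al -> comm u v -> comm u (winv v).
Proof.
move=> va uv; have va' := closed_winv va.
apply: (@movd_trans0 _ (winv v ++ v ++ u ++ winv v)).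
  apply/movie_movd.
  by have := movie_createw al [::] (u ++ winv v) (winv v); rewrite winvK.
apply: (@movd_trans0 _ (winv v ++ (u ++ v) ++ winv v)).
  by rewrite (catA v); apply: movd_ctx => //; exact: movd_sym0.
apply/movie_movd.
by have := movie_cancelw al (winv v ++ u) [::] v; rewrite !cats0 -!catA.
Qed.

(** Since [u] is closed, the colour of the region to its right is [al], and
    the letter can be dragged through [u]. *)
Lemma comm_base u s : acts al u = al -> comm u [:: (al, s)].
Proof.
move=> ua; have [d dD] := movie_drag al u [::] s.
by rewrite ua cats0 => dM; exists d => //; rewrite subr0.
Qed.

(** With [l] the longitude these are the words of the peripheral subgroup. *)
Inductive peripheral (l : seq (letter Q)) : seq (letter Q) -> Prop :=
| peripheral_nil : peripheral l [::]
| peripheral_base s p : peripheral l p -> peripheral l ((al, s) :: p)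
| peripheral_loop p : peripheral l p -> peripheral l (l ++ p)
| peripheral_loopV p : peripheral l p -> peripheral l (winv l ++ p).

Lemma peripheral_cat l p q :
  peripheral l p -> peripheral l q -> peripheral l (p ++ q).
Proof.
move=> pp pq; elim: pp => //= [s p'|p'|p'] _ IH.
- by rewrite -?cat_cons; apply: peripheral_base.
- by rewrite -catA; apply: peripheral_loop.
- by rewrite -catA; apply: peripheral_loopV.
Qed.

Lemma peripheral_winv l p : peripheral l p -> peripheral l (winv p).
Proof.
have base s : peripheral l [:: (al, s)] by exact/peripheral_base/peripheral_nil.
have loop : peripheral l l.
  by have := peripheral_loop (peripheral_nil l); rewrite cats0.
have loopV : peripheral l (winv l).
  by have := peripheral_loopV (peripheral_nil l); rewrite cats0.
elim=> [|s {}p _ IH|{}p _ IH|{}p _ IH]; first exact: peripheral_nil.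
- by rewrite winv_cons -cats1; exact: peripheral_cat IH (base _).
- by rewrite winv_cat; exact: peripheral_cat IH loopV.
- by rewrite winv_cat winvK; exact: peripheral_cat IH loop.
Qed.

Section Peripheral.
Variable l : seq (letter Q).
Hypothesis l_closed : acts al l = al.

Lemma peripheral_closed p : peripheral l p -> acts al p = al.
Proof.
elim=> //= [s {}p _|{}p _|{}p _] IH; first by rewrite act_self.
- exact: closed_cat.
- exact/closed_cat/IH/closed_winv.
Qed.

Lemma comm_peripheral u p :
  acts al u = al -> comm u l -> peripheral l p -> comm u p.
Proof.
move=> ua ul; elim=> [|s {}p pp IH|{}p pp IH|{}p pp IH]; first exact: comm_nil.
- rewrite -cat1s; apply: comm_cat => //=; first exact: act_self.
  exact: comm_base.
- exact: comm_cat.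
- by apply: comm_cat => //; [exact: closed_winv|exact: comm_winv].
Qed.

Lemma peripheral_comm p q : peripheral l p -> peripheral l q -> comm p q.
Proof.
move=> pp pq; apply: comm_peripheral pq; first exact: peripheral_closed.
by apply/comm_sym/comm_peripheral => //; exact: movd_refl.
Qed.

Hypothesis closed_peripheral : forall w, acts al w = al ->
  exists p d, peripheral l p /\ movie al w p d.

(** The chains of the movies from [u] and [v] to peripheral words do not depend
    on whether the other word stands to the left, because it is closed; hence
    they cancel against the chains of the reversed movies. *)
Lemma closed_comm u v : acts al u = al -> acts al v = al -> comm u v.
Proof.
move=> ua va.
have [p [d [pp /movie_movd up]]] := closed_peripheral ua.
have [q [e [pq /movie_movd vq]]] := closed_peripheral va.
have pa := peripheral_closed pp; have qa := peripheral_closed pq.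
rewrite /comm (_ : 0 = d + (e + (0 + (- d + - e)))); last by rewrite add0r addrA -opprD subrr.
apply: movd_trans (movd_catr v up) _; apply: movd_trans (movd_catl pa vq) _.
apply: movd_trans (peripheral_comm pp pq) _.
apply: movd_trans (movd_catl qa (movd_sym up)) _.
exact: movd_catr (movd_sym vq).
Qed.

Section Blocks.
Variables (K : eqType) (blk : K -> seq (letter Q)).
Hypothesis blk_closed : forall k, acts al (blk k) = al.

Definition sblk (x : K * bool) := if x.2 then blk x.1 else winv (blk x.1).

Lemma sblk_closed x : acts al (sblk x) = al.
Proof. by rewrite /sblk; case: x.2 => //; exact: closed_winv. Qed.

Lemma sblks_closed T : acts al (flatten (map sblk T)) = al.
Proof. by elim: T => //= x T IH; apply: closed_cat => //; exact: sblk_closed. Qed.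

(** A loop and its inverse are brought next to each other and cancelled. *)
Lemma movd_balanced T :
  (forall k, count_mem (k, true) T = count_mem (k, false) T) ->
  movd (flatten (map sblk T)) [::] 0.
Proof.
have [n] := ubnP (size T); elim: n T => // n IH [|[k s] T] nT bal.
  exact: movd_refl.
have : (k, ~~ s) \in T.
  have := bal k; rewrite /= !xpair_eqE !eqxx /= -has_pred1 has_count.
  by case: (s) => /=; lia.
move=> kT; have [T1 [T2 ET]] : exists T1 T2, T = T1 ++ (k, ~~ s) :: T2.
  by case/splitPr: kT => T1 T2; exists T1, T2.
have : movd (flatten (map sblk (T1 ++ T2))) [::] 0.
  apply: IH => [|k']; first by move: nT; rewrite ET /= !size_cat /=; lia.
  have := bal k'; rewrite ET /= !count_cat /= !xpair_eqE.
  by case: (s); case: (k == k') => /=; lia.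
apply: movd_trans0; rewrite ET /= !map_cat !flatten_cat /=.
have c1 := sblks_closed T1.
apply: (@movd_trans0 _
  (flatten (map sblk T1) ++ sblk (k, s) ++ sblk (k, ~~ s) ++ flatten (map sblk T2))).
  rewrite !catA; do 2![apply: movd_catr]; apply: closed_comm => //.
  exact: sblk_closed.
apply: movie_movd; rewrite /sblk; case: (s) => /=.
- exact: movie_cancelw.
- exact: movie_cancelVw.
Qed.

End Blocks.

(** The signed edges that a path runs through: [(y, a)] stands for the edge from
    [y] to [y ◁ a], so that a negative letter runs backwards through an edge that
    starts where the letter ends. *)
Fixpoint trail y w : seq ((Q * Q) * bool) :=
  if w is l :: w' then
    ((if l.2 then y else act y l, l.1), l.2) :: trail (act y l) w'
  else [::].

Lemma trail_cat y u v : trail y (u ++ v) = trail y u ++ trail (acts y u) v.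
Proof. by elim: u y => //= l' u IH y; rewrite IH. Qed.

Definition edge_chain (T : seq ((Q * Q) * bool)) : rack_chain Q 2 :=
  \sum_(x <- T) (if x.2 then << [tuple x.1.1; x.1.2] >>
                 else - << [tuple x.1.1; x.1.2] >>).

Lemma edge_chain_cat S T : edge_chain (S ++ T) = edge_chain S + edge_chain T.
Proof. exact: big_cat. Qed.

Lemma edge_chain_winv y w :
  edge_chain (trail (acts y w) (winv w)) = - edge_chain (trail y w).
Proof.
elim: w y => [|[a s] w IH] y /=; first by rewrite /edge_chain big_nil oppr0.
rewrite winv_cons -cats1 trail_cat edge_chain_cat IH acts_winv.
rewrite /edge_chain big_seq1 big_cons opprD addrC; congr (_ + _).
case: s => /=; last by rewrite opprK.
by have := actK y (a, true); rewrite /linv /= => ->.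
Qed.

Lemma coeff_edge_chain T y a : coeff [tuple y; a] (edge_chain T) =
  (count_mem ((y, a), true) T)%:Z - (count_mem ((y, a), false) T)%:Z.
Proof.
elim: T => [|[[y' a'] s] T IH]; first by rewrite /edge_chain big_nil coeff0.
rewrite /edge_chain big_cons coeffD -/(edge_chain T) IH /=.
have E : ([tuple y'; a'] == [tuple y; a]) = ((y', a') == (y, a)).
  by rewrite -val_eqE /= eqseq_cons eqseq_cons eqxx andbT -xpair_eqE.
rewrite !xpair_eqE.
case: s => /=; rewrite ?coeffN coeffU mul1r E xpair_eqE;
  case: (y' == y); case: (a' == a) => /=; lia.
Qed.

Lemma count_trail y w (P : pred bool) :
  count (fun x => P x.2) (trail y w) = count (fun l => P l.2) w.
Proof. by elim: w y => //= l' w IH y; rewrite IH. Qed.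

Hypothesis connected : forall y, exists w, acts al w = y.

(** The empty tail at the base point makes the path of a closed word equal to
    the product of the loops of its edges in [movie_trail]. *)
Definition tail_word y : seq (letter Q) :=
  if y == al then [::] else projT1 (cid (connected y)).

Lemma tail_wordE y : acts al (tail_word y) = y.
Proof.
by rewrite /tail_word; case: eqP => [->//|_]; exact: projT2 (cid (connected y)).
Qed.

Definition edge_word (k : Q * Q) :=
  tail_word k.1 ++ (k.2, true) :: winv (tail_word (k.1 ◁ k.2)).

Lemma edge_word_closed k : acts al (edge_word k) = al.
Proof.
rewrite acts_cat /= tail_wordE /act /=.
by rewrite -{1}[_ ◁ _]tail_wordE acts_winv.
Qed.

(** Between successive letters a tail is inserted with its inverse. *)
Lemma movie_trail y w : movie al (tail_word y ++ w)
  (flatten (map (sblk edge_word) (trail y w)) ++ tail_word (acts y w)) 0.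
Proof.
elim: w y => [|[a s] w IH] y; first by rewrite cats0; exact: movie_nil.
rewrite /= -catA; set x := (X in sblk _ X).
have Ex : sblk edge_word x =
    tail_word y ++ (a, s) :: winv (tail_word (act y (a, s))).
  rewrite /x /sblk /edge_word /act; case: s {x} => //=.
  rewrite qopVK winv_cat winv_cons winvK.
  by rewrite -cats1 -catA /linv.
rewrite -[0]addr0.
apply: (@movie_trans _ _ _ (sblk edge_word x ++ tail_word (act y (a, s)) ++ w)).
  have := movie_createw al (tail_word y ++ [:: (a, s)]) w
    (winv (tail_word (act y (a, s)))).
  by rewrite winvK Ex -!catA.
have xa : acts al (sblk edge_word x) = al by exact/sblk_closed/edge_word_closed.
have := @movie_ctx _ al (sblk edge_word x) [::] (tail_word (act y (a, s)) ++ w).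
by rewrite xa => /(_ _ _ (IH _)); rewrite !cats0.
Qed.

(** Degenerate edges share one key because their loops are all equivalent to
    the letter [al], by [movie_drag]. *)
Definition trail_key (k : Q * Q) : option (Q * Q) :=
  if k.1 == k.2 then None else Some k.

Definition key_word (k : option (Q * Q)) : seq (letter Q) :=
  if k is Some k then edge_word k else [:: (al, true)].

Lemma key_word_closed k : acts al (key_word k) = al.
Proof. by case: k => [k|]; rewrite /= ?edge_word_closed ?act_self. Qed.

Lemma movd_key_word k : movd (edge_word k) (key_word (trail_key k)) 0.
Proof.
rewrite /trail_key; case: eqP => [kk|_] /=; last exact: movd_refl.
rewrite /edge_word -kk qopxx.
have [d dD dM] := movie_drag al (tail_word k.1) (winv (tail_word k.1)) true.
apply: (@movd_trans0 _
  ((al, true) :: tail_word k.1 ++ winv (tail_word k.1))); last first.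
  apply/movie_movd.
  by have := movie_cancelw al [:: (al, true)] [::] (tail_word k.1); rewrite !cats0.
by rewrite tail_wordE in dM; exists d; rewrite ?subr0.
Qed.

Lemma movd_winv u v : acts al u = al -> acts al v = al ->
  movd u v 0 -> movd (winv u) (winv v) 0.
Proof.
move=> ua va uv.
apply: (@movd_trans0 _ (winv u ++ v ++ winv v)).
  by apply/movie_movd; have := movie_createw al (winv u) [::] v; rewrite !cats0.
apply: (@movd_trans0 _ (winv u ++ u ++ winv v)).
  by apply: movd_ctx; [exact: closed_winv|exact: movd_sym0].
by apply/movie_movd; have := movie_cancelVw al [::] (winv v) u.
Qed.

Lemma movd_sblk_key x :
  movd (sblk edge_word x) (sblk key_word (trail_key x.1, x.2)) 0.
Proof.
case: x => k [] /=; first exact: movd_key_word.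
apply: movd_winv (movd_key_word k); first exact: edge_word_closed.
exact: key_word_closed.
Qed.

Lemma count_key (T : seq ((Q * Q) * bool)) (k : option (Q * Q) * bool) :
  count_mem k [seq (trail_key x.1, x.2) | x <- T] =
  count (fun x => (trail_key x.1, x.2) == k) T.
Proof. by rewrite count_map. Qed.

(** A homomorphism that vanishes on degenerate chains: it shows that the edges
    which are not degenerate are balanced in total, and hence so are the others. *)
Definition nondegenerate_weight (c : rack_chain Q 2) : int :=
  fglift (fun x => (~~ degenerate_tuple x)%:R : int^o) c.

Lemma nondegenerate_weight_additive : additive nondegenerate_weight.
Proof. exact: (@lift_is_additive int _ int^o). Qed.
HB.instance Definition _ :=
  GRing.isAdditive.Build _ _ nondegenerate_weight nondegenerate_weight_additive.

Lemma nondegenerate_weightU x :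
  nondegenerate_weight << x >> = (~~ degenerate_tuple x)%:R.
Proof. by rewrite /nondegenerate_weight liftU scale1r. Qed.

Lemma nondegenerate_weight0 c : c \in @degenerate Q 2 -> nondegenerate_weight c = 0.
Proof.
move=> /allP cD; rewrite -[c]freeg_sumE raddf_sum big_seq big1// => x /cD xD.
by rewrite /= /nondegenerate_weight liftU xD scaler0.
Qed.

Lemma nondegenerate_weight_edge_chain (S : seq ((Q * Q) * bool)) :
    nondegenerate_weight (edge_chain S) =
    (count (fun x => (x.1.1 != x.1.2) && (x.2 == true)) S)%:Z -
    (count (fun x => (x.1.1 != x.1.2) && (x.2 == false)) S)%:Z.
Proof.
elim: S => [|[[y a] s] S IH]; first by rewrite /edge_chain big_nil raddf0.
rewrite /edge_chain big_cons -/(edge_chain S) raddfD /= IH.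
case: s; rewrite /= ?raddfN /= nondegenerate_weightU /degenerate_tuple /= andbT negbK;
  by case: (y != a) => /=; lia.
Qed.

(** The loops around edges that are not degenerate are balanced edge by edge,
    since the edge chain is degenerate; the loops around degenerate edges are
    balanced in total, since the letters of [w] are. All these loops commute. *)
Lemma movd_null w : acts al w = al ->
  edge_chain (trail al w) \in @degenerate Q 2 ->
  count (fun l => l.2) w = count (fun l => ~~ l.2) w ->
  movd w [::] 0.
Proof.
move=> wa eD bal; pose T := trail al w.
apply: (@movd_trans0 _ (flatten (map (sblk edge_word) T))).
  apply/movie_movd; have := movie_trail al w.
  by rewrite wa /tail_word eqxx cats0.
pose T' := [seq (trail_key x.1, x.2) | x <- T].
(* the loops are replaced by those of their keys *)
apply: (@movd_trans0 _ (flatten (map (sblk key_word) T'))).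
  rewrite /T'; elim: T {T'} => [|x T IH]; first exact: movd_refl.
  rewrite /=; apply: movd_trans0 (movd_catr _ (movd_sblk_key x)) _.
  by apply: movd_catl => //; exact/sblk_closed/key_word_closed.
apply: movd_balanced => [k|k]; first exact: key_word_closed.
have Some_bal k' s : trail_key k' = Some k' ->
    count (fun x => (trail_key x.1, x.2) == (Some k', s)) T =
    count_mem (k', s) T.
  move=> kk; apply: eq_count => -[k0 s0] /=; rewrite !xpair_eqE; congr (_ && _).
  move: kk; rewrite /trail_key; case: (k' =P k0) => [<-|nk].
    by case: ifP => // _ _; rewrite !eqxx.
  move=> _; rewrite [RHS]eq_sym (introF eqP nk).
  by case: ifP => // _; apply/eqP => -[/esym].
have keyE k' : trail_key k' = Some k' ->
    count_mem (k', true) T = count_mem (k', false) T.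
  case: k' => y a; rewrite /trail_key /=; case: eqP => // /eqP ya _.
  apply/eqP; rewrite -eqz_nat -subr_eq0 -coeff_edge_chain.
  rewrite coeff_outdom//; apply/negP => /(allP eD).
  by rewrite /degenerate_tuple /= ya.
case: k => [k|].
  case: (eqVneq (trail_key k) (Some k)) => [kk|kN].
    by rewrite !count_key !Some_bal// keyE.
  rewrite !count_key !(eq_count (a2 := pred0)) ?count_pred0// => -[k' s] /=;
    rewrite xpair_eqE; apply/negP => /andP[/eqP k'k _]; move: k'k kN;
    rewrite /trail_key; case: ifP => // /negbT k'N [<-]; by rewrite (negbTE k'N) eqxx.
have NoneE s : count (fun x => (trail_key x.1, x.2) == (None, s)) T =
    count (fun x => (x.1.1 == x.1.2) && (x.2 == s)) T.
  apply: eq_count => -[[y a] t] /=; rewrite xpair_eqE /trail_key /=.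
  by case: (y == a).
rewrite !count_key !NoneE.
have := nondegenerate_weight_edge_chain T; rewrite nondegenerate_weight0//.
move=> /esym/eqP; rewrite subr_eq0 eqz_nat => /eqP.
have tot s : count (fun x => x.2 == s) T =
   (count (fun x => (x.1.1 == x.1.2) && (x.2 == s)) T +
    count (fun x => (x.1.1 != x.1.2) && (x.2 == s)) T)%N.
  elim: (T) => //= -[[y a] t] S /= ->.
  by case: (y == a); case: (t == s) => /=; lia.
have := tot true; have := tot false; rewrite !(count_trail _ _ (fun t => t == _)).
have E1 : count (fun l : letter Q => l.2 == true) w = count (fun l => l.2) w.
  by apply: eq_count => -[? []].
have E2 : count (fun l : letter Q => l.2 == false) w = count (fun l => ~~ l.2) w.
  by apply: eq_count => -[? []].
by rewrite E1 E2 bal; lia.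
Qed.

Definition signed_sum (S : seq ((3.-tuple Q) * bool)) : rack_chain Q 3 :=
  \sum_(x <- S) (if x.2 then << x.1 >> else - << x.1 >>).

Lemma signed_sumP (c : rack_chain Q 3) : exists S, c = signed_sum S.
Proof.
have zero : exists S, 0 = signed_sum S by exists [::]; rewrite /signed_sum big_nil.
have add c1 c2 : (exists S, c1 = signed_sum S) -> (exists S, c2 = signed_sum S) ->
    exists S, c1 + c2 = signed_sum S.
  by move=> [S1 ->] [S2 ->]; exists (S1 ++ S2); rewrite /signed_sum big_cat.
rewrite -[c]freeg_sumE; elim/big_ind: _ => // x _.
have one (s : bool) : exists S,
    (if s then << x >> else - << x >> : rack_chain Q 3) = signed_sum S.
  by exists [:: (x, s)]; rewrite /signed_sum big_seq1.
rewrite -(mulr1 (coeff x c)).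
case: (coeff x c) => n.
- elim: n => [|n IH]; first by rewrite mul0r freegU0.
  have -> : n.+1%:Z * 1 = n%:Z * 1 + 1 by lia.
  by rewrite -freegUD; apply: add IH (one true).
- elim: n => [|n IH].
    by have -> : Negz 0 * 1 = -1 by []; rewrite -freegUN; exact: (one false).
  have -> : Negz n.+1 * 1 = Negz n * 1 - 1 by lia.
  by rewrite -freegUB; apply: add IH (one false).
Qed.

(** The entries of [x] are the colours of the region, the under-arc and the
    over-arc at a crossing. *)
Definition crossing_word (x : 3.-tuple Q) : seq (letter Q) :=
  let w := tail_word (tnth x ord0) in
  w ++ square_word (tnth x (inord 1)) (tnth x (inord 2)) ++ winv w.

Lemma acts_square y a b : acts y (square_word a b) = y.
Proof. by rewrite /= /act /= qopD !qopK. Qed.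

Lemma crossing_word_closed x : acts al (crossing_word x) = al.
Proof.
rewrite !acts_cat acts_square tail_wordE.
by rewrite -{1}[tnth x _]tail_wordE acts_winv.
Qed.

Lemma tuple3E (x : 3.-tuple Q) :
  x = [tuple tnth x ord0; tnth x (inord 1); tnth x (inord 2)].
Proof.
apply: eq_from_tnth => -[[|[|[|]]]]//= i; rewrite [RHS](tnth_nth (tnth x ord0)) /=;
  by congr tnth; apply/val_inj; rewrite /= ?inordK.
Qed.

Lemma movie_crossing_word x : movie al [::] (crossing_word x) << x >>.
Proof.
rewrite -[<< x >>]add0r.
have := movie_createw al [::] [::] (tail_word (tnth x ord0)).
rewrite /= cats0 => /movie_trans; apply.
by rewrite [in << x >>](tuple3E x); exact/movie_square/tail_wordE.
Qed.

Lemma rack_boundary_tuple y a b : rack_boundary << [tuple y; a; b] >> =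
  (<< [tuple y ◁ b; a ◁ b] >> - << [tuple y; a] >>)
  - (<< [tuple y ◁ a; b] >> - << [tuple y; b] >>) :> rack_chain Q 2.
Proof.
rewrite /rack_boundary liftU scale1r /rack_boundary_gen.
rewrite !big_ord_recl big_ord0 /= addr0.
have E (f g : 2.-tuple Q) : tnth f ord0 = tnth g ord0 ->
    tnth f ord_max = tnth g ord_max -> f = g.
  move=> f0 f1; apply: eq_from_tnth => -[[|[|]]]//= i.
    by rewrite [Ordinal _](_ : _ = ord0)//; exact: val_inj.
  by rewrite [Ordinal _](_ : _ = ord_max)//; exact: val_inj.
set x := [tuple y; a; b].
have -> : face_act x ord0 = face x ord0.
  by apply: E; rewrite !tnth_mktuple.
have -> : face_act x (fintype.lift ord0 ord0) = [tuple y ◁ a; b].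
  by apply: E; rewrite !tnth_mktuple /= !(tnth_nth y).
have -> : face x (fintype.lift ord0 ord0) = [tuple y; b].
  by apply: E; rewrite !tnth_mktuple /= !(tnth_nth y).
have -> : face_act x (fintype.lift ord0 (fintype.lift ord0 ord0)) = [tuple y ◁ b; a ◁ b].
  by apply: E; rewrite !tnth_mktuple /= !(tnth_nth y).
have -> : face x (fintype.lift ord0 (fintype.lift ord0 ord0)) = [tuple y; a].
  by apply: E; rewrite !tnth_mktuple /= !(tnth_nth y).
rewrite subrr scaler0 add0r /bump /= subnn expr0 scale1r.
by rewrite [(2 - _)%N](_ : _ = 1%N)// expr1 scaleN1r addrC.
Qed.

(** The tails cancel, and the four edges of the square are the faces of [x];
    the two faces that omit the region colour cancel each other. *)
Lemma edge_chain_crossing_word x :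
  edge_chain (trail al (crossing_word x)) = - rack_boundary << x >>.
Proof.
rewrite {2}(tuple3E x) rack_boundary_tuple /crossing_word.
move: (tnth x ord0) (tnth x (inord 1)) (tnth x (inord 2)) => y a b.
rewrite !trail_cat !edge_chain_cat acts_square tail_wordE.
have -> : edge_chain (trail y (winv (tail_word y))) =
    - edge_chain (trail al (tail_word y)).
  by rewrite -{1}[y]tail_wordE edge_chain_winv.
rewrite addrC addrNK /= /act /=.
rewrite /edge_chain !big_cons big_nil /= addr0.
rewrite [(y ◁ a) ◁ b]qopD !qopK.
set p := << _ >>; set q := << _ >>; set r := << _ >>; set t := << _ >>.
by rewrite !opprB [RHS]addrC [RHS]addrACA [LHS]addrA.
Qed.

Lemma edge_chain_sblk x :
  edge_chain (trail al (sblk crossing_word x)) =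
  - rack_boundary (if x.2 then << x.1 >> else - << x.1 >>).
Proof.
case: x => x [] /=; first exact: edge_chain_crossing_word.
rewrite raddfN /= -edge_chain_crossing_word /sblk /=.
by rewrite -edge_chain_winv crossing_word_closed.
Qed.

(** The crossing words of the terms of [c] are created and their product,
    whose edge chain is minus the boundary of [c], is removed by [movd_null]. *)
Theorem cycle_movie (c : rack_chain Q 3) :
  rack_boundary c \in @degenerate Q 2 ->
  exists2 d, movie al [::] [::] d & d - c \in @degenerate Q 3.
Proof.
have [S ->] := signed_sumP c; move=> bD.
pose W := flatten (map (sblk crossing_word) S).
have cwc := crossing_word_closed.
have Wa : acts al W = al by exact: sblks_closed.
have WS : movd [::] W (signed_sum S).
  rewrite /W /signed_sum; elim: (S) => [|x T IH] /=.
    by rewrite big_nil; exact: movd_refl.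
  rewrite big_cons; set w := flatten _ in IH *.
  apply: (movd_trans (v := sblk crossing_word x)); last first.
    have := movd_catl (sblk_closed cwc x) IH.
    by rewrite cats0.
  case: x => x [] /=; first exact/movie_movd/movie_crossing_word.
  rewrite -[- _]add0r; apply: (movd_trans (v := crossing_word x ++ winv (crossing_word x))).
    by apply/movie_movd; have := movie_createw al [::] [::] (crossing_word x);
      rewrite !cats0.
  have := movd_catr (winv (crossing_word x))
    (movd_sym (movie_movd (movie_crossing_word x))).
  exact.
have [d Md dS] : movd [::] [::] (signed_sum S).
  rewrite -[signed_sum S]addr0; apply: movd_trans WS _.
  apply: movd_null => //.
    have -> : edge_chain (trail al W) = - rack_boundary (signed_sum S).
      rewrite /W /signed_sum; elim: (S) => [|x T IH] /=.
        by rewrite big_nil raddf0 oppr0 /edge_chain big_nil.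
      rewrite big_cons trail_cat edge_chain_cat (sblk_closed cwc) IH.
      by rewrite edge_chain_sblk raddfD opprD.
    by rewrite rpredN.
  (* W is balanced, as tails come with their inverses and squares are balanced *)
  have inv_bal w : count (fun l => l.2) (winv w) = count (fun l => ~~ l.2) w /\
      count (fun l => ~~ l.2) (winv w) = count (fun l => l.2) w.
    rewrite /winv !count_rev !count_map; split => //.
    by apply: eq_count => l' /=; rewrite negbK.
  have cw x : count (fun l => l.2) (crossing_word x) =
      count (fun l => ~~ l.2) (crossing_word x).
    rewrite /crossing_word !count_cat.
    by have [-> ->] := inv_bal (tail_word (tnth x ord0)); rewrite /= addnCA addnC; lia.
  rewrite /W; elim: (S) => //= -[x s] T IH; rewrite !count_cat IH; congr (_ + _)%N.
  rewrite /sblk; case: s => //=.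
  by have [-> ->] := inv_bal (crossing_word x).
by exists d.
Qed.

End Peripheral.
End Fillings.

(** * Components and segments *)

Lemma near_seq (T : Type) (F : set_system T) {FF : Filter F} (I : eqType)
    (s : seq I) (P : I -> T -> Prop) :
  (forall i, i \in s -> \forall x \near F, P i x) ->
  \forall x \near F, forall i, i \in s -> P i x.
Proof.
elim: s => [_|i s IH sP]; first exact: nearW.
have /IH {}IH : forall j, j \in s -> \forall x \near F, P j x.
  by move=> j js; apply: sP; rewrite inE js orbT.
have iP := sP i (mem_head _ _).
by apply: filterS2 iP IH => x ix sx j; rewrite inE => /predU1P[->|/sx].
Qed.

Lemma near_above (R : realType) (a x : R) : a < x -> \forall y \near x, a < y.
Proof. by move=> ax; apply: open_nbhs_nbhs; split; [exact: open_gt|]. Qed.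

Lemma near_below (R : realType) (a x : R) : x < a -> \forall y \near x, y < a.
Proof. by move=> xa; apply: open_nbhs_nbhs; split; [exact: open_lt|]. Qed.

Section ComponentTheory.
Variables (T : topologicalType) (A : set T).
Implicit Types (c : component A) (x y : T).

Lemma component_setE c x : component_set c x ->
  component_set c = connected_component A x.
Proof.
by case: c => C Cp /=; case: Cp => y Ay -> yx; exact: same_connected_component.
Qed.

Lemma component_sub c : component_set c `<=` A.
Proof. by case: c => C Cp /=; case: Cp => y Ay ->; exact: connected_component_sub. Qed.

Lemma component_connected c : connected (component_set c).
Proof. by case: c => C Cp /=; case: Cp => y Ay ->; exact: component_connected. Qed.

Lemma component_uniq c c' x : component_set c x -> component_set c' x -> c = c'.
Proof.
move=> /component_setE; case: c => C Cp /= CE /component_setE.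
case: c' => C' Cp' /= CE'; move: Cp Cp'; rewrite CE CE' => p p'.
by congr Component; exact: Prop_irrelevance.
Qed.

Lemma component_max c x (B : set T) :
  connected B -> B `<=` A -> B x -> component_set c x -> B `<=` component_set c.
Proof.
by move=> Bc BA Bx /component_setE ->; exact: connected_component_max.
Qed.

Lemma component_of x : A x -> exists c, component_set c x.
Proof.
move=> Ax; exists (Component (ex_intro2 _ _ x Ax erefl)) => /=.
exact: connected_component_refl.
Qed.

Lemma connected_locally_constant (B : set T) (P : T -> Prop) x y :
  connected B ->
  (forall z, B z -> \forall w \near z, B w -> (P w <-> P z)) ->
  B x -> B y -> P x -> P y.
Proof.
move=> Bc lc Bx By Px.
pose U := [set z | B z /\ P z].
have op (b : Prop -> Prop) : (b = id \/ b = not) ->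
    exists2 C : set T, open C & [set z | B z /\ b (P z)] = B `&` C.
  move=> bE; exists [set w | B w -> b (P w)]^°; first exact: open_interior.
  apply/seteqP; split => [z [Bz bz]|z [Bz zN]]; split => //=; last first.
    by have := interior_subset zN; exact.
  apply: filterS (lc z Bz) => w /= wz Bw.
  by have := wz Bw; case: bE bz => -> /=; tauto.
have [C Co CE] := op id (or_introl erefl).
have [C' Co' CE'] := op not (or_intror erefl).
suff : U = B by move=> UB; have : B y := By; rewrite -UB => -[].
apply: Bc; first by exists x.
  by exists C => //.
exists (~` C'); first exact: open_closedC.
have E' z : (B z /\ ~ P z) = (B z /\ C' z) by have := congr1 (@^~ z) CE'.
apply/seteqP; split => z [Bz Pz]; split => //.
- by move=> C'z; have : B z /\ C' z by []; rewrite -E' => -[].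
- by apply: contrapT => nP; apply: Pz; have [] : B z /\ C' z by rewrite -E'.
Qed.

Lemma component_const c (P : T -> Prop) x y :
  (forall z, A z -> \forall w \near z, A w -> (P w <-> P z)) ->
  component_set c x -> component_set c y -> P x -> P y.
Proof.
move=> lc; apply: connected_locally_constant; first exact: component_connected.
move=> z /component_sub /lc; apply: filterS => w wz /component_sub; exact: wz.
Qed.

End ComponentTheory.

Section PathComponent.
Variables (R : realType) (T : topologicalType) (A : set T).

Lemma connected_path (g : R -> T) (J : interval R) :
  continuous g -> connected (g @` [set` J]).
Proof.
move=> gc; apply: connected_continuous_connected.
  exact/connected_intervalP/interval_is_interval.
by apply: continuous_subspaceT => x; exact: gc.
Qed.

(** An initial piece of the curve is connected and hence lies in a single
    component, so that the default value is not taken. *)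
Lemma component_nearP (d : component A) (g : R -> T) :
  continuous g -> (\forall t \near 0^'+, A (g t)) ->
  \forall t \near 0^'+,
    component_set (xget d [set c | \forall t \near 0^'+, component_set c (g t)]) (g t).
Proof.
move=> gc gA; apply: (@xgetPex _ d [set c : component A |
  \forall t \near 0^'+, component_set c (g t)]).
have [e /= e0 eA] := gA.
have eA' t : 0 < t < e -> A (g t).
  by move=> /andP[t0 te]; apply: eA => //=; rewrite sub0r normrN gtr0_norm.
have e20 : 0 < e / 2 by rewrite divr_gt0.
have [c cP] := component_of (eA' (e / 2) (ltac:(lra))).
exists c => /=; exists e => //= t /=; rewrite sub0r normrN => te t0.
rewrite gtr0_norm// in te.
apply: (@component_max _ _ c (g (e / 2)) (g @` [set` `]0, e[%R])).
- exact: connected_path.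
- by move=> ? [r /=]; rewrite in_itv /= => r0 <-; exact: eA'.
- by exists (e / 2) => //=; rewrite in_itv /=; lra.
- by [].
- by exists t => //=; rewrite in_itv /= t0.
Qed.

Lemma component_nearE (d c : component A) (g : R -> T) :
  continuous g -> (\forall t \near 0^'+, component_set c (g t)) ->
  xget d [set c | \forall t \near 0^'+, component_set c (g t)] = c.
Proof.
move=> gc cg.
have gA : \forall t \near 0^'+, A (g t).
  by apply: filterS cg => t; exact: component_sub.
have dg := component_nearP d gc gA.
have [t [ct dt]] : exists t, component_set c (g t) /\ component_set
    (xget d [set c | \forall t \near 0^'+, component_set c (g t)]) (g t).
  by apply: (@filter_ex _ (0 : R)^'+); exact: filterI.
exact: component_uniq dt ct.
Qed.

End PathComponent.

Section Segments.
Variable R : realType.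
Implicit Types (e : edge R) (x y z : 'rV[R]_3) (s t : R).

Definition pt e t : 'rV[R]_3 := e.1 + t *: direction e.

Lemma ptE e t : (1 - t) *: e.1 + t *: e.2 = pt e t.
Proof. by rewrite /pt /direction scalerBl scale1r scalerBr -addrA (addrC (- _)). Qed.

Lemma pt0 e : pt e 0 = e.1.
Proof. by rewrite /pt scale0r addr0. Qed.

Lemma pt1 e : pt e 1 = e.2.
Proof. by rewrite /pt scale1r /direction addrC subrK. Qed.

Lemma segmentP e x : segment e x <-> exists2 t, 0 <= t <= 1 & x = pt e t.
Proof.
by split=> [[t /= t01 <-]|[t t01 ->]]; exists t => //; rewrite ptE.
Qed.

Lemma half_openP e x :
  half_open_segment e x <-> exists2 t, 0 <= t < 1 & x = pt e t.
Proof.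
by split=> [[t /= t01 <-]|[t t01 ->]]; exists t => //; rewrite ptE.
Qed.

Lemma openP e x : open_segment e x <-> exists2 t, 0 < t < 1 & x = pt e t.
Proof.
by split=> [[t /= t01 <-]|[t t01 ->]]; exists t => //; rewrite ptE.
Qed.

Lemma segment_pt e t : 0 <= t <= 1 -> segment e (pt e t).
Proof. by move=> t01; apply/segmentP; exists t. Qed.

Lemma proj_is_linear : linear (@proj R).
Proof. by move=> a x y; apply/rowP => j; rewrite !mxE. Qed.
HB.instance Definition _ :=
  GRing.isLinear.Build R 'rV[R]_3 'rV[R]_2 _ (@proj R) proj_is_linear.

Lemma height_is_linear : linear_for *%R (@height R).
Proof. by move=> a x y; rewrite /height !mxE. Qed.
HB.instance Definition _ :=
  GRing.isLinear.Build R 'rV[R]_3 R _ (@height R) height_is_linear.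

Lemma proj_height x y : proj x = proj y -> height x = height y -> x = y.
Proof.
move=> /rowP xy hxy; apply/rowP => -[[|[|[|//]]] i].
- by have := xy ord0; rewrite !mxE; congr (_ = _); congr (_ _ _);
    apply/val_inj; rewrite /= inordK.
- by have := xy ord_max; rewrite !mxE; congr (_ = _); congr (_ _ _);
    apply/val_inj; rewrite /= inordK.
- by move: hxy; rewrite /height; congr (_ = _); congr (_ _ _);
    apply/val_inj; rewrite /= inordK.
Qed.

Lemma proj_pt e t : proj (pt e t) = proj e.1 + t *: proj (direction e).
Proof. by rewrite /pt linearD linearZ. Qed.

Lemma pt_conv e s t l : pt e (s + l * (t - s)) = pt e s + l *: (pt e t - pt e s).
Proof.
by rewrite /pt opprD addrACA subrr add0r -scalerBl scalerA -addrA -scalerDl.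
Qed.

Lemma proj_pt_conv e s t l :
  proj (pt e (s + l * (t - s))) =
  proj (pt e s) + l *: (proj (pt e t) - proj (pt e s)).
Proof.
rewrite pt_conv; move: (pt e s) (pt e t) => x y.
by rewrite linearD linearZ linearB.
Qed.

Lemma conv01 s t l : 0 <= s <= 1 -> 0 <= t <= 1 -> 0 <= l <= 1 ->
  0 <= s + l * (t - s) <= 1.
Proof. by move=> /andP[? ?] /andP[? ?] /andP[? ?]; apply/andP; split; nra. Qed.

Lemma continuous_line (n : nat) (a v : 'rV[R]_n.+1) :
  continuous (fun t : R => a + t *: v).
Proof.
move=> t; apply: cvgD; first exact: cvg_cst.
by apply: cvgZl; exact: cvg_id.
Qed.

Lemma proj_continuous : continuous (@proj R).
Proof.
move=> x A /nbhs_ballP[e e0 eA]; apply/nbhs_ballP; exists e => // y xy.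
apply: eA; case: xy => ? xy; split => // i j; rewrite !mxE; exact: xy.
Qed.

Lemma segment_closed e : closed (segment e).
Proof.
apply: compact_closed => //.
have -> : segment e = (pt e) @` [set` `[0, 1]%R].
  apply/seteqP; split=> x.
    by move=> /segmentP[t t01 ->]; exists t => //=; rewrite in_itv.
  by move=> [t /=]; rewrite in_itv /= => t01 <-; exact: segment_pt.
apply: continuous_compact; last exact: segment_compact.
by apply: continuous_subspaceT => t; exact: continuous_line.
Qed.

Lemma proj_segment_closed e : closed (@proj R @` segment e).
Proof.
apply: compact_closed => //.
have -> : @proj R @` segment e =
    (fun t => proj e.1 + t *: proj (direction e)) @` [set` `[0, 1]%R].
  apply/seteqP; split=> x.
    move=> [y /segmentP[t t01 ->] <-].
    by exists t; rewrite ?proj_pt//= in_itv.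
  move=> [t /=]; rewrite in_itv /= => t01 <-; exists (pt e t); last exact: proj_pt.
  exact: segment_pt.
apply: continuous_compact; last exact: segment_compact.
by apply: continuous_subspaceT => t; exact: continuous_line.
Qed.

Lemma near_closed (T : topologicalType) (C : set T) (x : T) :
  closed C -> \forall y \near x, (C y -> C x).
Proof.
move=> Cc; have [Cx|nCx] := pselect (C x); first exact: nearW.
have : nbhs x (~` C) by apply: open_nbhs_nbhs; split => //; exact: closed_openC.
by apply: filterS => y /= nCy /nCy.
Qed.

Lemma det2_scale_parallel (v w : 'rV[R]_2) : det2 v w = 0 -> w != 0 ->
  exists a, v = a *: w.
Proof.
rewrite /det2 => vw w0.
have det : v 0 0 * w 0 1 = v 0 1 * w 0 0 by lra.
have [w00|w00] := eqVneq (w 0 0) 0; last first.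
  exists (v 0 0 / w 0 0); apply/rowP => -[[|[|//]] i]; rewrite mxE.
  - by rewrite (_ : Ordinal i = 0) ?divfK//; exact: val_inj.
  - rewrite (_ : Ordinal i = 1); last exact: val_inj.
    by rewrite mulrAC det mulfK.
have w01 : w 0 1 != 0.
  apply: contra w0 => /eqP w01; apply/eqP/rowP => -[[|[|//]] i]; rewrite mxE.
  - by rewrite (_ : Ordinal i = 0) ?w00//; exact: val_inj.
  - by rewrite (_ : Ordinal i = 1) ?w01//; exact: val_inj.
exists (v 0 1 / w 0 1); apply/rowP => -[[|[|//]] i]; rewrite mxE.
- rewrite (_ : Ordinal i = 0); last exact: val_inj.
  by rewrite mulrAC -det mulfK.
- by rewrite (_ : Ordinal i = 1) ?divfK//; exact: val_inj.
Qed.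

End Segments.

(** * The edges of a polygonal link *)

Section LinkEdges.
Variables (R : realType) (L : seq (polygon R)).
Hypothesis linkL : is_link L.
Local Notation E := (link_edges L).
Implicit Types (e : edge R) (z : 'rV[R]_3).

Lemma edges_fst (p : polygon R) : map fst (edges p) = p.
Proof. by rewrite -/unzip1 unzip1_zip// size_rot. Qed.

Lemma edges_snd (p : polygon R) : map snd (edges p) = rot 1 p.
Proof. by rewrite -/unzip2 unzip2_zip// size_rot. Qed.

Lemma link_edges_fst : map fst E = flatten L.
Proof.
rewrite /link_edges map_flatten -map_comp.
by rewrite (eq_map (g := id)) ?map_id// => p; exact: edges_fst.
Qed.

Lemma link_edges_snd : map snd E = flatten (map (rot 1) L).
Proof.
rewrite /link_edges map_flatten -map_comp; congr flatten.
by apply: eq_map => p; exact: edges_snd.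
Qed.

Lemma perm_link_edges : perm_eq (map snd E) (map fst E).
Proof.
rewrite link_edges_fst link_edges_snd.
by elim: L => //= p s IH; rewrite perm_cat ?perm_rot.
Qed.

Lemma half_open_disjoint e e' z : e \in E -> e' \in E ->
  half_open_segment e z -> half_open_segment e' z -> e = e'.
Proof.
move=> eE e'E ez e'z; have [_ _ tri] := linkL.
have := tri (index e E) (index e' E); rewrite /= !index_mem => /(_ eE e'E).
rewrite !nth_index// => h; rewrite -[LHS](nth_index (0, 0) eE).
by rewrite h ?nth_index//; exists z.
Qed.

Lemma half_open_fst e : half_open_segment e e.1.
Proof. by apply/half_openP; exists 0; rewrite ?pt0// lexx ltr01. Qed.

Lemma uniq_link_fst : uniq (map fst E).
Proof.
have [_ _ tri] := linkL; apply/(uniqP 0) => i j.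
rewrite !inE size_map => iE jE; rewrite !(nth_map (0, 0))// => ij.
apply: tri => //; exists (nth (0, 0) E i).1; split; first exact: half_open_fst.
by rewrite ij; exact: half_open_fst.
Qed.

Lemma uniq_link_edges : uniq E.
Proof. exact: map_uniq uniq_link_fst. Qed.

Lemma link_next e : e \in E -> exists2 e', e' \in E & e'.1 = e.2.
Proof.
move=> eE; have : e.2 \in map fst E.
  by rewrite -(perm_mem perm_link_edges) map_f.
by move=> /mapP[e' e'E ->]; exists e'.
Qed.

Lemma link_edge_neq e : e \in E -> e.1 != e.2.
Proof.
move=> /flattenP[_ /mapP[p pL ->] ep].
have [_ /allP/(_ _ pL) p3 _] := linkL.
have up : uniq p.
  have := uniq_link_fst; rewrite link_edges_fst.
  by move: pL; elim: L => //= q s IH; rewrite inE cat_uniq => /predU1P[->|/IH h]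
    /and3P[]// ? ? /h.
case: p p3 up {pL} ep => [|x s]//=.
rewrite ltnS => s0 /andP[xs us] ep; apply/eqP => ee.
have /(nthP (0, 0))[i ie ei] := ep.
move: ie; rewrite size_zip size_rot minnn => ip.
move: ei ee; rewrite /edges nth_zip ?size_rot// => <- /=.
rewrite rot1_cons nth_rcons.
case: ltnP => [ii|ii] /= h.
  have : uniq (x :: s) by rewrite /= xs.
  move=> /(uniqP 0)/(_ i i.+1); rewrite !inE /= => /(_ ip).
  by rewrite ltnS => /(_ ii h) /eqP; rewrite eqn_leq ltnn andbF.
have Ei : i = size s by move: ip; rewrite /= ltnS => ip; apply/eqP; rewrite eqn_leq ip.
move: h; rewrite Ei eqxx => h; move: xs.
by rewrite -h; case: (s) s0 => // y r _ /=; rewrite mem_nth.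
Qed.

Lemma pt_inj e s t : e \in E -> pt e s = pt e t -> s = t.
Proof.
move=> eE /addrI /eqP; rewrite -subr_eq0 -scalerBl scaler_eq0 subr_eq0.
move=> /predU1P[->//|/eqP d0]; have := link_edge_neq eE.
by rewrite eq_sym -subr_eq0 -/(direction e) d0 eqxx.
Qed.

Lemma half_open_pt e t : 0 <= t < 1 -> half_open_segment e (pt e t).
Proof. by move=> t01; apply/half_openP; exists t. Qed.

Lemma link_pt e t : e \in E -> 0 <= t <= 1 -> link_set L (pt e t).
Proof. by move=> eE t01; exists e => //; exact: segment_pt. Qed.

Lemma segment_ends e z : segment e z ->
  z = e.2 \/ half_open_segment e z.
Proof.
move=> /segmentP[t /andP[t0]]; rewrite le_eqVlt => /predU1P[->|t1] ->.
  by rewrite pt1; left.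
by right; apply: half_open_pt; rewrite t0.
Qed.

(** A terminal vertex is the initial vertex of the next edge, so that the
    disjointness of half-open edges decides all cases. *)
Lemma open_unique e e' t : e \in E -> e' \in E -> 0 < t < 1 ->
  segment e' (pt e t) -> e' = e.
Proof.
move=> eE e'E /andP[t0 t1] /segment_ends[]; last first.
  move=> h; apply: half_open_disjoint h _ => //; apply: half_open_pt.
  by rewrite ltW.
move=> te; have [e'' e''E e''1] := link_next e'E.
have ee'' : e = e''.
  apply: (half_open_disjoint (z := pt e t)) => //.
    by apply: half_open_pt; rewrite ltW.
  by rewrite te -e''1; exact: half_open_fst.
have : pt e t = pt e 0 by rewrite pt0 te -e''1 ee''.
by move=> /(pt_inj eE) t00; move: t0; rewrite t00 ltxx.
Qed.

End LinkEdges.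

Section Regular.
Variables (R : realType) (D : diagram R).
Local Notation E := (link_edges D).
Implicit Types (e : edge R) (x y z : 'rV[R]_3).

Let linkD := diagram_is_link D.

Lemma edge_vertex e : e \in E ->
  exists2 p, p \in (D : seq (polygon R)) & (e.1 \in p) && (e.2 \in p).
Proof.
move=> /flattenP[_ /mapP[p pL ->] ep]; exists p => //.
have -> : e.1 \in p by rewrite -(edges_fst p) map_f.
by rewrite -(mem_rot 1) -edges_snd map_f.
Qed.

Lemma regular_fst e x : e \in E -> link_set D x -> proj x = proj e.1 -> x = e.1.
Proof.
move=> /edge_vertex[p pD /andP[ep _]] xD; have [_ h] := diagram_regular D.
exact: h pD ep xD.
Qed.

Lemma regular_snd e x : e \in E -> link_set D x -> proj x = proj e.2 -> x = e.2.
Proof.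
move=> /edge_vertex[p pD /andP[_ ep]] xD; have [_ h] := diagram_regular D.
exact: h pD ep xD.
Qed.

Lemma proj_direction_neq0 e : e \in E -> proj (direction e) != 0.
Proof.
move=> eE; apply/eqP => d0; have /eqP[] := link_edge_neq linkD eE.
apply/esym/regular_fst => //.
  by rewrite -pt1; apply: link_pt => //; rewrite ler01 lexx.
by rewrite -pt1 proj_pt d0 scaler0 addr0.
Qed.

Lemma proj_pt_inj e s t : e \in E -> proj (pt e s) = proj (pt e t) -> s = t.
Proof.
move=> eE; rewrite !proj_pt => /addrI /eqP.
rewrite -subr_eq0 -scalerBl scaler_eq0 (negbTE (proj_direction_neq0 eE)) orbF.
by rewrite subr_eq0 => /eqP.
Qed.

Lemma proj_segment_inj e x y : e \in E -> segment e x -> segment e y ->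
  proj x = proj y -> x = y.
Proof.
by move=> eE /segmentP[s _ ->] /segmentP[t _ ->] /(proj_pt_inj eE) ->.
Qed.

(** Follow the line through the two points beyond the second one until it
    leaves the square. *)
Lemma exit_square (s1 s2 t1 t2 : R) : 0 <= s1 <= 1 -> 0 <= s2 <= 1 ->
  0 <= t1 <= 1 -> 0 <= t2 <= 1 -> s1 != s2 -> t1 != t2 ->
  exists l, [/\ 1 <= l, 0 <= s1 + l * (s2 - s1) <= 1,
    0 <= t1 + l * (t2 - t1) <= 1 &
    [\/ s1 + l * (s2 - s1) = 0, s1 + l * (s2 - s1) = 1,
        t1 + l * (t2 - t1) = 0 | t1 + l * (t2 - t1) = 1]].
Proof.
move=> s1I s2I t1I t2I ss tt.
have exit (a b : R) : 0 <= a <= 1 -> 0 <= b <= 1 -> a != b -> exists m,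
   [/\ 1 <= m, a + m * (b - a) = 0 \/ a + m * (b - a) = 1 &
     forall l, 0 <= l <= m -> 0 <= a + l * (b - a) <= 1].
  move=> /andP[a0 a1] /andP[b0 b1]; rewrite neq_lt => /orP[ab|ab].
    have d0 : 0 < b - a by rewrite subr_gt0.
    exists ((1 - a) / (b - a)); split.
    - by rewrite ler_pdivlMr// mul1r lerD2r.
    - by right; rewrite divfK ?gt_eqF// addrC subrK.
    - move=> l /andP[l0]; rewrite ler_pdivlMr// => l1; nra.
  have d0 : 0 < a - b by rewrite subr_gt0.
  exists (a / (a - b)); split.
  - by rewrite ler_pdivlMr// mul1r gerBl.
  - by left; rewrite -[b - a]opprB mulrN divfK ?gt_eqF// subrr.
  - by move=> l /andP[l0]; rewrite ler_pdivlMr// => l1; nra.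
have [m [m1 me mP]] := exit _ _ s1I s2I ss.
have [k [k1 ke kP]] := exit _ _ t1I t2I tt.
have [mk|km] := leP m k.
  exists m; split => //; [apply: mP; lra|apply: kP; lra|].
  by case: me => ->; [constructor 1|constructor 2].
exists k; split => //; [apply: mP; lra|apply: kP; lra|].
by case: ke => ->; [constructor 3|constructor 4].
Qed.

(** Otherwise the projections overlap along a segment, and on both sides the
    overlap ends at the projection of a vertex of one of the edges, where
    regularity forces the two points above it to coincide. Then the edges have a
    segment in common. *)
Lemma proj_edges_meet e e' s1 s2 t1 t2 : e \in E -> e' \in E ->
  0 <= s1 <= 1 -> 0 <= s2 <= 1 -> 0 <= t1 <= 1 -> 0 <= t2 <= 1 ->
  proj (pt e s1) = proj (pt e' t1) -> proj (pt e s2) = proj (pt e' t2) ->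
  s1 != s2 -> e = e'.
Proof.
move=> eE e'E.
have meet a b c d : 0 <= a <= 1 -> 0 <= b <= 1 -> 0 <= c <= 1 -> 0 <= d <= 1 ->
    proj (pt e a) = proj (pt e' c) -> proj (pt e b) = proj (pt e' d) -> a != b ->
    exists l m n, [/\ 1 <= l, m = a + l * (b - a), 0 <= m <= 1, 0 <= n <= 1
      & pt e m = pt e' n].
  move=> aI bI cI dI ac bd ab.
  have cd : c != d.
    apply: contra ab => /eqP cd; apply/eqP/(proj_pt_inj eE).
    by rewrite ac bd cd.
  have [l [l1 mI nI ends]] := exit_square aI bI cI dI ab cd.
  exists l, (a + l * (b - a)), (c + l * (d - c)); split => //.
  have pm : proj (pt e (a + l * (b - a))) = proj (pt e' (c + l * (d - c))).
    by rewrite !proj_pt_conv ac bd.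
  case: ends => h; move: pm (link_pt eE mI) (link_pt e'E nI); rewrite h.
  - by rewrite pt0 => pm _ xD; apply/esym/regular_fst.
  - by rewrite pt1 => pm _ xD; apply/esym/regular_snd.
  - by rewrite pt0 => pm xD _; apply/regular_fst.
  - by rewrite pt1 => pm xD _; apply/regular_snd.
move=> s1I s2I t1I t2I p1 p2 ss.
have [l [m [n [l1 mE mI nI pmn]]]] := meet _ _ _ _ s1I s2I t1I t2I p1 p2 ss.
have [l' [m' [n' [l'1 m'E m'I n'I pmn']]]] :=
  meet _ _ _ _ s2I s1I t2I t1I p2 p1 (ltac:(by rewrite eq_sym)).
have mm' : m != m'.
  rewrite -subr_eq0 mE m'E.
  have -> : s1 + l * (s2 - s1) - (s2 + l' * (s1 - s2)) =
    (l + l' - 1) * (s2 - s1) by ring.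
  by rewrite mulf_neq0 ?subr_eq0 1?eq_sym//; apply/eqP; lra.
have nn' : n != n'.
  apply: contra mm' => /eqP nn'; apply/eqP/(pt_inj linkD eE).
  by rewrite pmn pmn' nn'.
(* the midpoint of the common segment is interior to both edges *)
have mid (f : edge R) a b : pt f (a + 2^-1 * (b - a)) = 2^-1 *: (pt f a + pt f b).
  by rewrite pt_conv; apply/rowP => j; rewrite !mxE; lra.
have inner (a b : R) : 0 <= a <= 1 -> 0 <= b <= 1 -> a != b ->
    0 <= a + 2^-1 * (b - a) < 1.
  move=> /andP[a0 a1] /andP[b0 b1] ab; apply/andP; split; first lra.
  by move: ab; rewrite neq_lt => /orP[]; lra.
apply: (half_open_disjoint linkD eE e'E (z := pt e (m + 2^-1 * (m' - m)))).
  exact/half_open_pt/inner.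
by rewrite mid pmn pmn' -mid; exact/half_open_pt/inner.
Qed.

End Regular.

(** * Crossings, arcs and regions *)

Section Crossings.
Variables (R : realType) (D : diagram R).
Local Notation E := (link_edges D).
Implicit Types (e : edge R) (x y z : 'rV[R]_3) (c : edge R * edge R).

Let linkD := diagram_is_link D.

Lemma crossingsP c : c \in crossings D <->
  [/\ c.1 \in E, c.2 \in E & exists o u, crosses_at c o u].
Proof.
rewrite /crossings mem_filter; split.
  move=> /andP[/asboolP ou /allpairsP[[e e'] /= [eE e'E]]] cE.
  by rewrite cE in ou *.
move=> [c1 c2 ou]; apply/andP; split; first exact/asboolP.
by rewrite [c]surjective_pairing; exact: allpairs_f.
Qed.

Lemma uniq_crossings : uniq (crossings D).
Proof.
apply/filter_uniq/allpairs_uniq; try exact: uniq_link_edges.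
by move=> [a b] [a' b'] /=.
Qed.

Section OneCrossing.
Variable c : edge R * edge R.
Hypothesis cD : c \in crossings D.

Let c1E : c.1 \in E. Proof. by have /crossingsP[] := cD. Qed.
Let c2E : c.2 \in E. Proof. by have /crossingsP[] := cD. Qed.

Lemma crosses_atP : crosses_at c (over_point c) (under_point c).
Proof.
have /crossingsP[_ _ [ov [u ou]]] := cD.
rewrite /over_point /under_point /crossing_points.
by apply: (@xgetPex _ (0, 0) [set x | crosses_at c x.1 x.2]); exists (ov, u).
Qed.

Lemma not_ends e x y : e \in E -> segment e x -> link_set D y ->
  proj x = proj y -> x != y -> exists2 t, 0 < t < 1 & x = pt e t.
Proof.
move=> eE /segmentP[t /andP[t0 t1] ->] yD xy nxy; exists t => //.
rewrite !lt_def t0 t1 !andbT; apply/andP; split; apply/eqP => tE.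
  case/eqP: nxy; move: xy; rewrite tE pt0 => xy.
  exact/esym/(regular_fst eE yD)/esym.
case/eqP: nxy; move: xy; rewrite -tE pt1 => xy.
exact/esym/(regular_snd eE yD)/esym.
Qed.

Lemma over_under_neq : over_point c != under_point c.
Proof.
have [_ _ _ h] := crosses_atP; apply/eqP => ou.
by move: h; rewrite ou ltxx.
Qed.

Lemma over_param : exists2 s, 0 < s < 1 & over_point c = pt c.1 s.
Proof.
have [so su p h] := crosses_atP; apply: not_ends (p) _ => //.
  by exists c.2.
exact: over_under_neq.
Qed.

Lemma under_param : exists2 t, 0 < t < 1 & under_point c = pt c.2 t.
Proof.
have [so su p h] := crosses_atP; apply: not_ends (esym p) _ => //.
  by exists c.1.
by rewrite eq_sym; exact: over_under_neq.
Qed.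

Lemma crossing_edges_neq : c.1 != c.2.
Proof.
have [so su p _] := crosses_atP; apply: contra over_under_neq => /eqP cc.
by apply/eqP/(@proj_segment_inj _ D c.1) => //; rewrite cc.
Qed.

Lemma crosses_at_uniq o u : crosses_at c o u ->
  o = over_point c /\ u = under_point c.
Proof.
move=> [/segmentP[s sI ->] /segmentP[t tI ->] p _].
have [/segmentP[s' s'I Eo] /segmentP[t' t'I Eu] p' _] := crosses_atP.
rewrite Eo Eu in p' *.
have ss : s = s'.
  apply/eqP; apply: contraT => ss; case/eqP: crossing_edges_neq.
  exact: proj_edges_meet c1E c2E sI s'I tI t'I p p' ss.
split; first by rewrite ss.
by congr pt; apply: (proj_pt_inj c2E); rewrite -p -p' ss.
Qed.

(** Parallel projections through the crossing overlap near it. *)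
Lemma crossing_det_neq0 : crossing_det c != 0.
Proof.
apply/eqP => d0; have [a aE] := det2_scale_parallel d0 (proj_direction_neq0 c2E).
have [s /andP[s0 s1] sE] := over_param; have [t /andP[t0 t1] tE] := under_param.
have [_ _ p _] := crosses_atP; rewrite sE tE in p.
(* del is small enough for s + del and t + del * a to stay in the unit
   interval *)
pose m := Num.min t (1 - t) / (`|a| + 1).
have a1 : 0 < `|a| + 1 by rewrite ltr_wpDl.
have m0 : 0 < m by rewrite divr_gt0// lt_min t0 subr_gt0.
pose del := Num.min (1 - s) m.
have del0 : 0 < del by rewrite lt_min subr_gt0 s1.
have delm : del <= m by rewrite ge_min lexx orbT.
have dels : del <= 1 - s by rewrite ge_min lexx.
have ad : `|del * a| <= Num.min t (1 - t).
  rewrite normrM gtr0_norm//; apply: (@le_trans _ _ (m * (`|a| + 1))).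
    by apply: ler_pM => //; [exact: ltW|rewrite lerDl].
  by rewrite divfK ?gt_eqF.
have adt : `|del * a| <= t by apply: le_trans ad _; rewrite ge_min lexx.
have adt' : `|del * a| <= 1 - t by apply: le_trans ad _; rewrite ge_min lexx orbT.
move: adt adt'; rewrite !ler_norml => /andP[h1 h2] /andP[h3 h4].
have p2 : proj (pt c.1 (s + del)) = proj (pt c.2 (t + del * a)).
  move: p; rewrite !proj_pt !scalerDl !addrA => ->; congr (_ + _).
  by rewrite aE scalerA.
have ss : s != s + del by rewrite lt_eqF// ltrDl.
case/eqP: crossing_edges_neq.
apply: (proj_edges_meet c1E c2E _ _ _ _ p p2 ss); lra.
Qed.

Lemma over_crossing z : link_set D z -> proj z = proj (under_point c) ->
  z = over_point c \/ z = under_point c.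
Proof.
have [so su p _] := crosses_atP => zD zu.
have oD : link_set D (over_point c) by exists c.1.
have uD : link_set D (under_point c) by exists c.2.
have [reg _] := diagram_regular D.
have [|h|] := reg _ _ _ zD uD oD zu (esym p); [by right| |by left].
by have /eqP[] := over_under_neq.
Qed.

Lemma edges_at_crossing e z : e \in E -> segment e z ->
  proj z = proj (under_point c) -> e = c.1 \/ e = c.2.
Proof.
move=> eE ez zu; have zD : link_set D z by exists e.
have [s sI sE] := over_param; have [t tI tE] := under_param.
case: (over_crossing zD zu) => zE; move: ez; rewrite zE.
- by rewrite sE => ez; left; exact: (open_unique linkD c1E eE sI ez).
- by rewrite tE => ez; right; exact: (open_unique linkD c2E eE tI ez).
Qed.

Lemma under_points_under : under_points D (under_point c).
Proof.
have [so su p h] := crosses_atP; split; first by exists c.2.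
by exists (over_point c); split => //; exists c.1.
Qed.

Lemma over_link : link_set D (over_point c).
Proof. by have [so _ _ _] := crosses_atP; exists c.1. Qed.

End OneCrossing.

Lemma under_pointsP z : under_points D z <->
  exists2 c, c \in crossings D & z = under_point c.
Proof.
split=> [[[e' e'E e'z] [ov [[e eE eo] p h]]]|[c cD ->]]; last first.
  exact: under_points_under.
have cr : crosses_at (e, e') ov z by split.
have cD : (e, e') \in crossings D by apply/crossingsP; split => //; exists ov, z.
by exists (e, e') => //; have [] := crosses_at_uniq cD cr.
Qed.

Lemma crossing_inj c c' : c \in crossings D -> c' \in crossings D ->
  under_point c = under_point c' -> c = c'.
Proof.
move=> cD c'D uu; have [so su p h] := crosses_atP cD.
have [so' su' p' h'] := crosses_atP c'D.
have /crossingsP[c1 c2 _] := cD; have /crossingsP[c'1 c'2 _] := c'D.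
have [t tI tE] := under_param c'D; have [s sI sE] := over_param c'D.
have E2 : c.2 = c'.2 by apply: (open_unique linkD c'2 c2 tI); rewrite -tE -uu.
have oE : over_point c = over_point c'.
  have [//|ou] := over_crossing c'D (over_link cD) (etrans p (congr1 _ uu)).
  by case/eqP: (over_under_neq cD); rewrite ou uu.
have E1 : c.1 = c'.1 by apply: (open_unique linkD c'1 c1 sI); rewrite -sE -oE.
by rewrite [c]surjective_pairing [c']surjective_pairing E1 E2.
Qed.

(** Under-points accumulating at [x] would lie below some fixed edge, whose
    projection is closed and so contains that of [x]; this projection would meet
    that of [e] twice. *)
Lemma near_not_under e x : e \in E -> segment e x ->
  \forall z \near x, segment e z -> z <> x -> ~ under_points D z.
Proof.
move=> eE ex.
have : \forall z \near x, forall e', e' \in E ->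
    (@proj R @` segment e') (proj z) -> (@proj R @` segment e') (proj x).
  apply: (@near_seq _ _ (nbhs_filter x)) => e' e'E.
  have := near_closed (proj x) (@proj_segment_closed R e').
  by move=> /(@proj_continuous R x).
apply: filterS => z zP ez zx [zD [ov [[e' e'E e'o] oz h]]].
have [w e'o' o'x] : (@proj R @` segment e') (proj x).
  by apply: zP => //; exists ov.
move: ex ez e'o e'o' zx oz o'x h => /segmentP[t tI ->] /segmentP[s sI ->].
move=> /segmentP[s' s'I ->] /segmentP[t' t'I ->] zx ps pt' h.
have st : s != t by apply: contra_notN zx => /eqP ->.
have ee := proj_edges_meet eE e'E sI tI s'I t'I (esym ps) (esym pt') st.
move: h; rewrite -ee.
by rewrite -(proj_pt_inj eE (etrans (congr1 (fun f => proj (pt f s')) ee) ps)) ltxx.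
Qed.

End Crossings.

Section Arcs.
Variables (R : realType) (D : diagram R).
Local Notation E := (link_edges D).
Local Notation A := (link_set D `\` under_points D).
Implicit Types (e : edge R) (x y z : 'rV[R]_3) (a : arc D).

Let linkD := diagram_is_link D.

Definition free e (s t : R) : Prop :=
  forall l, 0 <= l <= 1 -> ~ under_points D (pt e (s + l * (t - s))).

Lemma arc_atP x : A x -> component_set (arc_at D x) x.
Proof.
move=> /component_of[a ax].
by apply: (@xgetPex _ point [set a : arc D | component_set a x]); exists a.
Qed.

Lemma arc_atE a x : component_set a x -> arc_at D x = a.
Proof.
move=> ax; apply: component_uniq (ax); apply: arc_atP.
exact: component_sub ax.
Qed.

Lemma freeC e s t : free e s t -> free e t s.
Proof.
move=> st l /andP[l0 l1]; rewrite (_ : t + l * _ = s + (1 - l) * (t - s)).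
  by apply: st; rewrite subr_ge0 l1 gerBl.
by ring.
Qed.

Lemma arc_free e s t a : e \in E -> 0 <= s <= 1 -> 0 <= t <= 1 ->
  free e s t -> component_set a (pt e s) -> component_set a (pt e t).
Proof.
move=> eE sI tI st as_.
pose g l := pt e (s + l * (t - s)).
apply: (@component_max _ _ a (pt e s) (g @` [set` `[0, 1]%R])).
- apply: connected_path => l; apply: (@continuous_comp _ _ _
    (fun l : R => s + l * (t - s)) (pt e)); last exact: continuous_line.
  by apply: cvgD; [exact: cvg_cst|apply: cvgMl; exact: cvg_id].
- move=> z [l /=]; rewrite in_itv /= => lI <-; split; last exact: st.
  exact/link_pt/conv01.
- by exists 0; rewrite /= ?in_itv /= ?lexx ?ler01// /g mul0r addr0.
- by [].
- by exists 1; rewrite /= ?in_itv /= ?lexx ?ler01// /g mul1r addrC subrK.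
Qed.

Lemma free_arc e s t l : 0 <= l <= 1 -> e \in E -> 0 <= s <= 1 -> 0 <= t <= 1 ->
  free e s t -> A (pt e (s + l * (t - s))).
Proof. by move=> lI eE sI tI st; split; [exact/link_pt/conv01|exact: st]. Qed.

Lemma free_arcl e s t : e \in E -> 0 <= s <= 1 -> 0 <= t <= 1 ->
  free e s t -> A (pt e s).
Proof.
move=> eE sI tI st; have := free_arc (l := 0) _ eE sI tI st.
by rewrite mul0r addr0; apply; rewrite lexx ler01.
Qed.

Lemma arc_at_free e s t : e \in E -> 0 <= s <= 1 -> 0 <= t <= 1 ->
  free e s t -> arc_at D (pt e s) = arc_at D (pt e t).
Proof.
move=> eE sI tI st; apply/esym/arc_atE/(arc_free eE sI tI st)/arc_atP.
exact: free_arcl tI st.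
Qed.

(** Every point of an arc near [x], even if [x] is a vertex, is joined to [x] by
    a piece of an edge without under-points; so the property is locally constant
    on the arc. *)
Lemma arc_label (P : 'rV[R]_3 -> Prop) a x y :
  (forall e s t, e \in E -> 0 <= s <= 1 -> 0 <= t <= 1 -> free e s t ->
     P (pt e s) -> P (pt e t)) ->
  component_set a x -> component_set a y -> P x -> P y.
Proof.
move=> lab; apply: component_const => {}x [xD xN].
have : \forall z \near x, forall e, e \in E ->
    (segment e z -> segment e x) /\
    (segment e x -> segment e z -> z <> x -> ~ under_points D z).
  apply: (@near_seq _ _ (nbhs_filter x)) => e eE; apply: (@filterI _ _ (nbhs_filter x)).
    exact: (near_closed x (@segment_closed R e)).
  have [ex|ex] := pselect (segment e x).
    by apply: (@filterS _ _ (nbhs_filter x)) (near_not_under eE ex) => z h _.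
  by apply: (@nearW _ _ _ (nbhs_filter x)) => z /ex.
move=> /nbhs_ballP[eps /= eps0 epsP].
apply/nbhs_ballP; exists eps => //= z zB [[e eE ez] zN].
have ex := (epsP _ zB e eE).1 ez.
move: (ex) (ez) => /segmentP[t tI xE] /segmentP[s sI zE].
suff ts : free e t s.
  rewrite xE zE; split; apply: lab => //; exact: freeC.
move=> l lI; have [->|zx] := pselect (pt e (t + l * (s - t)) = x) => //.
apply: (epsP _ _ e eE).2 => //; last exact/segment_pt/conv01.
rewrite pt_conv -xE -zE -ball_normE /ball_ /= opprD addNKr normrN.
move: zB; rewrite -ball_normE /ball_ /= distrC; apply: le_lt_trans.
have /andP[l0 l1] := lI.
by rewrite normrZ ger0_norm// ler_piMl.
Qed.

(** The arc that an edge enters at an under-point is that of any point of the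
    edge which is reached before the next under-point. *)
Lemma arc_near_edge e tau s d (g : R -> 'rV[R]_3) : e \in E ->
  0 <= tau <= 1 -> 0 <= s <= 1 -> 0 < (s - tau) * d ->
  (forall l, 0 < l <= 1 -> ~ under_points D (pt e (tau + l * (s - tau)))) ->
  (forall t, g t = pt e (tau + t * d)) ->
  arc_near D g = arc_at D (pt e s).
Proof.
move=> eE tI sI sd fr gE.
have -> : g = fun t => pt e (tau + t * d) by apply/funext.
have d0 : d != 0 by apply: contraTneq sd => ->; rewrite mulr0 ltxx.
have st0 : s - tau != 0 by apply: contraTneq sd => ->; rewrite mul0r ltxx.
apply: component_nearE.
  move=> l; apply: (@continuous_comp _ _ _
    (fun l : R => tau + l * d) (pt e)); last exact: continuous_line.
  by apply: cvgD; [exact: cvg_cst|apply: cvgMl; exact: cvg_id].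
have k0 : 0 < (s - tau) / d.
  rewrite (_ : _ / _ = (s - tau) * d / d ^+ 2); last by rewrite expr2 invfM mulrA mulfK.
  by rewrite divr_gt0// exprn_even_gt0.
exists ((s - tau) / d) => //= t /=; rewrite sub0r normrN => tk t0.
rewrite gtr0_norm// in tk.
pose l := t * d / (s - tau).
have lI : 0 < l <= 1.
  rewrite /l -mulrA -[d / _]invrK invf_div divr_gt0//=.
  by rewrite ler_pdivrMr// mul1r ltW.
have tl : tau + t * d = tau + l * (s - tau) by rewrite /l divfK.
have /andP[l0 l1] := lI.
have tdI : 0 <= tau + t * d <= 1 by rewrite tl; apply: conv01 => //; rewrite l1 ltW.
have fr1 : free e s (tau + t * d).
  move=> m /andP[m0 m1]; rewrite tl.
  rewrite (_ : s + m * _ = tau + (1 - m * (1 - l)) * (s - tau)); last by ring.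
  by apply: fr; apply/andP; split; nra.
apply: arc_free (fr1) _ => //; apply: arc_atP; exact: free_arcl fr1.
Qed.

Lemma under_iniE c tau s : c \in crossings D -> under_point c = pt c.2 tau ->
  0 <= tau <= 1 -> 0 <= s <= 1 -> 0 < (tau - s) * crossing_det c ->
  (forall l, 0 < l <= 1 -> ~ under_points D (pt c.2 (tau + l * (s - tau)))) ->
  under_ini D c = arc_at D (pt c.2 s).
Proof.
move=> /crossingsP[_ c2 _] uE tI sI sd fr.
apply: (arc_near_edge (d := - crossing_det c) c2 tI sI _ fr).
  by rewrite mulrN -mulNr opprB.
by move=> t; rewrite uE /pt mulrN scalerDl scaleNr addrA.
Qed.

Lemma under_terE c tau s : c \in crossings D -> under_point c = pt c.2 tau ->
  0 <= tau <= 1 -> 0 <= s <= 1 -> 0 < (s - tau) * crossing_det c ->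
  (forall l, 0 < l <= 1 -> ~ under_points D (pt c.2 (tau + l * (s - tau)))) ->
  under_ter D c = arc_at D (pt c.2 s).
Proof.
move=> /crossingsP[_ c2 _] uE tI sI sd fr.
apply: (arc_near_edge (d := crossing_det c) c2 tI sI _ fr) => //.
by move=> t; rewrite uE /pt scalerDl addrA.
Qed.

End Arcs.

Section Regions.
Variables (R : realType) (D : diagram R).
Local Notation E := (link_edges D).
Local Notation B := (~` (@proj R @` link_set D)).
Implicit Types (e : edge R) (z : 'rV[R]_3) (p v : 'rV[R]_2) (r : region D).

Let linkD := diagram_is_link D.

Lemma det2Zl a v w : det2 (a *: v) w = a * det2 v w :> R.
Proof. by rewrite /det2 !mxE; ring. Qed.

Lemma det2_self v : det2 v v = 0 :> R.
Proof. by rewrite /det2; ring. Qed.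

(** A ray that is transverse to all the edges over its origin leaves the
    projections of the other edges at a positive distance at first. *)
Lemma region_nearP r0 p v :
  (forall e z, e \in E -> segment e z -> proj z = p ->
     det2 v (proj (direction e)) != 0) ->
  \forall t \near 0^'+,
    component_set (region_near r0 (fun t => p + t *: v)) (p + t *: v).
Proof.
move=> tr; apply: component_nearP; first exact: continuous_line.
have : \forall t \near 0^'+, forall e, e \in E ->
    (@proj R @` segment e) (p + t *: v) -> (@proj R @` segment e) p.
  apply: (@near_seq _ _ (at_right_proper_filter (0:R))) => e eE.
  have := near_closed p (@proj_segment_closed R e).
  have c0 : (fun t : R => p + t *: v) t @[t --> 0^'+] --> p.
    have h : p + t *: v @[t --> (0 : R)] --> p + 0 *: v :=
      @continuous_line R 1 p v 0.
    by rewrite scale0r addr0 in h; exact: cvg_at_right_filter.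
  by move=> /c0.
move=> near_p; apply: filterS2 near_p (nbhs_right_gt 0) => t tP t0.
move=> [z [e eE ez] zE].
have [z' ez' z'p] : (@proj R @` segment e) p by apply: tP eE _; exists z.
have /eqP := tr e z' eE ez' z'p; apply.
move: ez ez' zE z'p => /segmentP[a _ ->] /segmentP[b _ ->].
rewrite !proj_pt => ab pE; rewrite -pE in ab.
move: ab => /esym; rewrite -addrA => /addrI ab.
have vE : t *: v = (a - b) *: proj (direction e).
  by rewrite scalerBl -ab addrAC subrr add0r.
have : t * det2 v (proj (direction e)) = 0.
  by rewrite -det2Zl vE det2Zl det2_self mulr0.
by move=> /eqP; rewrite mulf_eq0 gt_eqF//= => /eqP.
Qed.

Lemma left_normal_det2 v : v != 0 -> 0 < det2 v (left_normal v) :> R.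
Proof.
move=> v0; have -> : det2 v (left_normal v) = v 0 0 ^+ 2 + v 0 1 ^+ 2.
  by rewrite /det2 /left_normal !mxE /=; ring.
rewrite lt_def addr_ge0 ?sqr_ge0// andbT paddr_eq0 ?sqr_ge0// !sqrf_eq0.
apply: contra v0 => /andP[/eqP v00 /eqP v01]; apply/eqP/rowP.
move=> -[[|[|//]] i]; rewrite mxE.
- by rewrite (_ : Ordinal i = 0) ?v00//; exact: val_inj.
- by rewrite (_ : Ordinal i = 1) ?v01//; exact: val_inj.
Qed.

Lemma det2C v w : det2 v w = - det2 w v :> R.
Proof. by rewrite /det2; ring. Qed.

Lemma region_near_edge r0 e x (a : R) : e \in E -> open_segment e x ->
  (forall y, link_set D y -> proj y = proj x -> y = x) -> a != 0 ->
  let n := left_normal (proj (direction e)) in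
  \forall t \near 0^'+,
    component_set (region_near r0 (fun t => proj x + t *: (a *: n)))
      (proj x + t *: (a *: n)).
Proof.
move=> eE /openP[s sI xE] only a0 n.
apply: region_nearP => e' z e'E e'z zx.
have zD : link_set D z by exists e'.
have -> : e' = e.
  by apply: (open_unique linkD eE e'E sI); rewrite -xE -(only z zD zx).
rewrite det2Zl mulf_neq0// det2C oppr_eq0 gt_eqF//.
exact/left_normal_det2/(@proj_direction_neq0 _ D).
Qed.

Lemma region_iniP c r0 : c \in crossings D ->
  let v := crossing_det c *: (proj (direction c.1) - proj (direction c.2)) in
  \forall t \near 0^'+,
    component_set (region_ini c r0) (proj (under_point c) + t *: v).
Proof.
move=> cD v.
have -> : region_ini c r0 =
    region_near r0 (fun t => proj (under_point c) + t *: v).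
  by rewrite /region_ini; congr region_near; apply/funext => t; rewrite scalerA.
apply: region_nearP => e z eE ez zu.
have d0 := crossing_det_neq0 cD.
rewrite /v det2Zl mulf_neq0//.
have [->|->] := edges_at_crossing cD eE ez zu.
  rewrite (_ : det2 _ _ = crossing_det c)//.
  by rewrite /crossing_det /det2 !mxE; ring.
rewrite (_ : det2 _ _ = crossing_det c)//.
by rewrite /crossing_det /det2 !mxE; ring.
Qed.

Lemma region_colour_uniq (Z : Type) (lam : 'rV[R]_2 -> Z) r p
    (q : 'rV[R]_2) :
  (forall z : 'rV[R]_2, B z -> \forall w \near z, B w -> lam w = lam z) ->
  component_set r p -> component_set r q -> lam p = lam q.
Proof.
move=> lc rp rq; apply/esym.
apply: (component_const (P := fun w => lam w = lam p) _ rp rq erefl) => z Bz.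
by apply: filterS (lc z Bz) => w wz Bw; rewrite wz.
Qed.

End Regions.

(** * Polygons from edges *)

Section PolygonsFromEdges.
Variables (R : realType) (E : seq (edge R)).
Hypothesis snd_inj : {in E &, injective snd}.
Hypothesis follows : forall e, e \in E -> exists2 e', e' \in E & e'.1 = e.2.
Hypothesis no_loop : forall e, e \in E -> e.1 != e.2.
Hypothesis no_digon :
  forall e e', e \in E -> e' \in E -> e.1 = e'.2 -> e.2 = e'.1 -> False.

Local Notation T := (seq_sub E).

Definition next_edge (e : T) : T := odflt e [pick e' : T | (val e').1 == (val e).2].

Lemma next_edgeP e : (val (next_edge e)).1 = (val e).2.
Proof.
rewrite /next_edge; case: pickP => [e' /eqP //|none].
have [e' e'E e'1] := follows (valP e).
by have := none (Sub e' e'E); rewrite SubK e'1 eqxx.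
Qed.

Lemma next_edge_inj : injective next_edge.
Proof.
move=> e e' ee; apply/val_inj/snd_inj; try exact: valP.
by rewrite -!next_edgeP ee.
Qed.

Lemma fcycle_map_rot (s : seq T) : fcycle next_edge s -> map next_edge s = rot 1 s.
Proof.
case: s => // x s; rewrite rot1_cons /=.
have h : forall y t, fpath next_edge y t -> map next_edge (belast y t) = t.
  by move=> y t; elim: t y => //= z t IH y /andP[/eqP -> /IH ->].
by move=> /h; rewrite belast_rcons.
Qed.

Lemma edges_fcycle (s : seq T) : fcycle next_edge s ->
  edges [seq (val e).1 | e <- s] = map val s.
Proof.
move=> /fcycle_map_rot sr; rewrite /edges -map_rot -sr -map_comp.
elim: (s) => //= e t ->; congr cons.
by rewrite [RHS]surjective_pairing next_edgeP.
Qed.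

Lemma orbit_size3 (x : T) : (2 < size (orbit next_edge x))%N.
Proof.
rewrite /orbit size_traject.
have := cycle_orbit next_edge_inj x; rewrite /orbit.
move: (order_gt0 next_edge x); case: (order next_edge x) => [|[|[|n]]]//= _.
- rewrite andbT => /eqP xx; have /eqP[] := no_loop (valP x).
  by rewrite -{1}xx next_edgeP.
- move=> /and3P[_ /eqP xx _]; exfalso.
  apply: (no_digon (valP x) (valP (next_edge x))); last by rewrite next_edgeP.
  by rewrite -next_edgeP xx.
Qed.

(** The orbit of an edge is a polygon, and the remaining edges are still closed
    under passing to the next edge. *)
Lemma polygons_of_closed (S : seq T) : uniq S ->
  (forall x, x \in S -> next_edge x \in S) ->
  exists L : seq (polygon R), perm_eq (link_edges L) (map val S) /\
    all (fun p : polygon R => 2 < size p)%N L.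
Proof.
have [n] := ubnP (size S); elim: n S => // n IH [|x S] nS uS clS.
  by exists [::].
pose orb := orbit next_edge x.
have orbP y : (y \in orb) = fconnect next_edge x y by rewrite -fconnect_orbit.
have orbS y : y \in orb -> y \in x :: S.
  rewrite orbP => /iter_findex <-; elim: (findex _ _ _) => [|k IHk] /=.
    exact: mem_head.
  exact: clS.
pose S' := [seq y <- x :: S | y \notin orb].
have [|||L [LS L3]] := IH S'.
- rewrite /S' /= orbP connect0 /=.
  by rewrite size_filter (leq_ltn_trans (count_size _ _)).
- exact: filter_uniq.
- move=> y; rewrite !mem_filter => /andP[yo /clS ->]; rewrite andbT.
  apply: contra yo; rewrite !orbP => h.
  by rewrite (same_fconnect1_r next_edge_inj).
exists ([seq (val e).1 | e <- orb] :: L); split; last first.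
  by rewrite /= L3 andbT size_map orbit_size3.
rewrite /link_edges /= -/(link_edges L) edges_fcycle; last exact: cycle_orbit next_edge_inj x.
apply: perm_trans (perm_cat (perm_refl _) LS) _.
rewrite -map_cat; apply: (@perm_map _ _ _ _ (x :: S)).
apply: (@perm_trans _ ([seq y <- x :: S | y \in orb] ++ S')); last first.
  by rewrite perm_filterC.
rewrite perm_cat2r; apply: uniq_perm; first exact: orbit_uniq.
  exact: filter_uniq.
by move=> y; rewrite mem_filter; case: (boolP (y \in orb)) => //= /orbS ->.
Qed.

Lemma polygons_of_edges : uniq E ->
  exists L : seq (polygon R), perm_eq (link_edges L) E /\
    all (fun p : polygon R => 2 < size p)%N L.
Proof.
move=> uE; have [||L [LE L3]] := @polygons_of_closed (enum {: T}).
- exact: enum_uniq.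
- by move=> x _; rewrite mem_enum.
exists L; split => //; apply: perm_trans LE _.
apply: uniq_perm => //; first by rewrite map_inj_uniq ?enum_uniq//; exact: val_inj.
move=> e; apply/mapP/idP => [[x _ ->]|eE]; first exact: valP.
by exists (Sub e eE); rewrite ?mem_enum ?SubK.
Qed.

End PolygonsFromEdges.

(** * One layer of a grid diagram *)

Section Coordinates.
Variable R : realType.
Implicit Types (x y : R) (z : 'rV[R]_3) (n : nat).

Definition plane_point x y : 'rV[R]_2 := \row_(j < 2) (if j == 0 then x else y).

Lemma plane_pointE (p : 'rV[R]_2) : p = plane_point (p 0 0) (p 0 1).
Proof.
apply/rowP => -[[|[|//]] i]; rewrite !mxE.
- by congr (p _ _); exact: val_inj.
- by congr (p _ _); exact: val_inj.
Qed.

Lemma plane_pointX x y : plane_point x y 0 0 = x. Proof. by rewrite mxE. Qed.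
Lemma plane_pointY x y : plane_point x y 0 1 = y. Proof. by rewrite mxE. Qed.

(** Vertices at odd levels, where the rows are, have the height -1, and those at
    even levels the height 0. So a row passes under a column that runs from one
    even level to the next. *)
Definition grid_vertex x n : 'rV[R]_3 :=
  \row_(k < 3) [:: x; n%:R; - (odd n)%:R]`_k.

Lemma proj_grid_vertex x n : proj (grid_vertex x n) = plane_point x n%:R.
Proof.
apply/rowP => -[[|[|//]] i]; rewrite !mxE /= inordK//.
Qed.

Lemma height_grid_vertex x n : height (grid_vertex x n) = - (odd n)%:R.
Proof. by rewrite /height mxE inordK. Qed.

Lemma grid_vertexP z x n : proj z 0 0 = x -> proj z 0 1 = n%:R ->
  height z = - (odd n)%:R -> z = grid_vertex x n.
Proof.
move=> zx zy zh; apply: proj_height; last by rewrite height_grid_vertex.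
by rewrite proj_grid_vertex [LHS]plane_pointE zx zy.
Qed.

Lemma grid_vertex_inj x n x' n' :
  grid_vertex x n = grid_vertex x' n' -> x = x' /\ n = n'.
Proof.
move=> /(congr1 (@proj R)); rewrite !proj_grid_vertex => h.
have := congr1 (fun p : 'rV[R]_2 => p 0 0) h.
have := congr1 (fun p : 'rV[R]_2 => p 0 1) h.
by rewrite !plane_pointX !plane_pointY => /eqP; rewrite eqr_nat => /eqP.
Qed.

Lemma grid_edge_pt x n x' n' t : let z := pt (grid_vertex x n, grid_vertex x' n') t in
  [/\ proj z 0 0 = x + t * (x' - x), proj z 0 1 = n%:R + t * (n'%:R - n%:R) &
      height z = - ((odd n)%:R + t * ((odd n')%:R - (odd n)%:R))].
Proof.
rewrite /= /height; rewrite /pt /direction !mxE /= !inordK//=.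
by split=> //; ring.
Qed.

End Coordinates.

Section Layers.
Variable R : realType.

(** The layer with the index j lies between the levels 2j and 2j+2, and its row
    is at the level 2j+1 between the abscissas [l_p] and [l_q]. A strand consists
    of the abscissa of a column and of its orientation, [true] for downwards, when
    the normal points to the right. The columns at the ends of the row fill only
    one half of the layer, the lower one if [l_dp], resp. [l_dq], and inherit
    their orientation from the row; the other columns, to the left in [l_U],
    between in [l_m] and to the right in [l_V], run through the whole layer. *)
Record layer := Layer {
  l_U : seq (R * bool); l_V : seq (R * bool);
  l_p : R; l_q : R; l_r : bool; l_dp : bool; l_dq : bool;
  l_m : option (R * bool) }.

Definition l_sp l := l_dp l (+) l_r l.
Definition l_sq l := l_dq l == l_r l.
Definition strands l : seq (R * bool) :=
  l_U l ++ (l_p l, l_sp l) :: seq_of_opt (l_m l) ++ (l_q l, l_sq l) :: l_V l.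
Definition layer_sorted l := sorted <%R (map fst (strands l)).

Definition is_below l x := if x == l_p l then l_dp l else (x == l_q l) ==> l_dq l.
Definition is_above l x :=
  if x == l_p l then ~~ l_dp l else (x == l_q l) ==> ~~ l_dq l.
Definition below l := [seq x <- strands l | is_below l x.1].
Definition above l := [seq x <- strands l | is_above l x.1].

Definition lo j l x := if is_below l x then j.*2 else j.*2.+1.
Definition hi j l x := if is_above l x then j.*2.+2 else j.*2.+1.

Definition grid_edge (b : bool) (u v : 'rV[R]_3) : edge R :=
  if b then (u, v) else (v, u).
Definition column_edge j l (x : R * bool) : edge R :=
  grid_edge (~~ x.2) (grid_vertex x.1 (lo j l x.1)) (grid_vertex x.1 (hi j l x.1)).
Definition row_edge j l : edge R :=
  grid_edge (l_r l) (grid_vertex (l_p l) j.*2.+1) (grid_vertex (l_q l) j.*2.+1).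

Definition layer_edges j l := row_edge j l :: map (column_edge j l) (strands l).

Arguments layer_edges : simpl never.

Lemma segment_grid_edge b u v z : segment (grid_edge b u v) z <-> segment (u, v) z.
Proof.
case: b => //=; rewrite !segmentP.
have h (a b : 'rV[R]_3) t : 0 <= t <= 1 ->
    exists2 s, 0 <= s <= 1 & pt (b, a) t = pt (a, b) s.
  move=> /andP[t0 t1]; exists (1 - t); first by rewrite subr_ge0 t1 gerBl.
  by rewrite -!ptE /= subKr addrC.
by split=> -[t tI ->]; apply: h.
Qed.

Lemma ltn_lo_hi j l x : (lo j l x < hi j l x)%N.
Proof.
rewrite /lo /hi /is_below /is_above.
by case: (x == l_p l); case: (l_dp l); case: (x == l_q l); case: (l_dq l);
  rewrite /= ltnS ?leqnSn ?leqnn.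
Qed.

Lemma lo_bounds j l x : (j.*2 <= lo j l x <= j.*2.+1)%N.
Proof. by rewrite /lo; case: ifP; rewrite ?leqnn ?leqnSn. Qed.

Lemma hi_bounds j l x : (j.*2.+1 <= hi j l x <= j.*2.+2)%N.
Proof. by rewrite /hi; case: ifP; rewrite ?leqnn ?leqnSn. Qed.

Section OneLayer.
Variables (j : nat) (l : layer).
Hypothesis sl : layer_sorted l.
Implicit Types (x : R) (s : bool).

Lemma uniq_positions : uniq (map fst (strands l)).
Proof. by apply: sorted_uniq sl; [exact: lt_trans|exact: ltxx]. Qed.

Lemma strand_inj a b : a \in strands l -> b \in strands l -> a.1 = b.1 -> a = b.
Proof.
move=> aS bS ab; have /(uniqP 0) u := uniq_positions.
rewrite -(nth_index (0, true) aS) -(nth_index (0, true) bS).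
congr nth; apply: u; rewrite ?inE ?size_map ?index_mem//.
by rewrite !(nth_map (0, true)) ?index_mem// !nth_index.
Qed.

Lemma p_strand : (l_p l, l_sp l) \in strands l.
Proof. by rewrite /strands mem_cat inE eqxx orbT. Qed.

Lemma q_strand : (l_q l, l_sq l) \in strands l.
Proof. by rewrite /strands mem_cat inE mem_cat inE eqxx !orbT. Qed.

Lemma m_strand m : l_m l = Some m -> m \in strands l.
Proof.
by move=> E; rewrite /strands mem_cat inE mem_cat E /= inE eqxx !orbT.
Qed.

Lemma strands_order : [/\
  forall a, a \in l_U l -> a.1 < l_p l,
  l_p l < l_q l,
  forall a, a \in l_V l -> l_q l < a.1 &
  forall m, l_m l = Some m -> l_p l < m.1 < l_q l].
Proof.
move: sl; rewrite /layer_sorted /strands map_cat /=.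
rewrite (sorted_pairwise lt_trans) pairwise_cat /= => /and3P[/allrelP h1 _].
rewrite map_cat /= all_cat pairwise_cat => /andP[].
move=> /andP[/allP pm /andP[pq /allP pV]] /and3P[/allrelP mq _].
move=> /andP[/allP qV _]; split => //.
- move=> a aU; apply: h1; last exact: mem_head.
  exact: map_f.
- by move=> a aV; apply: qV; exact: map_f.
- move=> m mE; rewrite mE /= in pm mq.
  by rewrite pm ?mem_head// mq ?mem_head.
Qed.

Lemma strand_between a : a \in strands l -> l_p l <= a.1 <= l_q l ->
  [\/ a = (l_p l, l_sp l), a = (l_q l, l_sq l) | l_m l = Some a].
Proof.
have [hU _ hV _] := strands_order.
rewrite /strands mem_cat inE mem_cat inE => h /andP[pa aq]; move: h.
case/or4P => [/hU|/eqP ->|am|].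
- by rewrite ltNge pa.
- by constructor 1.
- by constructor 3; move: am; case: (l_m l) => //= m; rewrite inE => /eqP ->.
- by move=> /orP[/eqP ->|/hV]; [constructor 2|rewrite ltNge aq].
Qed.

Lemma row_edgeP z : segment (row_edge j l) z <->
  [/\ l_p l <= proj z 0 0 <= l_q l, proj z 0 1 = j.*2.+1%:R & height z = - 1].
Proof.
have [_ pq _ _] := strands_order.
rewrite segment_grid_edge; split.
  move=> /segmentP[t /andP[t0 t1] ->].
  have [-> -> ->] := grid_edge_pt (l_p l) j.*2.+1 (l_q l) j.*2.+1 t.
  rewrite !subrr !mulr0 !addr0 /= odd_double; split => //.
  by apply/andP; split; nra.
move=> [/andP[zp zq] zy zh]; have d0 : 0 < l_q l - l_p l by rewrite subr_gt0.
apply/segmentP; exists ((proj z 0 0 - l_p l) / (l_q l - l_p l)).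
  by rewrite ler_pdivrMr// mul1r lerD2r divr_ge0 ?(ltW d0) ?subr_ge0.
set t := _ / _; have [zx' zy' zh'] := grid_edge_pt (l_p l) j.*2.+1 (l_q l) j.*2.+1 t.
apply: proj_height; last first.
  by rewrite zh zh' subrr mulr0 addr0 /= odd_double.
rewrite [LHS]plane_pointE [RHS]plane_pointE zx' zy' subrr mulr0 addr0 zy.
by congr plane_point; rewrite /t divfK ?gt_eqF// addrC subrK.
Qed.

(** A column is a graph over its projection, since the height is affine
    between the levels of its ends. *)
Definition column_height x (y : R) : R :=
  - ((odd (lo j l x))%:R +
     (y - (lo j l x)%:R) * ((odd (hi j l x))%:R - (odd (lo j l x))%:R)).

Lemma column_edgeP a z : segment (column_edge j l a) z <->
  [/\ proj z 0 0 = a.1, (lo j l a.1)%:R <= proj z 0 1 <= (hi j l a.1)%:R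
    & height z = column_height a.1 (proj z 0 1)].
Proof.
rewrite segment_grid_edge.
set n := lo j l a.1; set n' := hi j l a.1.
have nn : (n < n')%N by exact: ltn_lo_hi.
have d0 : 0 < n'%:R - n%:R :> R by rewrite subr_gt0 ltr_nat.
(* the column has the length 1, or its ends have the same height *)
have par : n'%:R - n%:R = 1 :> R \/ (odd n')%:R - (odd n)%:R = 0 :> R.
  rewrite /n /n' /lo /hi; case: ifP; case: ifP => _ _; rewrite /= ?odd_double.
  - by right; rewrite subrr.
  - by left; rewrite -natr1 addrAC subrr add0r.
  - by left; rewrite -[X in X - _]natr1 addrAC subrr add0r.
  - by right; rewrite subrr.
split.
  move=> /segmentP[t /andP[t0 t1] ->]; rewrite /column_height -/n -/n'.
  have [-> -> ->] := grid_edge_pt a.1 n a.1 n' t; split.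
  - by rewrite subrr mulr0 addr0.
  - by apply/andP; split; nra.
  - by rewrite addrAC subrr add0r; case: par => ->; rewrite ?mulr1 ?mulr0.
move=> [zx /andP[zn zn'] zh].
apply/segmentP; exists ((proj z 0 1 - n%:R) / (n'%:R - n%:R)).
  by rewrite ler_pdivrMr// mul1r lerD2r divr_ge0 ?(ltW d0) ?subr_ge0.
set t := _ / _; have [zx' zy' zh'] := grid_edge_pt a.1 n a.1 n' t.
apply: proj_height; last first.
  rewrite zh zh' /column_height -/n -/n' /t.
  by case: par => ->; rewrite ?divr1 ?mulr0.
rewrite [LHS]plane_pointE [RHS]plane_pointE zx' zy' subrr mulr0 addr0 zx.
by congr plane_point; rewrite /t divfK ?gt_eqF// addrC subrK.
Qed.

Lemma column_height_lo x : column_height x (lo j l x)%:R = - (odd (lo j l x))%:R.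
Proof. by rewrite /column_height subrr mul0r addr0. Qed.

Lemma column_height_hi x : column_height x (hi j l x)%:R = - (odd (hi j l x))%:R.
Proof.
have odd_eq : ((hi j l x)%:R - (lo j l x)%:R - 1) *
    ((odd (hi j l x))%:R - (odd (lo j l x))%:R) = 0 :> R.
  rewrite /lo /hi; case: ifP; case: ifP => _ _; rewrite /= ?odd_double /= -?natr1;
    by ring.
by rewrite /column_height; congr -%R; move: odd_eq; lra.
Qed.

Definition corner (e : edge R) z : Prop := z = e.1 \/ z = e.2.

Lemma corner_grid b u v z : corner (grid_edge b u v) z <-> z = u \/ z = v.
Proof. by rewrite /corner; case: b => /=; tauto. Qed.

Lemma column_edge_lo a z : segment (column_edge j l a) z ->
  proj z 0 1 = (lo j l a.1)%:R -> z = grid_vertex a.1 (lo j l a.1).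
Proof.
move=> /column_edgeP[zx _ zh] zy; apply: grid_vertexP => //.
by rewrite zh zy column_height_lo.
Qed.

Lemma column_edge_hi a z : segment (column_edge j l a) z ->
  proj z 0 1 = (hi j l a.1)%:R -> z = grid_vertex a.1 (hi j l a.1).
Proof.
move=> /column_edgeP[zx _ zh] zy; apply: grid_vertexP => //.
by rewrite zh zy column_height_hi.
Qed.

Lemma column_corner a z : segment (column_edge j l a) z ->
  proj z 0 1 = (lo j l a.1)%:R \/ proj z 0 1 = (hi j l a.1)%:R ->
  corner (column_edge j l a) z.
Proof.
move=> az [/(column_edge_lo az)|/(column_edge_hi az)] ->; apply/corner_grid;
  by [left|right].
Qed.

Lemma p_half : (lo j l (l_p l) == j.*2.+1) || (hi j l (l_p l) == j.*2.+1).
Proof.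
by rewrite /lo /hi /is_below /is_above eqxx; case: (l_dp l); rewrite /= eqxx ?orbT.
Qed.

Lemma q_half : (lo j l (l_q l) == j.*2.+1) || (hi j l (l_q l) == j.*2.+1).
Proof.
have [_ pq _ _] := strands_order.
rewrite /lo /hi /is_below /is_above (gt_eqF pq) eqxx.
by case: (l_dq l); rewrite /= eqxx ?orbT.
Qed.

Lemma straight_strand x : x != l_p l -> x != l_q l ->
  lo j l x = j.*2 /\ hi j l x = j.*2.+2.
Proof. by move=> /negbTE xp /negbTE xq; rewrite /lo /hi /is_below /is_above xp xq. Qed.

Lemma middle_strand m : l_m l = Some m ->
  lo j l m.1 = j.*2 /\ hi j l m.1 = j.*2.+2.
Proof.
have [_ _ _ h] := strands_order => /h /andP[pm mq].
by apply: straight_strand; rewrite ?(gt_eqF pm) ?(lt_eqF mq).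
Qed.

(** The columns at the ends of the row reach its level at their own ends, where
    they share a vertex with it; the middle column is there at the height 0. *)
Lemma row_column_meet a z z' : a \in strands l ->
  segment (row_edge j l) z -> segment (column_edge j l a) z' ->
  proj z = proj z' ->
  (z = z' /\ corner (row_edge j l) z /\ corner (column_edge j l a) z') \/
  [/\ l_m l = Some a, height z = -1, height z' = 0,
      proj z 0 0 = a.1 & proj z 0 1 = j.*2.+1%:R].
Proof.
move=> aS rz cz' zz.
have [zpq zy zh] := (row_edgeP z).1 rz; have [z'x z'y z'h] := (column_edgeP a z').1 cz'.
rewrite zz z'x in zpq.
have zrow : proj z' 0 1 = j.*2.+1%:R by rewrite -zz.
have end_case b : a = b -> (lo j l b.1 == j.*2.+1) || (hi j l b.1 == j.*2.+1) ->
    (b.1 == l_p l) || (b.1 == l_q l) ->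
    z = z' /\ corner (row_edge j l) z /\ corner (column_edge j l a) z'.
  move=> ab; rewrite -ab => half apq.
  have z'E : z' = grid_vertex a.1 j.*2.+1.
    case/orP: half => /eqP half; rewrite -half.
    - by apply: column_edge_lo => //; rewrite half.
    - by apply: column_edge_hi => //; rewrite half.
  have zE : z = z'.
    by apply: proj_height => //; rewrite zh z'E height_grid_vertex /= odd_double.
  split => //; split.
    rewrite zE z'E; apply/corner_grid.
    by case/orP: apq => /eqP ->; [left|right].
  apply: column_corner => //.
  by case/orP: half => /eqP ->; [left|right].
case: (strand_between aS zpq) => [aE|aE|aE].
- by left; apply: (end_case _ aE p_half); rewrite eqxx.
- by left; apply: (end_case _ aE q_half); rewrite eqxx orbT.
- right; split => //; last by rewrite zz.
  rewrite z'h /column_height; have [-> ->] := middle_strand aE.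
  by rewrite /= odd_double subrr mulr0 addr0 oppr0.
Qed.

End OneLayer.
Definition kept (d : bool) l x := if d then is_below l x else is_above l x.
Definition kept_strands d l := [seq a <- strands l | kept d l a.1].

Lemma kept_p d l : kept d l (l_p l) = (d == l_dp l).
Proof. by rewrite /kept /is_below /is_above eqxx; case: d; case: (l_dp l). Qed.

Lemma kept_q d l : layer_sorted l -> kept d l (l_q l) = (d == l_dq l).
Proof.
move=> /strands_order[_ pq _ _]; rewrite /kept /is_below /is_above (gt_eqF pq) eqxx.
by case: d; case: (l_dq l).
Qed.

Lemma kept_other d l x : x != l_p l -> x != l_q l -> kept d l x.
Proof.
by move=> /negbTE xp /negbTE xq; rewrite /kept /is_below /is_above xp xq; case: d.
Qed.

Lemma kept_strandsE d l : layer_sorted l -> kept_strands d l =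
  l_U l ++ nseq (d == l_dp l) (l_p l, l_sp l) ++ seq_of_opt (l_m l) ++
  nseq (d == l_dq l) (l_q l, l_sq l) ++ l_V l.
Proof.
move=> sl; have [hU pq hV hm] := strands_order sl.
rewrite /kept_strands /strands -cat1s -(cat1s (l_q l, _)) !filter_cat.
congr (_ ++ (_ ++ (_ ++ (_ ++ _)))).
- apply/all_filterP/allP => a /hU aU.
  by apply: kept_other; rewrite lt_eqF//; exact: lt_trans pq.
- by rewrite /= kept_p; case: (d == _).
- apply/all_filterP/allP => a.
  case: (l_m l) hm => //= m /(_ _ erefl)/andP[pm mq].
  by rewrite inE => /eqP ->; rewrite kept_other// ?(gt_eqF pm) ?(lt_eqF mq).
- by rewrite /= kept_q//; case: (d == _).
- apply/all_filterP/allP => a /hV aV.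
  by apply: kept_other; rewrite gt_eqF//; exact: lt_trans aV.
Qed.

End Layers.

(** * Stacks of layers *)

Section Stack.
Variables (R : realType) (ls : seq (layer R)).
Implicit Types (e : edge R) (z : 'rV[R]_3) (a b : R * bool) (i j : nat) (l : layer R).

Local Notation n := (size ls).
Definition lay j : layer R := nth (Layer [::] [::] 0 0 true true true None) ls j.
Definition state j : seq (R * bool) := if (j < n)%N then below (lay j) else [::].

Definition stacked : Prop :=
  [/\ (0 < n)%N, forall j, (j < n)%N -> layer_sorted (lay j), state 0 = [::] &
      forall j, (j < n)%N -> above (lay j) = state j.+1].

Hypothesis stackedL : stacked.

Definition stack_edges : seq (edge R) :=
  flatten [seq layer_edges j (lay j) | j <- iota 0 n].

Lemma stack_edgesP e : e \in stack_edges <->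
  exists2 j, (j < n)%N & e = row_edge j (lay j) \/
    exists2 a, a \in strands (lay j) & e = column_edge j (lay j) a.
Proof.
split=> [/flattenP[_ /mapP[j + ->]]|[j jn ej]].
  rewrite mem_iota add0n inE => /= jn /predU1P[->|/mapP[a aS ->]]; exists j => //.
    by left.
  by right; exists a.
apply/flattenP; exists (layer_edges j (lay j)).
  by apply/map_f; rewrite mem_iota.
case: ej => [->|[a aS ->]]; first exact: mem_head.
by rewrite inE map_f ?orbT.
Qed.

Let sortedL j : (j < n)%N -> layer_sorted (lay j).
Proof. by case: stackedL => _ + _ _; exact. Qed.

Lemma above_state j : (j < n)%N -> above (lay j) = state j.+1.
Proof. by case: stackedL => _ _ _; exact. Qed.

Lemma state_below j a : a \in state j -> (j < n)%N /\ a \in below (lay j).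
Proof. by rewrite /state; case: ifP. Qed.

Lemma layer_index i j a b (y : R) : (i < j)%N ->
  (lo i (lay i) a.1)%:R <= y <= (hi i (lay i) a.1)%:R ->
  (lo j (lay j) b.1)%:R <= y <= (hi j (lay j) b.1)%:R ->
  [/\ j = i.+1, hi i (lay i) a.1 = j.*2, lo j (lay j) b.1 = j.*2 & y = j.*2%:R].
Proof.
move=> ij /andP[_ y1] /andP[y2 _].
have /andP[_ h1] := hi_bounds i (lay i) a.1.
have /andP[h2 _] := lo_bounds j (lay j) b.1.
have h3 : (lo j (lay j) b.1 <= hi i (lay i) a.1)%N.
  by rewrite -(ler_nat R); exact: le_trans y2 y1.
have Ej : j = i.+1 by lia.
have E1 : hi i (lay i) a.1 = j.*2 by lia.
have E2 : lo j (lay j) b.1 = j.*2 by lia.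
by split => //; apply/eqP; rewrite eq_le -{1}E1 y1 -E2 y2.
Qed.

Lemma columns_meet i j a b z z' : (i < n)%N -> (j < n)%N ->
  a \in strands (lay i) -> b \in strands (lay j) ->
  segment (column_edge i (lay i) a) z -> segment (column_edge j (lay j) b) z' ->
  proj z = proj z' ->
  z = z' /\ (column_edge i (lay i) a = column_edge j (lay j) b \/
    (corner (column_edge i (lay i) a) z /\ corner (column_edge j (lay j) b) z')).
Proof.
wlog ij : i j a b z z' / (i <= j)%N.
  move=> wl iN jN aS bS az bz' zz; have [ij|/ltnW ji] := leqP i j; first exact: wl.
  have [-> h] := wl _ _ _ _ _ _ ji jN iN bS aS bz' az (esym zz).
  split => //; case: h => [->|[h1 h2]]; first by left.
  by right.
move=> iN jN aS bS az bz' zz.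
have [zx zy zh] := (column_edgeP i (lay i) a z).1 az.
have [z'x z'y z'h] := (column_edgeP j (lay j) b z').1 bz'.
have ab1 : a.1 = b.1 by rewrite -zx zz.
move: ij; rewrite leq_eqVlt => /predU1P[ij|ij].
  move: aS az zh; rewrite ij => aS az zh.
  have ab : a = b by exact: (strand_inj (sortedL jN) aS bS ab1).
  split; last by left; rewrite ab.
  by apply: proj_height => //; rewrite zh z'h ab zz.
rewrite -zz in z'y; have [Ej E1 E2 Ey] := layer_index ij zy z'y.
have zE : z = grid_vertex a.1 (hi i (lay i) a.1).
  by apply: column_edge_hi => //; rewrite Ey E1.
have z'E : z' = grid_vertex b.1 (lo j (lay j) b.1).
  by apply: column_edge_lo => //; rewrite -zz Ey E2.
split; first by rewrite zE z'E E1 E2 ab1.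
right; split; apply: column_corner => //.
- by right; rewrite Ey E1.
- by left; rewrite -zz Ey E2.
Qed.

Definition crossing_at e e' z z' : Prop := exists j a,
  [/\ (j < n)%N, l_m (lay j) = Some a, e = column_edge j (lay j) a &
      e' = row_edge j (lay j)] /\
  [/\ proj z = plane_point a.1 j.*2.+1%:R, proj z' = proj z,
      height z = 0 & height z' = -1].

Lemma row_layer i j a (y : R) : y = i.*2.+1%:R ->
  (lo j (lay j) a.1)%:R <= y <= (hi j (lay j) a.1)%:R -> i = j.
Proof.
move=> ->; rewrite !ler_nat => /andP[h1 h2].
have /andP[_ h3] := hi_bounds j (lay j) a.1.
have /andP[h4 _] := lo_bounds j (lay j) a.1.
by lia.
Qed.

Lemma stack_meet e e' z z' : e \in stack_edges -> e' \in stack_edges ->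
  segment e z -> segment e' z' -> proj z = proj z' ->
  [\/ z = z' /\ (e = e' \/ (corner e z /\ corner e' z')),
      crossing_at e e' z z' | crossing_at e' e z' z].
Proof.
have rc i j a x x' : (i < n)%N -> (j < n)%N -> a \in strands (lay j) ->
    segment (row_edge i (lay i)) x -> segment (column_edge j (lay j) a) x' ->
    proj x = proj x' ->
    (x = x' /\ corner (row_edge i (lay i)) x /\
      corner (column_edge j (lay j) a) x') \/
    crossing_at (column_edge j (lay j) a) (row_edge i (lay i)) x' x.
  move=> iN jN aS rx cx' xx.
  have [_ xy _] := (row_edgeP i (sortedL iN) x).1 rx.
  have [_ x'y _] := (column_edgeP j (lay j) a x').1 cx'.
  rewrite -xx in x'y; have ij := row_layer xy x'y.
  move: rx xy; rewrite ij => rx xy.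
  have [h|[am xh x'h xX xY]] := row_column_meet (sortedL jN) aS rx cx' xx.
    by left.
  right; exists j, a; split => //; split => //.
  by rewrite -xx [LHS]plane_pointE xX xY.
move=> /stack_edgesP[i iN [->|[a aS ->]]] /stack_edgesP[j jN [->|[b bS ->]]].
- move=> rz rz' zz.
  have [_ zy zh] := (row_edgeP i (sortedL iN) z).1 rz.
  have [_ z'y z'h] := (row_edgeP j (sortedL jN) z').1 rz'.
  have ij : i = j.
    by move: z'y; rewrite -zz zy => /eqP; rewrite eqr_nat => /eqP; lia.
  constructor 1; split; last by left; rewrite ij.
  by apply: proj_height => //; rewrite zh z'h.
- move=> rz cz' zz; have [[? [? ?]]|h] := rc _ _ _ _ _ iN jN bS rz cz' zz.
    by constructor 1; split => //; right.
  by constructor 3.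
- move=> cz rz' zz.
  have [[h1 [h2 h3]]|h] := rc _ _ _ _ _ jN iN aS rz' cz (esym zz).
    by constructor 1; split => //; right.
  by constructor 2.
- move=> cz cz' zz; have [h1 h2] := columns_meet iN jN aS bS cz cz' zz.
  by constructor 1.
Qed.

Definition tip (b : bool) e : 'rV[R]_3 := if b then e.1 else e.2.

Lemma tip_grid (c d : bool) u v :
  tip c (@grid_edge R d u v) = if c == d then u else v.
Proof. by case: c; case: d. Qed.

Lemma p_strandE l a : layer_sorted l -> a \in strands l -> a.1 = l_p l ->
  a = (l_p l, l_sp l).
Proof. by move=> sl aS ap; apply: (strand_inj sl aS (p_strand l)). Qed.

Lemma q_strandE l a : layer_sorted l -> a \in strands l -> a.1 = l_q l ->
  a = (l_q l, l_sq l).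
Proof. by move=> sl aS aq; apply: (strand_inj sl aS (q_strand l)). Qed.

Lemma lo_p j l : lo j l (l_p l) = if l_dp l then j.*2 else j.*2.+1.
Proof. by rewrite /lo /is_below eqxx. Qed.
Lemma hi_p j l : hi j l (l_p l) = if l_dp l then j.*2.+1 else j.*2.+2.
Proof. by rewrite /hi /is_above eqxx; case: (l_dp l). Qed.
Lemma lo_q j l : layer_sorted l -> lo j l (l_q l) = if l_dq l then j.*2 else j.*2.+1.
Proof.
by move=> /strands_order[_ pq _ _]; rewrite /lo /is_below (gt_eqF pq) eqxx.
Qed.
Lemma hi_q j l : layer_sorted l ->
  hi j l (l_q l) = if l_dq l then j.*2.+1 else j.*2.+2.
Proof.
move=> /strands_order[_ pq _ _]; rewrite /hi /is_above (gt_eqF pq) eqxx.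
by case: (l_dq l).
Qed.

(** At a vertex two edges meet, and their orientations are chosen such that one
    of them enters and the other one leaves. *)
Lemma tip_inj d e e' : e \in stack_edges -> e' \in stack_edges ->
  tip d e = tip d e' -> e = e'.
Proof.
have rc i j a : (i < n)%N -> (j < n)%N -> a \in strands (lay j) ->
    tip d (row_edge i (lay i)) <> tip d (column_edge j (lay j) a).
  move=> iN jN aS; rewrite !tip_grid => h.
  have ij : i = j.
    have /andP[_ h3] := hi_bounds j (lay j) a.1.
    have /andP[h4 _] := lo_bounds j (lay j) a.1.
    have /andP[h5 _] := hi_bounds j (lay j) a.1.
    have /andP[_ h6] := lo_bounds j (lay j) a.1.
    by move: h; case: ifP => _; case: ifP => _ /grid_vertex_inj[_]; lia.
  have sl := sortedL jN; rewrite ij in h.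
  move: h; case: ifP => dr /=.
    case: ifP => da /grid_vertex_inj[ap].
      move: da; rewrite (p_strandE sl aS (esym ap)) /= lo_p /l_sp.
      by move: dr; case: (l_dp _); case: (l_r _); case: d => //= _ _; lia.
    move: da; rewrite (p_strandE sl aS (esym ap)) /= hi_p /l_sp.
    by move: dr; case: (l_dp _); case: (l_r _); case: d => //= _ _; lia.
  case: ifP => da /grid_vertex_inj[aq].
    move: da; rewrite (q_strandE sl aS (esym aq)) /= lo_q// /l_sq.
    by move: dr; case: (l_dq _); case: (l_r _); case: d => //= _ _; lia.
  move: da; rewrite (q_strandE sl aS (esym aq)) /= hi_q// /l_sq.
  by move: dr; case: (l_dq _); case: (l_r _); case: d => //= _ _; lia.
have cc i j a b : (i < n)%N -> (j < n)%N -> a \in strands (lay i) ->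
    b \in strands (lay j) -> (i <= j)%N ->
    tip d (column_edge i (lay i) a) = tip d (column_edge j (lay j) b) ->
    column_edge i (lay i) a = column_edge j (lay j) b.
  move=> iN jN aS bS; rewrite leq_eqVlt => /predU1P[ij|ij].
    move: aS; rewrite ij !tip_grid => aS h; congr column_edge.
    apply: (strand_inj (sortedL jN) aS bS).
    by move: h; case: ifP => _; case: ifP => _ /grid_vertex_inj[].
  rewrite !tip_grid; have := hi_bounds i (lay i) a.1.
  have := lo_bounds i (lay i) a.1; have := hi_bounds j (lay j) b.1.
  have := lo_bounds j (lay j) b.1 => /andP[b1 b2] /andP[b3 b4] /andP[b5 b6] /andP[b7 b8].
  case: ifP => da; case: ifP => db /grid_vertex_inj[ab]; try lia.
  move=> hl; have Ej : j = i.+1 by lia.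
  have aa : a \in above (lay i).
    rewrite mem_filter aS andbT; move: hl; rewrite /hi; case: ifP => // _.
    by lia.
  have bb : b \in strands (lay j) /\ a \in strands (lay j).
    split=> //; move: aa; rewrite above_state// -Ej /state jN mem_filter.
    by case/andP.
  have abE : a = b by case: bb => bS' aS'; exact: (strand_inj (sortedL jN) aS' bS' ab).
  by move: da db; rewrite abE => ->.
move=> /stack_edgesP[i iN [->|[a aS ->]]] /stack_edgesP[j jN [->|[b bS ->]]].
- rewrite !tip_grid => h; suff -> : i = j by [].
  by move: h; case: ifP => _; case: ifP => _ /grid_vertex_inj[_]; lia.
- by move=> /rc[].
- by move=> /esym /rc[].
- move=> h; have [ij|/ltnW ji] := leqP i j; first exact: cc.
  by apply/esym/cc.
Qed.

Lemma stack_follows e : e \in stack_edges ->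
  exists2 e', e' \in stack_edges & e'.1 = e.2.
Proof.
have rowE j : (j < n)%N -> row_edge j (lay j) \in stack_edges.
  by move=> jN; apply/stack_edgesP; exists j => //; left.
have colE j a : (j < n)%N -> a \in strands (lay j) ->
    column_edge j (lay j) a \in stack_edges.
  by move=> jN aS; apply/stack_edgesP; exists j => //; right; exists a.
move=> /stack_edgesP[i iN [->|[a aS ->]]]; have sl := sortedL iN.
  rewrite -/(tip false (row_edge i (lay i))) tip_grid.
  case rE : (l_r (lay i)) => /=.
    exists (column_edge i (lay i) (l_q (lay i), l_sq (lay i))).
      exact/colE/q_strand.
    rewrite -/(tip true (column_edge _ _ _)) tip_grid /= lo_q// hi_q// /l_sq rE.
    by case: (l_dq _).
  exists (column_edge i (lay i) (l_p (lay i), l_sp (lay i))).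
    exact/colE/p_strand.
  rewrite -/(tip true (column_edge _ _ _)) tip_grid /= lo_p// hi_p// /l_sp rE.
  by case: (l_dp _).
rewrite -/(tip false (column_edge i (lay i) a)) tip_grid.
case aE : a.2 => /=.
  case: (boolP (is_below (lay i) a.1)) => ab.
    have : a \in state i by rewrite /state iN mem_filter ab.
    case: i iN aS sl ab => [|i] iN aS sl ab.
      by case: stackedL => _ _ -> _.
    have iN' := ltnW iN; rewrite -above_state// mem_filter => /andP[aa aS'].
    exists (column_edge i (lay i) a); first exact: colE.
    rewrite -/(tip true (column_edge _ _ _)) tip_grid aE /=.
    by rewrite /lo ab /hi aa doubleS.
  exists (row_edge i (lay i)); first exact: rowE.
  rewrite -/(tip true (row_edge _ _)) tip_grid /lo (negbTE ab).
  move: ab; rewrite /is_below; case: eqP => [ap dp|_].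
    have := p_strandE sl aS ap => aP; rewrite ap.
    by move: aE; rewrite aP /= /l_sp (negbTE dp) /= => ->.
  rewrite negb_imply => /andP[/eqP aq dq].
  have := q_strandE sl aS aq => aQ; rewrite aq.
  by move: aE; rewrite aQ /= /l_sq (negbTE dq) /=; case: (l_r _).
case: (boolP (is_above (lay i) a.1)) => ab.
  have : a \in above (lay i) by rewrite mem_filter ab.
  rewrite above_state// => /state_below[i1N]; rewrite mem_filter => /andP[ab' aS'].
  exists (column_edge i.+1 (lay i.+1) a); first exact: colE.
  rewrite -/(tip true (column_edge _ _ _)) tip_grid aE /=.
  by rewrite /lo ab' /hi ab doubleS.
exists (row_edge i (lay i)); first exact: rowE.
rewrite -/(tip true (row_edge _ _)) tip_grid /hi (negbTE ab).
move: ab; rewrite /is_above; case: eqP => [ap dp|_].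
  have := p_strandE sl aS ap => aP; rewrite ap.
  by move: aE; rewrite aP /= /l_sp; move: dp; rewrite negbK => ->; case: (l_r _).
rewrite negb_imply negbK => /andP[/eqP aq dq].
have := q_strandE sl aS aq => aQ; rewrite aq.
by move: aE; rewrite aQ /= /l_sq dq /=; case: (l_r _).
Qed.

Lemma stack_no_loop e : e \in stack_edges -> e.1 != e.2.
Proof.
move=> /stack_edgesP[i iN eE]; apply/eqP.
rewrite -/(tip true e) -/(tip false e).
case: eE => [->|[a aS ->]]; rewrite !tip_grid => h.
  have [_ pq _ _] := strands_order (sortedL iN).
  by move: h; case: (l_r _) => /grid_vertex_inj[] h; move: pq; rewrite h ltxx.
have := ltn_lo_hi i (lay i) a.1.
by move: h; case: (a.2) => /grid_vertex_inj[_ ->]; rewrite ltnn.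
Qed.

(** Opposite edges would have the same midpoint, which is not a corner. *)
Lemma stack_no_digon e e' : e \in stack_edges -> e' \in stack_edges ->
  e.1 = e'.2 -> e.2 = e'.1 -> False.
Proof.
have half0 : (2^-1 - 0 == 0 :> R) = false by apply/eqP; lra.
have half1 : (2^-1 - 1 == 0 :> R) = false by apply/eqP; lra.
move=> eE e'E h1 h2; have ee : e = e'; last first.
  by have /eqP[] := stack_no_loop eE; rewrite h1 -ee.
have sub : forall z, segment e z <-> segment e' z.
  move=> z; rewrite (_ : e = grid_edge false e'.1 e'.2); last first.
    by rewrite [LHS]surjective_pairing h1 h2.
  by rewrite segment_grid_edge -surjective_pairing.
have mid : segment e (pt e 2^-1) by apply: segment_pt; lra.
have [[_ [//|[c _]]]|[j [a [_ [_ zz h0 h1']]]]|[j [a [_ [_ zz h0 h1']]]]] :=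
  stack_meet eE e'E mid ((sub _).1 mid) erefl.
- have d0 : direction e != 0 by rewrite subr_eq0 eq_sym stack_no_loop.
  case: c.
    rewrite -[e.1]pt0 /pt => /addrI /eqP.
    by rewrite -subr_eq0 -scalerBl scaler_eq0 (negbTE d0) orbF ?half0 ?half1.
  rewrite -[e.2]pt1 /pt => /addrI /eqP.
  by rewrite -subr_eq0 -scalerBl scaler_eq0 (negbTE d0) orbF ?half0 ?half1.
- by move: h1'; rewrite h0 => /esym/eqP; rewrite oppr_eq0 oner_eq0.
- by move: h1'; rewrite h0 => /esym/eqP; rewrite oppr_eq0 oner_eq0.
Qed.

Lemma uniq_stack_edges : uniq stack_edges.
Proof.
rewrite /stack_edges; have : forall j, j \in iota 0 n -> (j < n)%N.
  by move=> j; rewrite mem_iota.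
have layU j : (j < n)%N -> uniq (layer_edges j (lay j)).
  move=> jN; rewrite /layer_edges /=; have sl := sortedL jN; apply/andP; split.
    apply/mapP => -[a aS h]; have /eqP := ltn_lo_hi j (lay j) a.1.
    have [_ pq _ _] := strands_order sl.
    have := congr1 (tip true) h; have := congr1 (tip false) h.
    rewrite !tip_grid; case: (l_r _); case: (a.2) => /=
      /grid_vertex_inj[h1 _] /grid_vertex_inj[h2 _]; move: pq;
      by rewrite h1 h2 ltxx.
  rewrite map_inj_in_uniq; first exact: map_uniq (uniq_positions sl).
  move=> a b aS bS h; apply: (strand_inj sl) => //.
  have := congr1 (tip true) h; rewrite !tip_grid.
  by case: ifP => _; case: ifP => _ /grid_vertex_inj[].
have := iota_uniq 0 n.
elim: (iota 0 n) => [//|j s IH]; rewrite cons_uniq => /andP[js us] sN.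
rewrite (_ : flatten _ = layer_edges j (lay j) ++
  flatten [seq layer_edges i (lay i) | i <- s])//.
rewrite cat_uniq layU ?sN ?mem_head// IH//.
- rewrite /= andbT; apply/hasPn => e /flattenP[_ /mapP[i iS ->]] ei.
  have iN : (i < n)%N by apply: sN; rewrite inE iS orbT.
  apply/negP => ej; have jN : (j < n)%N by apply: sN; rewrite mem_head.
  suff ij : i = j by rewrite ij in iS; rewrite iS in js.
  (* the levels of the ends of an edge determine its layer *)
  have bnd k l f : layer_sorted l -> f \in layer_edges k l -> exists u v,
      [/\ f.1 = grid_vertex (u : R * nat).1 u.2, f.2 = grid_vertex (v : R * nat).1 v.2
        & (u.2 + v.2 = k.*2 + k.*2.+2)%N \/ (u.2 + v.2 = (k.*2 + k.*2).+1)%N \/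
          (u.2 + v.2 = (k.*2 + k.*2).+3)%N].
    move=> sl; rewrite inE => /predU1P[->|/mapP[a aS ->]].
      rewrite /row_edge; case: (l_r l).
        by exists (l_p l, k.*2.+1), (l_q l, k.*2.+1); split => //=; left; lia.
      by exists (l_q l, k.*2.+1), (l_p l, k.*2.+1); split => //=; left; lia.
    rewrite /column_edge /lo /hi; case: (a.2) => /=.
      exists (a.1, hi k l a.1), (a.1, lo k l a.1); split => //=; rewrite /lo /hi.
      have := ltn_lo_hi k l a.1; rewrite /lo /hi.
      by case: ifP; case: ifP => _ _; lia.
    exists (a.1, lo k l a.1), (a.1, hi k l a.1); split => //=; rewrite /lo /hi.
    have := ltn_lo_hi k l a.1; rewrite /lo /hi.
    by case: ifP; case: ifP => _ _; lia.
  have [u [v [e1 e2 uv]]] := bnd _ _ _ (sortedL iN) ei.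
  have [u' [v' [e1' e2' uv']]] := bnd _ _ _ (sortedL jN) ej.
  have [_ uu] := grid_vertex_inj (etrans (esym e1) e1').
  have [_ vv] := grid_vertex_inj (etrans (esym e2) e2').
  by lia.
- by move=> k ks; apply: sN; rewrite inE ks orbT.
Qed.

End Stack.

(** * The diagram of a stack *)

Section StackDiagram.
Variables (R : realType) (ls : seq (layer R)).
Hypothesis stackedL : stacked ls.
Local Notation n := (size ls).
Local Notation lay := (lay ls).
Local Notation E := (stack_edges ls).
Implicit Types (e : edge R) (z : 'rV[R]_3) (a b : R * bool) (i j : nat).

Let sortedL j : (j < n)%N -> layer_sorted (lay j).
Proof. by case: stackedL => _ + _ _; exact. Qed.

Lemma row_in_stack j : (j < n)%N -> row_edge j (lay j) \in E.
Proof. by move=> jN; apply/stack_edgesP; exists j => //; left. Qed.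

Lemma column_in_stack j a : (j < n)%N -> a \in strands (lay j) ->
  column_edge j (lay j) a \in E.
Proof. by move=> jN aS; apply/stack_edgesP; exists j => //; right; exists a. Qed.

Lemma half_open_corner e z : e \in E -> half_open_segment e z ->
  corner e z -> z = e.1.
Proof.
move=> eE /half_openP[t /andP[t0 t1] ->] [//|]; rewrite -[e.2]pt1 /pt.
move=> /addrI /eqP; rewrite -subr_eq0 -scalerBl scaler_eq0 => /orP[|d0].
  by rewrite subr_eq0 lt_eqF.
by have /eqP[] := stack_no_loop stackedL eE; move/eqP: d0 => /subr0_eq.
Qed.

Lemma half_open_segment_sub e z : half_open_segment e z -> segment e z.
Proof.
by move=> /half_openP[t /andP[t0 t1] ->]; apply: segment_pt; rewrite t0 ltW.
Qed.

Lemma stack_half_open e e' z : e \in E -> e' \in E ->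
  half_open_segment e z -> half_open_segment e' z -> e = e'.
Proof.
move=> eE e'E ez e'z.
have [[_ [//|[c c']]]|[j [a [_ [_ _ h0 h1]]]]|[j [a [_ [_ _ h0 h1]]]]] :=
  stack_meet stackedL eE e'E (half_open_segment_sub ez) (half_open_segment_sub e'z) erefl.
- apply: (tip_inj (d := true) stackedL) => //=.
  by rewrite -(half_open_corner eE ez c) -(half_open_corner e'E e'z c').
- by move: h1; rewrite h0 => /esym/eqP; rewrite oppr_eq0 oner_eq0.
- by move: h1; rewrite h0 => /esym/eqP; rewrite oppr_eq0 oner_eq0.
Qed.

Variable L : seq (polygon R).
Hypothesis LE : perm_eq (link_edges L) E.
Hypothesis L3 : all (fun p : polygon R => 2 < size p)%N L.

Lemma stack_is_link : is_link L.
Proof.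
have uL : uniq (link_edges L) by rewrite (perm_uniq LE) uniq_stack_edges.
split => //.
  apply/eqP => L0; have := perm_size LE; rewrite L0 /=.
  have [n0 _ _ _] := stackedL.
  by have := row_in_stack n0; case: (E).
move=> i j /= iL jL [z [iz jz]]; have /(uniqP (0, 0)) u := uL; apply: u => //.
by apply: stack_half_open iz jz; rewrite -(perm_mem LE) mem_nth.
Qed.

Lemma stack_double e e' z z' : e \in E -> e' \in E -> segment e z ->
  segment e' z' -> proj z = proj z' ->
  [\/ z = z', height z = 0 /\ height z' = -1 | height z = -1 /\ height z' = 0].
Proof.
move=> eE e'E ez e'z' zz.
have [[? _]|[j [a [_ [_ _ h0 h1]]]]|[j [a [_ [_ _ h0 h1]]]]] :=
  stack_meet stackedL eE e'E ez e'z' zz.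
- by constructor 1.
- by constructor 2.
- by constructor 3.
Qed.

(** A double point lies in the interior of a row and of a middle column, at
    the heights -1 and 0; a third point above it would have one of these heights. *)
Lemma stack_regular : regular L.
Proof.
split=> [x y z [e1 /= e1L x1] [e2 /= e2L y2] [e3 /= e3L z3] xy yz|p v x pL vp].
  rewrite !(perm_mem LE) in e1L e2L e3L.
  have n10 : -1 <> 0 :> R by move=> /eqP; rewrite oppr_eq0 oner_eq0.
  have [|[x0 y1]|[x0 y1]] := stack_double e1L e2L x1 y2 xy; first by constructor 1.
  - have [|[y0 z1]|[y0 z1]] := stack_double e2L e3L y2 z3 yz; first by constructor 2.
    + by move: y0; rewrite y1 => /n10.
    + constructor 3; apply: proj_height; first by rewrite xy.
      by rewrite x0 z1.
  - have [|[y0 z1]|[y0 z1]] := stack_double e2L e3L y2 z3 yz; first by constructor 2.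
    + constructor 3; apply: proj_height; first by rewrite xy.
      by rewrite x0 z1.
    + by move: y1; rewrite y0 => /n10.
move=> [e' /= e'L xe'] xv; rewrite (perm_mem LE) in e'L.
have : v \in map fst (link_edges L).
  by rewrite link_edges_fst; apply/flattenP; exists p.
move=> /mapP[e eL ve]; rewrite (perm_mem LE) in eL.
have ev : segment e v by rewrite ve -pt0; apply: segment_pt; rewrite lexx ler01.
have no_odd j a : (j < n)%N -> l_m (lay j) = Some a ->
    e = column_edge j (lay j) a -> proj v <> plane_point a.1 j.*2.+1%:R.
  move=> jN am eE; rewrite ve eE /column_edge.
  have [-> ->] := middle_strand j (sortedL jN) am.
  by case: (a.2) => /= ; rewrite proj_grid_vertex => /(congr1 (fun q : 'rV[R]_2 => q 0 1));
    rewrite !plane_pointY => /eqP; rewrite eqr_nat => /eqP; lia.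
have no_end j a : (j < n)%N -> l_m (lay j) = Some a ->
    e = row_edge j (lay j) -> proj v <> plane_point a.1 j.*2.+1%:R.
  move=> jN am eE; rewrite ve eE /row_edge.
  have [_ _ _ /(_ _ am) /andP[h1 h2]] := strands_order (sortedL jN).
  by case: (l_r _) => /= ; rewrite proj_grid_vertex => /(congr1 (fun q : 'rV[R]_2 => q 0 0));
    rewrite !plane_pointX => h; move: h1 h2; rewrite h ltxx.
have [[-> //]|[j [a [[jN am eE _] [pv _ _ _]]]]|[j [a [[jN am _ eE] [pv px _ _]]]]] :=
  stack_meet stackedL eL e'L ev xe' (esym xv).
- by case: (no_odd _ _ jN am eE pv).
- by case: (no_end _ _ jN am eE); rewrite px pv.
Qed.

End StackDiagram.

Lemma stack_diagram (R : realType) (ls : seq (layer R)) : stacked ls ->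
  exists D : diagram R, perm_eq (link_edges D) (stack_edges ls).
Proof.
move=> sL; have [|||||L [LE L3]] := @polygons_of_edges R (stack_edges ls).
- by move=> e e' eE e'E; exact: (tip_inj (d := false) sL eE e'E).
- exact: stack_follows.
- exact: stack_no_loop.
- exact: stack_no_digon.
- exact: uniq_stack_edges.
by exists (Diagram (stack_is_link sL LE L3) (stack_regular sL LE L3)).
Qed.

Section StackArcs.
Variables (R : realType) (ls : seq (layer R)) (D : diagram R).
Hypothesis stackedL : stacked ls.
Hypothesis DE : perm_eq (link_edges D) (stack_edges ls).
Local Notation n := (size ls).
Local Notation lay := (lay ls).
Local Notation E := (link_edges D).
Implicit Types (e : edge R) (z : 'rV[R]_3) (a b : R * bool) (i j : nat).

Let sortedL j : (j < n)%N -> layer_sorted (lay j).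
Proof. by case: stackedL => _ + _ _; exact. Qed.

Lemma DP e : (e \in E) = (e \in stack_edges ls).
Proof. exact: perm_mem. Qed.

Lemma row_in j : (j < n)%N -> row_edge j (lay j) \in E.
Proof. by rewrite DP; exact: row_in_stack. Qed.

Lemma column_in j a : (j < n)%N -> a \in strands (lay j) ->
  column_edge j (lay j) a \in E.
Proof. by rewrite DP; exact: column_in_stack. Qed.

Lemma crossing_height c : c \in crossings D -> exists j a,
  [/\ (j < n)%N, l_m (lay j) = Some a, c = (column_edge j (lay j) a, row_edge j (lay j))
  & proj (under_point c) = plane_point a.1 j.*2.+1%:R].
Proof.
move=> cD; have /crossingsP[c1 c2 _] := cD; have [co cu p h] := crosses_atP cD.
rewrite !DP in c1 c2.
have [[ou _]|[j [a [[jN am e1 e2] [z1 _ _ _]]]]|[j [a [_ [_ _ h0 h1]]]]] :=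
  stack_meet stackedL c1 c2 co cu p.
- by move: h; rewrite ou ltxx.
- exists j, a; split => //; last by rewrite -p.
  by rewrite [c]surjective_pairing e1 e2.
- by move: h; rewrite h0 h1 ltNge lerN10.
Qed.

Lemma middle_crossing j a : (j < n)%N -> l_m (lay j) = Some a ->
  (column_edge j (lay j) a, row_edge j (lay j)) \in crossings D.
Proof.
move=> jN am; have sl := sortedL jN.
have [_ _ _ /(_ _ am) /andP[h1 h2]] := strands_order sl.
apply/crossingsP; split => /=; [exact/column_in/m_strand|exact: row_in|].
have [lE hE] := middle_strand j sl am.
pose pnt h : 'rV[R]_3 := \row_(k < 3) [:: a.1; j.*2.+1%:R; h]`_k.
have pP h : proj (pnt h) = plane_point a.1 j.*2.+1%:R.
  by apply/rowP => -[[|[|//]] i]; rewrite !mxE /= inordK.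
have pH h : height (pnt h) = h by rewrite /height mxE inordK.
exists (pnt 0), (pnt (-1)); split => /=.
- apply/column_edgeP; rewrite pP plane_pointX plane_pointY pH /column_height lE hE.
  rewrite /= odd_double subrr mulr0 addr0 oppr0; split => //.
  by rewrite !ler_nat !leqnSn.
- apply/(row_edgeP _ sl); rewrite pP plane_pointX plane_pointY pH.
  by split => //; rewrite !ltW.
- by rewrite !pP.
- by rewrite !pH ltrN10.
Qed.

Lemma under_row z : under_points D z -> exists j a,
  [/\ (j < n)%N, l_m (lay j) = Some a, segment (row_edge j (lay j)) z &
      proj z = plane_point a.1 j.*2.+1%:R].
Proof.
move=> /under_pointsP[c cD ->].
have [j [a [jN am cE pu]]] := crossing_height cD; exists j, a; split => //.
by have [_ + _ _] := crosses_atP cD; rewrite {1}cE.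
Qed.

Lemma column_not_under j a z : (j < n)%N -> a \in strands (lay j) ->
  segment (column_edge j (lay j) a) z -> ~ under_points D z.
Proof.
move=> jN aS az /under_row[i [b [iN bm bz zE]]].
have [_ _ _ /(_ _ bm) /andP[h1 h2]] := strands_order (sortedL iN).
have [[_ [cr|[_ cz]]]|[k [c [_ [_ _ h0 h3]]]]|[k [c [_ [_ _ h0 h3]]]]] :=
  stack_meet stackedL (column_in_stack jN aS) (row_in_stack iN) az bz erefl.
- have : tip true (column_edge j (lay j) a) = tip true (row_edge i (lay i)) /\
      tip false (column_edge j (lay j) a) = tip false (row_edge i (lay i)).
    by rewrite cr.
  rewrite !tip_grid; have [_ pq _ _] := strands_order (sortedL iN).
  by case: (a.2); case: (l_r _) => /= -[/grid_vertex_inj[e1 _] /grid_vertex_inj[e2 _]];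
    move: pq; rewrite -e1 -e2 ltxx.
- have /corner_grid[] := cz => zz; move: zE; rewrite zz proj_grid_vertex;
    move=> /(congr1 (fun q : 'rV[R]_2 => q 0 0)); rewrite !plane_pointX => h;
    by move: h1 h2; rewrite h ltxx.
- by move: h3; rewrite h0 => /esym/eqP; rewrite oppr_eq0 oner_eq0.
- by move: h3; rewrite h0 => /esym/eqP; rewrite oppr_eq0 oner_eq0.
Qed.

Lemma column_free j a s t : (j < n)%N -> a \in strands (lay j) ->
  0 <= s <= 1 -> 0 <= t <= 1 -> free D (column_edge j (lay j) a) s t.
Proof.
move=> jN aS sI tI l lI; apply: (column_not_under jN aS).
exact/segment_pt/conv01.
Qed.

Lemma row_under j z : (j < n)%N -> segment (row_edge j (lay j)) z ->
  under_points D z -> exists2 a, l_m (lay j) = Some a & proj z 0 0 = a.1.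
Proof.
move=> jN jz /under_row[i [a [iN am _ zE]]].
have [_ zy _] := (row_edgeP j (sortedL jN) z).1 jz.
have ij : i = j.
  move: zy; rewrite zE plane_pointY => /eqP; rewrite eqr_nat => /eqP; lia.
by exists a; rewrite -?ij// zE plane_pointX.
Qed.

Lemma column_arc j a z z' : (j < n)%N -> a \in strands (lay j) ->
  segment (column_edge j (lay j) a) z -> segment (column_edge j (lay j) a) z' ->
  arc_at D z = arc_at D z'.
Proof.
move=> jN aS /segmentP[s sI ->] /segmentP[t tI ->].
by apply: arc_at_free => //; [exact: column_in|exact: column_free].
Qed.

End StackArcs.

(** * Colourings of the arcs of a stack *)

Section StackColouring.
Variables (R : realType) (ls : seq (layer R)) (Z : quandleType).

Definition right_end_colour (C : nat -> R -> Z) j : Z :=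
  let l := lay ls j in
  if l_m l is Some a then act (C j (l_p l)) (C j a.1, a.2) else C j (l_p l).

(** [C j x] is the colour of the column at the abscissa [x] in the layer [j]. It is
    constrained by the row of the layer, which changes its colour under the middle
    column, and by the columns which continue in the next layer. *)
Definition stack_colouring (C : nat -> R -> Z) : Prop :=
  (forall j, (j < size ls)%N -> C j (l_q (lay ls j)) = right_end_colour C j) /\
  (forall j a, (j.+1 < size ls)%N -> a \in above (lay ls j) -> C j a.1 = C j.+1 a.1).

End StackColouring.

Section StackArcColours.
Variables (R : realType) (ls : seq (layer R)) (D : diagram R).
Hypothesis stackedL : stacked ls.
Hypothesis DE : perm_eq (link_edges D) (stack_edges ls).
Local Notation n := (size ls).
Local Notation lay := (lay ls).
Local Notation E := (link_edges D).
Implicit Types (e : edge R) (z : 'rV[R]_3) (a b : R * bool) (i j : nat).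

Let sortedL j : (j < n)%N -> layer_sorted (lay j).
Proof. by case: stackedL => _ + _ _; exact. Qed.

Definition layer_crossing j a := (column_edge j (lay j) a, row_edge j (lay j)).

Lemma proj_direction_grid d u v :
  proj (direction (@grid_edge R d u v)) = (if d then 1 else -1) *: (proj v - proj u).
Proof.
by case: d; rewrite /direction /= linearB ?scale1r// scaleN1r opprB.
Qed.

Lemma crossing_directions j a : (j < n)%N -> l_m (lay j) = Some a ->
  proj (direction (layer_crossing j a).1) =
    plane_point 0 (if a.2 then - 2 else 2) /\
  proj (direction (layer_crossing j a).2) =
    plane_point ((if l_r (lay j) then 1 else -1) * (l_q (lay j) - l_p (lay j))) 0.
Proof.
move=> jN am; rewrite /= !proj_direction_grid !proj_grid_vertex.
have [-> ->] := middle_strand j (sortedL jN) am; split.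
  apply/rowP => i; rewrite !mxE -[j.*2.+2%:R]natr1 -[j.*2.+1%:R]natr1.
  by case: (i == 0); case: (a.2) => /=; ring.
by apply/rowP => i; rewrite !mxE; case: (i == 0); case: (l_r _) => /=; ring.
Qed.

Lemma crossing_detE j a : (j < n)%N -> l_m (lay j) = Some a ->
  crossing_det (layer_crossing j a) =
  (if a.2 == l_r (lay j) then 1 else -1) * (2 * (l_q (lay j) - l_p (lay j))).
Proof.
move=> jN am; rewrite /crossing_det.
have [-> ->] := crossing_directions jN am.
by rewrite /det2 !plane_pointX !plane_pointY; case: (a.2); case: (l_r _) => /=; ring.
Qed.

Lemma crossing_signE j a : (j < n)%N -> l_m (lay j) = Some a ->
  crossing_sign (layer_crossing j a) = if a.2 == l_r (lay j) then 1 else -1.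
Proof.
move=> jN am; rewrite /crossing_sign crossing_detE//.
have [_ pq _ _] := strands_order (sortedL jN).
have d0 : 0 < 2 * (l_q (lay j) - l_p (lay j)) by rewrite mulr_gt0 ?subr_gt0.
by case: ifP => _; rewrite ?mul1r ?mulN1r ?sgzN gtr0_sgz.
Qed.

Lemma row_under_eq j a z : (j < n)%N -> l_m (lay j) = Some a ->
  segment (row_edge j (lay j)) z -> proj z 0 0 = a.1 ->
  z = under_point (layer_crossing j a).
Proof.
move=> jN am jz zx; have cD := middle_crossing stackedL DE jN am.
have [_ cu _ _] := crosses_atP cD.
have [i [b [iN bm cE pu]]] := crossing_height stackedL DE cD.
have [_ zy _] := (row_edgeP j (sortedL jN) z).1 jz.
have [_ uy _] := (row_edgeP j (sortedL jN) (under_point (layer_crossing j a))).1 cu.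
apply: (proj_segment_inj (row_in DE jN) jz cu).
rewrite [LHS]plane_pointE zx zy [RHS]plane_pointE uy pu plane_pointX.
have ij : i = j.
  move: uy; rewrite pu plane_pointY => /eqP; rewrite eqr_nat => /eqP; lia.
by move: bm; rewrite ij am => -[->].
Qed.

Lemma row_side_free j a tau s l : (j < n)%N -> l_m (lay j) = Some a ->
  under_point (layer_crossing j a) = pt (row_edge j (lay j)) tau ->
  0 < tau < 1 -> s = 0 \/ s = 1 -> 0 < l <= 1 ->
  ~ under_points D (pt (row_edge j (lay j)) (tau + l * (s - tau))).
Proof.
move=> jN am uE /andP[t0 t1] s01 /andP[l0 l1].
have sI : 0 <= tau + l * (s - tau) <= 1.
  by apply: conv01; rewrite ?l1 ?(ltW l0) ?(ltW t0) ?(ltW t1)//;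
    case: s01 => ->; rewrite ?lexx ?ler01.
move=> /(row_under stackedL DE jN (segment_pt _ sI))[b bm xb].
have ab : a = b by move: bm; rewrite am => -[].
have := row_under_eq jN am (segment_pt _ sI); rewrite xb ab => /(_ erefl).
rewrite -ab uE => /(pt_inj (diagram_is_link D) (row_in DE jN)) /eqP.
rewrite -subr_eq0 addrAC subrr add0r mulf_eq0 (gt_eqF l0) /= subr_eq0 => /eqP st.
by case: s01 => h; move: t0 t1; rewrite -st h ltxx.
Qed.

(** The normal of the middle column points to the right if [a.2], and then the
    left half of the row is the initial under-arc, whatever the direction of the
    row. *)
Lemma row_arcs j a : (j < n)%N -> l_m (lay j) = Some a ->
  let c := layer_crossing j a in
  (under_ini D c, under_ter D c) =
    if a.2 then (arc_at D (grid_vertex (l_p (lay j)) j.*2.+1),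
                 arc_at D (grid_vertex (l_q (lay j)) j.*2.+1))
    else (arc_at D (grid_vertex (l_q (lay j)) j.*2.+1),
          arc_at D (grid_vertex (l_p (lay j)) j.*2.+1)).
Proof.
move=> jN am c; have cD : c \in crossings D := middle_crossing stackedL DE jN am.
have [tau tI uE] := under_param cD; have /andP[t0 t1] := tI.
have fr s l := @row_side_free j a tau s l jN am uE tI.
have [_ pq _ _] := strands_order (sortedL jN).
have d0 : 0 < 2 * (l_q (lay j) - l_p (lay j)) by rewrite mulr_gt0 ?subr_gt0.
have tI' : 0 <= tau <= 1 by rewrite !ltW.
have I0 : 0 <= (0 : R) <= 1 by rewrite lexx ler01.
have I1 : 0 <= (1 : R) <= 1 by rewrite lexx ler01.
have iniE s : s = 0 \/ s = 1 -> 0 < (tau - s) * crossing_det c ->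
    under_ini D c = arc_at D (pt c.2 s).
  move=> s01 h; apply: (under_iniE cD uE tI' _ h) => [|l lI]; last exact: fr.
  by case: s01 => ->.
have terE s : s = 0 \/ s = 1 -> 0 < (s - tau) * crossing_det c ->
    under_ter D c = arc_at D (pt c.2 s).
  move=> s01 h; apply: (under_terE cD uE tI' _ h) => [|l lI]; last exact: fr.
  by case: s01 => ->.
have detE := crossing_detE jN am; rewrite -/c in detE.
pose rev := ~~ (a.2 == l_r (lay j)).
have ini_rev : under_ini D c = arc_at D (pt c.2 (if rev then 1 else 0)).
  apply: iniE; rewrite ?detE /rev; first by case: ifP; [right|left].
  by case: eqP => _ /=; rewrite ?mul1r ?mulN1r ?mulrN -?mulNr mulr_gt0//; lra.
have ter_rev : under_ter D c = arc_at D (pt c.2 (if rev then 0 else 1)).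
  apply: terE; rewrite ?detE /rev; first by case: ifP; [left|right].
  by case: eqP => _ /=; rewrite ?mul1r ?mulN1r ?mulrN -?mulNr mulr_gt0//; lra.
rewrite ini_rev ter_rev /rev /c /= /row_edge.
by case: (a.2); case: (l_r _) => /=; rewrite pt0 pt1.
Qed.

Lemma row_arc_plain j : (j < n)%N -> l_m (lay j) = None ->
  arc_at D (grid_vertex (l_p (lay j)) j.*2.+1) =
  arc_at D (grid_vertex (l_q (lay j)) j.*2.+1).
Proof.
move=> jN m0; have I0 : 0 <= (0 : R) <= 1 by rewrite lexx ler01.
have I1 : 0 <= (1 : R) <= 1 by rewrite lexx ler01.
have : arc_at D (pt (row_edge j (lay j)) 0) = arc_at D (pt (row_edge j (lay j)) 1).
  apply: arc_at_free => //; first exact: row_in.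
  move=> l lI /(row_under stackedL DE jN (segment_pt _ (conv01 I0 I1 lI)))[a].
  by rewrite m0.
by rewrite pt0 pt1 /row_edge; case: (l_r _).
Qed.

Lemma segment_fst (u v : 'rV[R]_3) : segment (u, v) u.
Proof. by apply/segmentP; exists 0; rewrite ?lexx ?ler01 ?pt0. Qed.

Lemma segment_snd (u v : 'rV[R]_3) : segment (u, v) v.
Proof. by apply/segmentP; exists 1; rewrite ?lexx ?ler01 ?pt1. Qed.

Lemma grid_vertex_lo j a : segment (column_edge j (lay j) a)
  (grid_vertex a.1 (lo j (lay j) a.1)).
Proof. exact/segment_grid_edge/segment_fst. Qed.

Lemma grid_vertex_hi j a : segment (column_edge j (lay j) a)
  (grid_vertex a.1 (hi j (lay j) a.1)).
Proof. exact/segment_grid_edge/segment_snd. Qed.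

Lemma grid_vertex_p j : segment (column_edge j (lay j) (l_p (lay j), l_sp (lay j)))
  (grid_vertex (l_p (lay j)) j.*2.+1).
Proof.
have /orP[/eqP h|/eqP h] := p_half j (lay j).
- by have := grid_vertex_lo j (l_p (lay j), l_sp (lay j)); rewrite /= h.
- by have := grid_vertex_hi j (l_p (lay j), l_sp (lay j)); rewrite /= h.
Qed.

Lemma grid_vertex_q j : (j < n)%N ->
  segment (column_edge j (lay j) (l_q (lay j), l_sq (lay j)))
  (grid_vertex (l_q (lay j)) j.*2.+1).
Proof.
move=> jN; have /orP[/eqP h|/eqP h] := q_half j (sortedL jN).
- by have := grid_vertex_lo j (l_q (lay j), l_sq (lay j)); rewrite /= h.
- by have := grid_vertex_hi j (l_q (lay j), l_sq (lay j)); rewrite /= h.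
Qed.

Definition column_colour j (x : R) : knot_quandle D :=
  canonical_colouring (arc_at D (grid_vertex x (lo j (lay j) x))).

Lemma column_colourE j a z : (j < n)%N -> a \in strands (lay j) ->
  segment (column_edge j (lay j) a) z ->
  canonical_colouring (arc_at D z) = column_colour j a.1.
Proof.
move=> jN aS az; congr canonical_colouring.
by apply: (column_arc stackedL DE jN aS az); exact: grid_vertex_lo.
Qed.

Lemma crossing_relation c : c \in crossings D ->
  canonical_colouring (under_ini D c) ◁ canonical_colouring (over_arc D c) =
  canonical_colouring (under_ter D c).
Proof.
move=> cD; rewrite /canonical_colouring /pgen -[LHS]/(pop _ _) popE.
by apply/pi_qcong/qcong_rel; exists c.
Qed.

Lemma over_colour j a : (j < n)%N -> l_m (lay j) = Some a ->
  canonical_colouring (over_arc D (layer_crossing j a)) = column_colour j a.1.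
Proof.
move=> jN am; have cD := middle_crossing stackedL DE jN am.
have [co _ _ _] := crosses_atP cD.
by apply: (column_colourE jN _ co); exact: m_strand.
Qed.

Lemma column_colouring : stack_colouring ls column_colour.
Proof.
split=> [j jN|j a j1N aA].
  have -> : column_colour j (l_q (lay j)) =
      canonical_colouring (arc_at D (grid_vertex (l_q (lay j)) j.*2.+1)).
    by rewrite (column_colourE jN (q_strand _) (grid_vertex_q jN)).
  rewrite /right_end_colour.
  have pE : column_colour j (l_p (lay j)) =
      canonical_colouring (arc_at D (grid_vertex (l_p (lay j)) j.*2.+1)).
    by rewrite (column_colourE jN (p_strand _) (grid_vertex_p j)).
  case am : (l_m _) => [a|]; last by rewrite pE (row_arc_plain jN am).
  have cD := middle_crossing stackedL DE jN am.
  have := crossing_relation cD; have := row_arcs jN am.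
  rewrite over_colour// /layer_crossing pE /act /=.
  case: (a.2) => -[-> ->] <- //.
  by rewrite qopK.
have jN := ltnW j1N.
have /state_below[_ aB] : a \in state ls j.+1 by rewrite -above_state.
have aS : a \in strands (lay j) by move: aA; rewrite mem_filter => /andP[].
have aS' : a \in strands (lay j.+1) by move: aB; rewrite mem_filter => /andP[].
rewrite -(column_colourE jN aS (grid_vertex_hi j a)).
rewrite -(column_colourE j1N aS' (grid_vertex_lo j.+1 a)).
move: aA aB; rewrite !mem_filter => /andP[aA _] /andP[aB _].
by rewrite /lo aB /hi aA doubleS.
Qed.

Section Label.
Variables (Z : quandleType) (C : nat -> R -> Z).
Hypothesis colC : stack_colouring ls C.

Definition row_colour j (x : R) : Z :=
  if l_m (lay j) is Some a then
    if x < a.1 then C j (l_p (lay j)) else C j (l_q (lay j))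
  else C j (l_p (lay j)).

(** A relation rather than a function, because a vertex lies on two edges. *)
Definition label z (c : Z) : Prop := exists2 j, (j < n)%N &
  (exists2 a, a \in strands (lay j) &
     segment (column_edge j (lay j) a) z /\ c = C j a.1) \/
  (segment (row_edge j (lay j)) z /\ c = row_colour j (proj z 0 0)).

Lemma row_colour_p j : (j < n)%N -> row_colour j (l_p (lay j)) = C j (l_p (lay j)).
Proof.
move=> jN; have [_ _ _ pm] := strands_order (sortedL jN).
rewrite /row_colour; case am : (l_m _) => [a|]//.
by have /andP[-> _] := pm _ am.
Qed.

Lemma row_colour_q j : (j < n)%N -> row_colour j (l_q (lay j)) = C j (l_q (lay j)).
Proof.
move=> jN; have [_ _ _ pm] := strands_order (sortedL jN).
rewrite /row_colour; case am : (l_m _) => [a|].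
  by have /andP[_ /ltW] := pm _ am; rewrite leNgt => /negbTE ->.
by case: colC => /(_ j jN) + _; rewrite /right_end_colour am.
Qed.

Lemma label_uniq z c c' : label z c -> label z c' -> c = c'.
Proof.
have cc i j a b x : (i < n)%N -> (j < n)%N -> (i <= j)%N ->
    a \in strands (lay i) -> b \in strands (lay j) ->
    segment (column_edge i (lay i) a) x -> segment (column_edge j (lay j) b) x ->
    C i a.1 = C j b.1.
  move=> iN jN ij aS bS ax bx.
  have [ax1 axy _] := (column_edgeP i (lay i) a x).1 ax.
  have [bx1 bxy _] := (column_edgeP j (lay j) b x).1 bx.
  have ab : a.1 = b.1 by rewrite -ax1.
  move: ij; rewrite leq_eqVlt => /predU1P[->|ij]; first by rewrite ab.
  have [Ej E1 _ _] := layer_index ij axy bxy.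
  rewrite -ab Ej; apply: colC.2; first by rewrite -Ej.
  rewrite mem_filter aS andbT; move: E1; rewrite /hi; case: ifP => // _; lia.
have rc i j a x : (i < n)%N -> (j < n)%N -> a \in strands (lay j) ->
    segment (row_edge i (lay i)) x -> segment (column_edge j (lay j) a) x ->
    row_colour i (proj x 0 0) = C j a.1.
  move=> iN jN aS rx ax.
  have [ax1 axy _] := (column_edgeP j (lay j) a x).1 ax.
  have [_ xy _] := (row_edgeP i (sortedL iN) x).1 rx.
  have ij := row_layer xy axy; rewrite ij in rx xy *.
  have [[_ [rc _]]|[_ h1 h0 _ _]] := row_column_meet (sortedL jN) aS rx ax erefl.
    have /corner_grid[xE|xE] := rc.
      have xp : proj x 0 0 = l_p (lay j) by rewrite xE proj_grid_vertex plane_pointX.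
      by rewrite -ax1 xp row_colour_p.
    have xq : proj x 0 0 = l_q (lay j) by rewrite xE proj_grid_vertex plane_pointX.
    by rewrite -ax1 xq row_colour_q.
  by move: h1; rewrite h0 => /esym/eqP; rewrite oppr_eq0 oner_eq0.
move=> [i iN [[a aS [az ->]]|[rz ->]]] [j jN [[b bS [bz ->]]|[rz' ->]]].
- have [ij|/ltnW ji] := leqP i j; first exact: cc az bz.
  by apply/esym/(cc _ _ _ _ z).
- by apply/esym/(rc _ _ _ z).
- exact: (rc _ _ _ z).
- have [_ zy _] := (row_edgeP i (sortedL iN) z).1 rz.
  have [_ zy' _] := (row_edgeP j (sortedL jN) z).1 rz'.
  suff -> : i = j by [].
  by move: zy'; rewrite zy => /eqP; rewrite eqr_nat => /eqP; lia.
Qed.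

(** The colour of a row changes only below the middle column, at an
    under-point. *)
Lemma label_free e s t c : e \in E -> 0 <= s <= 1 -> 0 <= t <= 1 ->
  free D e s t -> label (pt e s) c -> label (pt e t) c.
Proof.
move=> eE sI tI st; move: (eE); rewrite (DP DE) => /stack_edgesP[j jN [eR|[a aS eC]]];
  last first.
  rewrite {}eC in st *.
  have ls_ : label (pt (column_edge j (lay j) a) s) (C j a.1).
    by exists j => //; left; exists a => //; split => //; exact: segment_pt.
  move=> /(label_uniq ls_) <-.
  by exists j => //; left; exists a => //; split => //; exact: segment_pt.
rewrite {}eR in eE st *; set e' := row_edge j (lay j) in st *.
have ls_ u : 0 <= u <= 1 -> label (pt e' u) (row_colour j (proj (pt e' u) 0 0)).
  by move=> uI; exists j => //; right; split => //; exact: segment_pt.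
move=> /(label_uniq (ls_ s sI)) <-; suff -> : row_colour j (proj (pt e' s) 0 0) =
  row_colour j (proj (pt e' t) 0 0) by exact: ls_.
rewrite /row_colour; case am : (l_m _) => [a|]//.
have no_mid u v : 0 <= u <= 1 -> 0 <= v <= 1 -> free D e' u v ->
    proj (pt e' u) 0 0 < a.1 -> a.1 <= proj (pt e' v) 0 0 -> False.
  move=> uI vI uv xu xv; set x := proj (pt e' u) 0 0 in xu xv *.
  set y := proj (pt e' v) 0 0 in xv *.
  have xy : 0 < y - x by rewrite subr_gt0; exact: lt_le_trans xu xv.
  pose l := (a.1 - x) / (y - x).
  have lI : 0 <= l <= 1.
    rewrite /l ler_pdivrMr// mul1r lerD2r xv andbT.
    by rewrite divr_ge0 ?subr_ge0 ?ltW// -subr_gt0.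
  apply: (uv l lI).
  have wI := conv01 uI vI lI.
  have wx : proj (pt e' (u + l * (v - u))) 0 0 = a.1.
    have convX (f g : 'rV[R]_2) k : (f + k *: (g - f)) 0 0 = f 0 0 + k * (g 0 0 - f 0 0).
      by rewrite !mxE.
    by rewrite proj_pt_conv convX -/x -/y /l divfK ?gt_eqF// addrC subrK.
  rewrite (row_under_eq jN am (segment_pt _ wI) wx).
  exact/under_points_under/(middle_crossing stackedL DE jN am).
case: ltP => xs; case: ltP => xt //.
- by case: (no_mid s t sI tI st xs xt).
- by case: (no_mid t s tI sI (freeC st) xt xs).
Qed.

Definition arc_colour (a : arc D) : Z :=
  xget (C 0 0) [set c | exists2 z, component_set a z & label z c].

Lemma arc_colourE (a : arc D) z c :
  component_set a z -> label z c -> arc_colour a = c.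
Proof.
move=> az zc; rewrite /arc_colour.
have [z' az' z'c] : [set c | exists2 z, component_set a z & label z c] (arc_colour a).
  by apply: (@xgetPex _ (C 0 0) [set c | exists2 z, component_set a z & label z c]);
    exists c, z.
apply: label_uniq z'c _.
apply: (arc_label (P := label^~ c) _ az az' zc) => e s t eE sI tI st.
exact: label_free.
Qed.

Lemma arc_colour_column j a z : (j < n)%N -> a \in strands (lay j) ->
  segment (column_edge j (lay j) a) z -> arc_colour (arc_at D z) = C j a.1.
Proof.
move=> jN aS az; apply: (@arc_colourE _ z); last first.
  by exists j => //; left; exists a.
apply: arc_atP; split; last exact: (column_not_under stackedL DE jN aS az).
by exists (column_edge j (lay j) a) => //; exact: column_in.
Qed.

Lemma arc_colour_crossing c : c \in crossings D ->
  arc_colour (under_ini D c) ◁ arc_colour (over_arc D c) =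
  arc_colour (under_ter D c).
Proof.
move=> cD; have [j [a [jN am cE _]]] := crossing_height stackedL DE cD.
have [co _ _ _] := crosses_atP cD.
have -> : arc_colour (over_arc D c) = C j a.1.
  by apply: (arc_colour_column jN (m_strand am)); rewrite cE in co *.
have pE : arc_colour (arc_at D (grid_vertex (l_p (lay j)) j.*2.+1)) = C j (l_p (lay j)).
  exact: (arc_colour_column jN (p_strand _) (grid_vertex_p j)).
have qE : arc_colour (arc_at D (grid_vertex (l_q (lay j)) j.*2.+1)) = C j (l_q (lay j)).
  exact: (arc_colour_column jN (q_strand _) (grid_vertex_q jN)).
have := row_arcs jN am; rewrite -[layer_crossing j a]cE.
have := colC.1 j jN; rewrite /right_end_colour am /act /=.
by case: (a.2) => h -[-> ->]; rewrite pE qE h ?qopVK.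
Qed.

End Label.

End StackArcColours.

(** * Colourings of the regions of a stack *)

Section RegionColour.
Variables (R : realType) (ls : seq (layer R)) (D : diagram R).
Hypothesis stackedL : stacked ls.
Hypothesis DE : perm_eq (link_edges D) (stack_edges ls).
Local Notation n := (size ls).
Local Notation lay := (lay ls).
Variables (Z : quandleType) (C : nat -> R -> Z) (al : Z).
Hypothesis colC : stack_colouring ls C.
Implicit Types (z : 'rV[R]_3) (a b : R * bool) (i j : nat) (x y : R)
  (S : seq (R * bool)).

Let sortedL j : (j < n)%N -> layer_sorted (lay j).
Proof. by case: stackedL => _ + _ _; exact. Qed.

(** The index of the state cut out by the horizontal line at height [y]; the line
    through a row counts as lying above the row. *)
Definition level y : nat := find (fun j => y < j.*2.+1%:R) (iota 0 n).

Lemma levelE j y : (j <= n)%N -> (forall i, (i < j)%N -> i.*2.+1%:R <= y) ->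
  ((j < n)%N -> y < j.*2.+1%:R) -> level y = j.
Proof.
move=> jn lej gtj; rewrite /level -(subnKC jn) iotaD find_cat size_iota add0n.
case: ifP => [/hasP[i]|_].
  by rewrite mem_iota add0n => /= /lej; rewrite leNgt => /negbTE ->.
case E : (n - j)%N => [|k] /=; first by rewrite addn0.
by rewrite gtj ?addn0// -subn_gt0 E.
Qed.

Lemma levelP y : [/\ (level y <= n)%N,
  forall i, (i < level y)%N -> i.*2.+1%:R <= y &
  (level y < n)%N -> y < (level y).*2.+1%:R].
Proof.
split.
- by rewrite /level -[X in (_ <= X)%N](size_iota 0 n) find_size.
- move=> i il; have := before_find 0 il.
  have iN : (i < n)%N.
    by apply: leq_trans il _; rewrite /level -[X in (_ <= X)%N](size_iota 0 n) find_size.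
  by rewrite nth_iota// add0n => /negbT; rewrite -leNgt.
- rewrite /level -[X in (_ < X)%N](size_iota 0 n) -has_find => h.
  have := nth_find 0 h; rewrite nth_iota ?add0n//.
  by move: h; rewrite has_find size_iota.
Qed.

Definition colour_letter j a : letter Z := (C j a.1, a.2).
Definition strand_word j S : seq (letter Z) := map (colour_letter j) S.
Definition left_of x S := [seq a <- S | a.1 < x].

Definition state_action j x : Z := acts al (strand_word j (left_of x (state ls j))).

(** Defined at all points of the plane, but meaningful off the diagram only. *)
Definition point_colour (p : 'rV[R]_2) : Z := state_action (level (p 0 1)) (p 0 0).

Lemma state_action_above j x : (j < n)%N ->
  state_action j.+1 x = acts al (strand_word j (left_of x (above (lay j)))).
Proof.
move=> jN; rewrite /state_action -above_state//; congr acts.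
apply/eq_in_map => a; rewrite mem_filter => /andP[_ aA].
rewrite /colour_letter; congr (_, _); apply/esym/colC.2 => //.
by move: aA; rewrite above_state// => /state_below[].
Qed.

Lemma state_action_below j x : (j < n)%N ->
  state_action j x = acts al (strand_word j (left_of x (below (lay j)))).
Proof. by move=> jN; rewrite /state_action /state jN. Qed.

Lemma kept_split d (l : layer R) x : layer_sorted l ->
  left_of x (kept_strands d l) =
  left_of x (l_U l) ++ nseq ((d == l_dp l) && (l_p l < x)) (l_p l, l_sp l) ++
  left_of x (seq_of_opt (l_m l)) ++
  nseq ((d == l_dq l) && (l_q l < x)) (l_q l, l_sq l) ++ left_of x (l_V l).
Proof.
move=> sl; rewrite kept_strandsE// /left_of !filter_cat.
congr (_ ++ (_ ++ (_ ++ (_ ++ _)))).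
- by case: (d == _) => //=; case: (l_p l < x).
- by case: (d == _) => //=; case: (l_q l < x).
Qed.

Lemma state_action_kept (d : bool) j x : (j < n)%N ->
  state_action (if d then j else j.+1) x =
  acts al (strand_word j (left_of x (kept_strands d (lay j)))).
Proof.
move=> jN; case: d; first exact: state_action_below.
exact: state_action_above.
Qed.

Definition layer_event j : event Z :=
  let l := lay j in
  Event (l_r l) (l_dp l) (l_dq l) (C j (l_p l)) (omap (colour_letter j) (l_m l)).

Definition layer_left j : Z := acts al (strand_word j (l_U (lay j))).

Lemma left_of_all x S : (forall a, a \in S -> a.1 < x) -> left_of x S = S.
Proof. by move=> h; apply/all_filterP/allP. Qed.

Lemma left_of_none x S : (forall a, a \in S -> x <= a.1) -> left_of x S = [::].
Proof.
move=> h; rewrite /left_of -(filter_pred0 S); apply: eq_in_filter => a /h.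
by rewrite leNgt => /negbTE.
Qed.

Lemma action_left d j x : (j < n)%N -> x <= l_p (lay j) ->
  state_action (if d then j else j.+1) x =
  acts al (strand_word j (left_of x (l_U (lay j)))).
Proof.
move=> jN xp; have sl := sortedL jN; have [_ pq hV hm] := strands_order sl.
rewrite state_action_kept// kept_split//.
rewrite !ltNge xp (le_trans xp (ltW pq)) !andbF /=.
rewrite (@left_of_none _ (seq_of_opt _)) ?(@left_of_none _ (l_V _)) ?cats0//.
- by move=> a /hV /ltW; apply: le_trans; exact: le_trans xp (ltW pq).
- move=> a; case: (l_m _) hm => //= m /(_ _ erefl)/andP[pm _].
  by rewrite inE => /eqP ->; exact: le_trans xp (ltW pm).
Qed.

Lemma action_middle (d : bool) j x : (j < n)%N -> l_p (lay j) < x <= l_q (lay j) ->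
  state_action (if d then j else j.+1) x =
  acts (layer_left j) (nseq (d == l_dp (lay j)) (left_letter (layer_event j)) ++
    strand_word j (left_of x (seq_of_opt (l_m (lay j))))).
Proof.
move=> jN /andP[px xq]; have sl := sortedL jN; have [hU pq hV hm] := strands_order sl.
rewrite state_action_kept// kept_split// px andbT ltNge xq andbF /=.
rewrite (@left_of_none _ (l_V _)) ?cats0; last first.
  by move=> a /hV /ltW; apply: le_trans.
rewrite (@left_of_all _ (l_U _)); last by move=> a /hU ap; exact: lt_trans px.
rewrite /strand_word !map_cat map_nseq acts_cat; congr acts.
Qed.

Lemma action_right (d : bool) j x : (j < n)%N -> l_q (lay j) < x ->
  state_action (if d then j else j.+1) x =
  acts (acts (layer_left j)
    (if d then below_word (layer_event j) else above_word (layer_event j)))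
    (strand_word j (left_of x (l_V (lay j)))).
Proof.
move=> jN qx; have sl := sortedL jN; have [hU pq hV hm] := strands_order sl.
have px := lt_trans pq qx.
rewrite state_action_kept// kept_split// px qx !andbT.
rewrite (@left_of_all _ (l_U _)); last by move=> a /hU ap; exact: lt_trans px.
rewrite (@left_of_all _ (seq_of_opt _)); last first.
  move=> a; case: (l_m _) hm => //= m /(_ _ erefl)/andP[_ mq].
  by rewrite inE => /eqP ->; exact: lt_trans qx.
rewrite -acts_cat /layer_left -acts_cat /strand_word !map_cat !map_nseq.
have qE : colour_letter j (l_q (lay j), l_sq (lay j)) = right_letter (layer_event j).
  rewrite /colour_letter /right_letter /right_colour /= colC.1// /right_end_colour.
  by case: (l_m _).
have mE : [seq colour_letter j a | a <- seq_of_opt (l_m (lay j))] =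
    seq_of_opt (ev_over (layer_event j)).
  by rewrite /=; case: (l_m _).
rewrite qE mE; congr (acts _ (_ ++ _)).
by case: d; rewrite /below_word /above_word /= ?(eqb_id, eqbF_neg) -!catA //;
  case: (l_dp _); case: (l_dq _).
Qed.

(** Beyond the right end of the row, the words below and above it act in the same
    way by [acts_event]. *)
Lemma row_crossed j x : (j < n)%N -> (x < l_p (lay j)) || (l_q (lay j) < x) ->
  state_action j x = state_action j.+1 x.
Proof.
move=> jN /orP[xp|qx].
  by rewrite (action_left true jN (ltW xp)) (action_left false jN (ltW xp)).
by rewrite (action_right true jN qx) (action_right false jN qx) acts_event.
Qed.

Local Notation B := (~` (@proj R @` link_set D)).

Lemma column_in_proj j a y : (j < n)%N -> a \in strands (lay j) ->
  (lo j (lay j) a.1)%:R <= y <= (hi j (lay j) a.1)%:R ->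
  (@proj R @` link_set D) (plane_point a.1 y).
Proof.
move=> jN aS ylh.
pose z : 'rV[R]_3 := \row_(k < 3) [:: a.1; y; column_height j (lay j) a.1 y]`_k.
have zP : proj z = plane_point a.1 y.
  by apply/rowP => -[[|[|//]] i]; rewrite !mxE /= inordK.
have zH : height z = column_height j (lay j) a.1 y by rewrite /height mxE inordK.
exists z => //; exists (column_edge j (lay j) a); first exact: (column_in DE).
by apply/column_edgeP; rewrite zP plane_pointX plane_pointY zH.
Qed.

Lemma row_in_proj j x : (j < n)%N -> l_p (lay j) <= x <= l_q (lay j) ->
  (@proj R @` link_set D) (plane_point x j.*2.+1%:R).
Proof.
move=> jN xpq.
pose z : 'rV[R]_3 := \row_(k < 3) [:: x; j.*2.+1%:R; -1]`_k.
have zP : proj z = plane_point x j.*2.+1%:R.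
  by apply/rowP => -[[|[|//]] i]; rewrite !mxE /= inordK.
have zH : height z = -1 by rewrite /height mxE inordK.
exists z => //; exists (row_edge j (lay j)); first exact: (row_in DE).
by apply/(row_edgeP _ (sortedL jN)); rewrite zP plane_pointX plane_pointY zH.
Qed.

Lemma state_in_proj j a y : a \in state ls j ->
  (forall i, i.+1 = j -> i.*2.+1%:R <= y) -> y <= j.*2.+1%:R ->
  (@proj R @` link_set D) (plane_point a.1 y).
Proof.
move=> aj y1 y2; have [jN aB] := state_below aj.
have aS : a \in strands (lay j) by move: aB; rewrite mem_filter => /andP[].
have [y3|y3] := leP j.*2%:R y.
  apply: (column_in_proj jN aS); apply/andP; split.
    by move: aB; rewrite mem_filter /lo => /andP[->].
  apply: le_trans y2 _; rewrite ler_nat.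
  by have /andP[] := hi_bounds j (lay j) a.1.
case: j aj y1 y2 jN aB aS y3 => [|j] aj y1 y2 jN aB aS y3.
  by move: aj; case: stackedL => _ _ ->.
have jN' := ltnW jN; move: aj; rewrite -above_state// mem_filter => /andP[aA aS'].
apply: (column_in_proj jN' aS'); apply/andP; split.
  apply: le_trans (y1 j erefl); rewrite ler_nat.
  by have /andP[] := lo_bounds j (lay j) a.1.
by rewrite /hi aA -doubleS ltW.
Qed.

Lemma near_coord (k : 'I_2) (p : 'rV[R]_2) (P : R -> Prop) :
  (\forall x \near p 0 k, P x) -> \forall w \near p, P ((w : 'rV[R]_2) 0 k).
Proof. by move=> h; exact: (@coord_continuous R 1 2 0 k p _ h). Qed.

Lemma near_left_of (S : seq (R * bool)) x : (forall a, a \in S -> a.1 != x) ->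
  \forall x' \near x, left_of x' S = left_of x S.
Proof.
move=> Sx; have : \forall x' \near x, forall a, a \in S -> (a.1 < x') = (a.1 < x).
  apply: (@near_seq _ _ (nbhs_filter x)) => a /Sx; rewrite neq_lt => /orP[ax|xa].
    by apply: filterS (near_above ax) => x' ax'; rewrite ax.
  apply: filterS (near_below xa) => x' xa'.
  by rewrite !ltNge (ltW xa) (ltW xa').
by apply: filterS => x' h; apply: eq_in_filter.
Qed.

Lemma near_level y : \forall y' \near y, level y' = level y \/
  exists2 i, (level y = i.+1 /\ y = i.*2.+1%:R) & level y' = i.
Proof.
have [jn lej gtj] := levelP y.
have up : \forall y' \near y, (level y < n)%N -> y' < (level y).*2.+1%:R.
  have [jN|jN] := boolP (level y < n)%N; last first.
    by apply: (@nearW _ _ _ (nbhs_filter y)) => y' h; case/negP: jN.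
  by apply: filterS (near_below (gtj jN)) => y' ? _.
case E : (level y) => [|i]; rewrite E in jn lej gtj up *.
  apply: filterS up => y' h; left; exact: levelE.
have iN : (i < n)%N by [].
have low : \forall y' \near y, forall k, (k < i)%N -> k.*2.+1%:R <= y'.
  case: i {E jn gtj up iN} lej => [|i] lej.
    exact: (@nearW _ _ _ (nbhs_filter y)).
  have h : i.*2.+1%:R < y.
    by apply: lt_le_trans (lej i.+1 _) => //; rewrite ltr_nat; lia.
  apply: filterS (near_above h) => y' iy k ki; apply: le_trans (ltW iy).
  by rewrite ler_nat; lia.
have := lej i (ltnSn i); rewrite le_eqVlt => /predU1P[yE|yi].
  apply: filterS2 up low => y' up low.
  have [iy|yi] := leP i.*2.+1%:R y'.
    left; apply: levelE => // k; rewrite ltnS leq_eqVlt => /predU1P[->//|]; exact: low.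
  right; exists i; first by split => //.
  by apply: levelE => //; exact: ltnW.
apply: filterS3 up low (near_above yi) => y' up low iy; left.
apply: levelE => // k; rewrite ltnS leq_eqVlt => /predU1P[->|]; first exact: ltW.
exact: low.
Qed.

(** Off the diagram no strand of the state has the abscissa of the point, and
    so the strands to the left of a nearby point are the same. If the point is at
    the level of a row, it is not between the ends of the row and [row_crossed]
    applies. *)
Lemma point_colour_locally_constant (p : 'rV[R]_2) : B p ->
  \forall w \near p, B w -> point_colour w = point_colour p.
Proof.
move=> pB; set y := p 0 1; set x := p 0 0.
have pE : p = plane_point x y by exact: plane_pointE.
have [jn lej gtj] := levelP y.
have free_pos j : (forall i, i.+1 = j -> i.*2.+1%:R <= y) -> y <= j.*2.+1%:R ->
    forall a, a \in state ls j -> a.1 != x.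
  move=> y1 y2 a aj; apply/eqP => ax; apply: pB; rewrite pE -ax.
  exact: state_in_proj aj y1 y2.
have near_state j : (forall a, a \in state ls j -> a.1 != x) ->
    \forall w \near p, state_action j ((w : 'rV[R]_2) 0 0) = state_action j x.
  move=> /near_left_of h; have := near_coord h.
  by apply: (@filterS _ _ (nbhs_filter p)) => w; rewrite /state_action => ->.
have posj : forall a, a \in state ls (level y) -> a.1 != x.
  move=> a aj; have [jN _] := state_below aj.
  by apply: free_pos aj => [i ij|]; [apply: lej; rewrite -ij|exact: ltW (gtj jN)].
have nl := near_coord (near_level y); have ns := near_state _ posj.
case E : (level y) => [|i].
  rewrite E in ns.
  apply: (@filterS2 _ _ (nbhs_filter p)) nl ns => w [wl|[k [kE _]]] wE _.
    by rewrite /point_colour wl -/x -/y E.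
  by move: kE; rewrite E.
have [yE|yE] := eqVneq y i.*2.+1%:R; last first.
  rewrite E in ns.
  apply: (@filterS2 _ _ (nbhs_filter p)) nl ns => w [wl|[k [kE ky] _]] wE _.
    by rewrite /point_colour wl -/x -/y E.
  by move: kE; rewrite E => -[ik]; move: yE; rewrite ky ik eqxx.
have iN : (i < n)%N by rewrite -E.
have posi : forall a, a \in state ls i -> a.1 != x.
  apply: free_pos => [k ki|]; last by rewrite yE.
  by rewrite yE -ki ler_nat; lia.
have xpq : (x < l_p (lay i)) || (l_q (lay i) < x).
  rewrite !ltNge -negb_and; apply/negP => /= xpq; apply: pB.
  by rewrite pE yE; exact: row_in_proj.
have ns' := near_state _ posi; rewrite E in ns.
apply: (@filterS3 _ _ (nbhs_filter p)) nl ns ns' => w [wl|[k [kE _] wl]] w1 w2 _.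
  by rewrite /point_colour wl -/x -/y E.
move: kE; rewrite E => -[ik]; rewrite /point_colour wl -ik w2 -/x -/y E.
exact: row_crossed.
Qed.

Lemma near_jump (S : seq (R * bool)) a : sorted <%R (map fst S) -> a \in S ->
  \forall t \near 0^'+, left_of (a.1 - t) S = left_of a.1 S /\
    left_of (a.1 + t) S = rcons (left_of a.1 S) a.
Proof.
move=> sS aS.
have : \forall t \near (0 : R)^'+, forall b, b \in S ->
    (b.1 < a.1 - t) = (b.1 < a.1) /\ (b.1 < a.1 + t) = (b.1 <= a.1).
  apply: near_seq => b bS; have [ba|ab|ab] := ltgtP b.1 a.1.
  - have d0 : 0 < a.1 - b.1 by rewrite subr_gt0.
    apply: filterS2 (nbhs_right_lt d0) (nbhs_right_gt 0) => t td t0; split.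
      by rewrite ltrBrDr -ltrBrDl td.
    by rewrite (lt_trans ba)// ltrDl.
  - have d0 : 0 < b.1 - a.1 by rewrite subr_gt0.
    apply: filterS2 (nbhs_right_lt d0) (nbhs_right_gt 0) => t td t0; split.
      by rewrite ltNge (le_trans _ (ltW ab))// gerBl ltW.
    by rewrite ltNge -lerBrDl (ltW td).
  - apply: filterS (nbhs_right_gt 0) => t t0; rewrite ab; split; last by rewrite ltrDl.
    by apply/negbTE; rewrite -leNgt gerBl ltW.
apply: filterS => t h; split.
  by apply: eq_in_filter => b /h[].
have [S1 [S2 SE]] : exists S1 S2, S = S1 ++ a :: S2.
  by case/splitPr: aS => S1 S2; exists S1, S2.
move: sS; rewrite SE map_cat (sorted_pairwise lt_trans) pairwise_cat /=.
move=> /and3P[/allrelP h1 _ /andP[/allP h2 _]].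
have S1a b : b \in S1 -> b.1 < a.1.
  by move=> bS; apply: h1; [exact: map_f|exact: mem_head].
have S2a b : b \in S2 -> a.1 < b.1 by move=> bS; apply: h2; exact: map_f.
have -> : left_of (a.1 + t) (S1 ++ a :: S2) =
    [seq b <- S1 ++ a :: S2 | b.1 <= a.1].
  by apply: eq_in_filter => b; rewrite -SE => /h[].
rewrite /left_of !filter_cat /= lexx ltxx.
have -> : [seq b <- S1 | b.1 <= a.1] = S1.
  by apply/all_filterP/allP => b /S1a /ltW.
have -> : [seq b <- S1 | b.1 < a.1] = S1 by apply/all_filterP/allP.
have -> : [seq b <- S2 | b.1 <= a.1] = [::].
  rewrite -(filter_pred0 S2); apply: eq_in_filter => b /S2a.
  by rewrite ltNge => /negbTE.
have -> : [seq b <- S2 | b.1 < a.1] = [::].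
  rewrite -(filter_pred0 S2); apply: eq_in_filter => b /S2a /ltW.
  by rewrite leNgt => /negbTE.
by rewrite cats0 cats1.
Qed.

Lemma state_sorted j : sorted <%R (map fst (state ls j)).
Proof.
rewrite /state; case: ifP => // jN; apply: subseq_sorted (sortedL jN).
  exact: lt_trans.
exact/map_subseq/filter_subseq.
Qed.

Lemma state_action_jump j a : a \in state ls j ->
  \forall t \near 0^'+, state_action j (a.1 + t) =
    act (state_action j (a.1 - t)) (C j a.1, a.2).
Proof.
move=> aj; apply: filterS (near_jump (state_sorted j) aj) => t [h1 h2].
rewrite /state_action h1 h2 /strand_word map_rcons -cats1 acts_cat //.
Qed.

Lemma near_scale (P : R -> Prop) (k : R) : 0 < k ->
  (\forall t \near 0^'+, P t) -> \forall t \near 0^'+, P (t * k).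
Proof.
move=> k0 [e /= e0 eP]; exists (e / k); first exact: divr_gt0.
move=> t /=; rewrite !sub0r !normrN => tek t0.
apply: eP; rewrite /= ?sub0r ?normrN ?mulr_gt0//.
by rewrite normrM (gtr0_norm k0) -ltr_pdivlMr.
Qed.

Lemma near_level_row j : (j < n)%N -> \forall t \near 0^'+,
  level (j.*2.+1%:R + t) = j.+1 /\ level (j.*2.+1%:R - t) = j.
Proof.
move=> jN; apply: filterS2 (nbhs_right_gt 0) (nbhs_right_lt ltr01) => t t0 t1.
have natS k : k.+2%:R = k.+1%:R + 1 :> R by rewrite natr1.
split; apply: levelE => //.
- move=> i; rewrite ltnS => ij; apply: (@le_trans _ _ j.*2.+1%:R).
    by rewrite ler_nat; move: ij; clear; lia.
  by rewrite lerDl ltW.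
- move=> _; apply: (@lt_le_trans _ _ (j.*2.+1%:R + 1)); first by rewrite ltrD2l.
  by rewrite natr1 ler_nat; clear; lia.
- exact: ltnW.
- move=> i ij; rewrite lerBrDl; apply: (@le_trans _ _ (1 + i.*2.+1%:R)).
    by rewrite lerD2r ltW.
  by rewrite addrC natr1 ler_nat; move: ij; clear; lia.
- by move=> _; rewrite gtrBl.
Qed.

Lemma left_normal_plane x y :
  left_normal (plane_point x y) = plane_point (- y) x :> 'rV[R]_2.
Proof. by apply/rowP => i; rewrite !mxE. Qed.

Lemma plane_pointD x y x' y' (t : R) : plane_point x y + t *: plane_point x' y' =
  plane_point (x + t * x') (y + t * y').
Proof. by apply/rowP => i; rewrite !mxE; case: ifP. Qed.

Lemma plane_pointB x y x' y' (t : R) : plane_point x y - t *: plane_point x' y' =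
  plane_point (x - t * x') (y - t * y').
Proof. by apply/rowP => i; rewrite !mxE; case: ifP. Qed.

(** The lower half of a column is seen in the state below the row, and the upper
    half in the state above it. *)
Lemma column_state j a z : (j < n)%N -> a \in strands (lay j) ->
  open_segment (column_edge j (lay j) a) z ->
  proj z 0 0 = a.1 /\ exists2 k, level (proj z 0 1) = k &
    a \in state ls k /\ C k a.1 = C j a.1.
Proof.
move=> jN aS /openP[t /andP[t0 t1] zE].
have tI : 0 <= t <= 1 by rewrite !ltW.
have az : segment (column_edge j (lay j) a) z by rewrite zE; exact: segment_pt.
have [zx zy _] := (column_edgeP j (lay j) a z).1 az; split => //.
have lh : (lo j (lay j) a.1)%:R < proj z 0 1 < (hi j (lay j) a.1)%:R.
  have lohi : (lo j (lay j) a.1)%:R < (hi j (lay j) a.1)%:R :> R.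
    by rewrite ltr_nat ltn_lo_hi.
  rewrite zE /column_edge; case: (a.2) => /=.
    have [_ -> _] := grid_edge_pt a.1 (hi j (lay j) a.1) a.1 (lo j (lay j) a.1) t.
    by apply/andP; split; nra.
  have [_ -> _] := grid_edge_pt a.1 (lo j (lay j) a.1) a.1 (hi j (lay j) a.1) t.
  by apply/andP; split; nra.
move: lh => /andP[ly yh].
have [yr|yr] := ltP (proj z 0 1) j.*2.+1%:R.
  have ab : is_below (lay j) a.1.
    move: ly; rewrite /lo; case: ifP => // _; rewrite ltNge => /negP[]; exact: ltW.
  exists j; last by split=> //; rewrite /state jN mem_filter ab.
  apply: levelE => //; first exact: ltnW.
  move=> i ij; apply: le_trans (ltW ly); rewrite ler_nat /lo ab.
  by move: ij; clear; lia.
have aA : is_above (lay j) a.1.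
  move: yh; rewrite /hi; case: ifP => // _.
  by rewrite ltNge yr.
have aj : a \in above (lay j) by rewrite mem_filter aA.
exists j.+1.
  apply: levelE => //.
    move=> i; rewrite ltnS => ij; apply: le_trans yr; rewrite ler_nat.
    by move: ij; clear; lia.
  by move=> _; apply: lt_le_trans yh _; rewrite ler_nat /hi aA; clear; lia.
rewrite -above_state//; split => //; apply/esym/colC.2 => //.
by move: aj; rewrite above_state// => /state_below[].
Qed.

Lemma point_colour_column j a z : (j < n)%N -> a \in strands (lay j) ->
  open_segment (column_edge j (lay j) a) z ->
  let nv := left_normal (proj (direction (column_edge j (lay j) a))) in
  \forall t \near 0^'+, point_colour (proj z - t *: nv) ◁ C j a.1 =
    point_colour (proj z + t *: nv).
Proof.
move=> jN aS az nv; have [zx [k kE [ak Ck]]] := column_state jN aS az.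
pose h : R := (hi j (lay j) a.1)%:R - (lo j (lay j) a.1)%:R.
have h0 : 0 < h by rewrite subr_gt0 ltr_nat ltn_lo_hi.
have nvE : nv = plane_point (if a.2 then h else - h) 0.
  rewrite /nv proj_direction_grid !proj_grid_vertex.
  have -> : (if ~~ a.2 then 1 else -1) *: (plane_point a.1 (hi j (lay j) a.1)%:R -
      plane_point a.1 (lo j (lay j) a.1)%:R) = plane_point 0 (if a.2 then - h else h).
    by apply/rowP => i; rewrite !mxE /h; case: (i == 0); case: (a.2) => /=; ring.
  by rewrite left_normal_plane; case: (a.2); rewrite ?opprK.
apply: filterS (near_scale h0 (state_action_jump ak)) => t jump.
rewrite nvE [proj z]plane_pointE zx plane_pointD plane_pointB mulr0 addr0 subr0.
rewrite /point_colour !plane_pointX !plane_pointY kE -Ck.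
move: jump; rewrite /act; case: (a.2) => /= jump; first by rewrite jump.
by rewrite !mulrN opprK jump qopVK.
Qed.

Lemma acts_qop (y c : Z) w : acts (y ◁ c) w = acts y w ◁ acts c w.
Proof.
elim: w y c => //= l w IH y c; rewrite -IH; congr acts.
by have := act_act y (c, true) l; rewrite /act /=.
Qed.

(** The colour of the region below, resp. above, the row at its left end. *)
Definition below_or_above (d : bool) j : Z :=
  acts (layer_left j) (nseq (d == l_dp (lay j)) (left_letter (layer_event j))).

Lemma row_jump j : (j < n)%N ->
  below_or_above (l_r (lay j)) j ◁ C j (l_p (lay j)) =
  below_or_above (~~ l_r (lay j)) j.
Proof.
move=> jN; rewrite /below_or_above /left_letter /=.
by case: (l_r _); case: (l_dp _); rewrite /= /act /= ?qopVK.
Qed.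

Lemma row_colour_acts j x : (j < n)%N -> (forall a, l_m (lay j) = Some a -> x != a.1) ->
  row_colour ls C j x =
  acts (C j (l_p (lay j))) (strand_word j (left_of x (seq_of_opt (l_m (lay j))))).
Proof.
move=> jN; rewrite /row_colour; case am : (l_m _) => [a|] //= /(_ _ erefl) xa.
have := colC.1 _ jN; rewrite /right_end_colour am => ->.
have [xa'|ax|xa'] := ltgtP x a.1 => //=.
by rewrite xa' eqxx in xa.
Qed.

Lemma near_row_level j x : (j < n)%N -> \forall t \near 0^'+,
  forall d : bool, point_colour
    (plane_point x (j.*2.+1%:R + (if d then - t else t))) =
  state_action (if d then j else j.+1) x.
Proof.
move=> jN; apply: filterS (near_level_row jN) => t [h1 h2] d.
by rewrite /point_colour plane_pointX plane_pointY; case: d; rewrite ?h1 ?h2.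
Qed.

Lemma point_colour_row j z : (j < n)%N -> segment (row_edge j (lay j)) z ->
  l_p (lay j) < proj z 0 0 < l_q (lay j) ->
  (forall a, l_m (lay j) = Some a -> proj z 0 0 != a.1) ->
  let nv := left_normal (proj (direction (row_edge j (lay j)))) in
  \forall t \near 0^'+,
    point_colour (proj z - t *: nv) ◁ row_colour ls C j (proj z 0 0) =
    point_colour (proj z + t *: nv).
Proof.
move=> jN jz zpq zm nv.
have [_ zy _] := (row_edgeP j (sortedL jN) z).1 jz.
pose h := l_q (lay j) - l_p (lay j).
have h0 : 0 < h by have [_ pq _ _] := strands_order (sortedL jN); rewrite subr_gt0.
have nvE : nv = plane_point 0 (if l_r (lay j) then h else - h).
  rewrite /nv proj_direction_grid !proj_grid_vertex.
  have -> : (if l_r (lay j) then 1 else -1) *: (plane_point (l_q (lay j)) j.*2.+1%:R -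
      plane_point (l_p (lay j)) j.*2.+1%:R) = plane_point (if l_r (lay j) then h else - h) 0.
    by apply/rowP => i; rewrite !mxE /h; case: (i == 0); case: (l_r _) => /=; ring.
  by rewrite left_normal_plane oppr0.
have xI : l_p (lay j) < proj z 0 0 <= l_q (lay j).
  by have /andP[-> /ltW ->] := zpq.
set x := proj z 0 0 in zpq zm xI *.
have actE d : state_action (if d then j else j.+1) x =
    acts (below_or_above d j) (strand_word j (left_of x (seq_of_opt (l_m (lay j))))).
  by rewrite action_middle// acts_cat.
apply: filterS (near_scale h0 (near_row_level x jN)) => t lev.
have levT := lev true; have levF := lev false; rewrite /= in levT levF.
rewrite nvE [proj z]plane_pointE zy -/x plane_pointD plane_pointB mulr0 addr0 subr0.
have main : state_action (if l_r (lay j) then j else j.+1) x ◁ row_colour ls C j x =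
    state_action (if ~~ l_r (lay j) then j else j.+1) x.
  by rewrite !actE row_colour_acts// -acts_qop row_jump.
move: main; case: (l_r _) => /=.
  by rewrite levT levF.
by rewrite mulrN opprK levT levF.
Qed.

(** The initial region at the crossing is below the row if it runs to the right,
    and to the left of the column if the normal of the column points to the
    right. *)
Lemma point_colour_crossing j a : (j < n)%N -> l_m (lay j) = Some a ->
  let c := layer_crossing ls j a in
  let v := crossing_det c *: (proj (direction c.1) - proj (direction c.2)) in
  \forall t \near 0^'+,
    point_colour (plane_point a.1 j.*2.+1%:R + t *: v) =
    if a.2 then below_or_above (l_r (lay j)) j
    else act (below_or_above (l_r (lay j)) j) (C j a.1, a.2).
Proof.
move=> jN am c v; have sl := sortedL jN.
have [_ pq _ /(_ _ am) /andP[pa aq]] := strands_order sl.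
pose h := l_q (lay j) - l_p (lay j).
have h0 : 0 < h by rewrite subr_gt0.
have vE : v = plane_point (if a.2 then - (2 * h ^+ 2) else 2 * h ^+ 2)
    (if l_r (lay j) then - (4 * h) else 4 * h).
  rewrite /v /c (crossing_detE stackedL jN am).
  have [-> ->] := crossing_directions stackedL jN am; rewrite -/h.
  apply/rowP => i; rewrite !mxE.
  by case: (i == 0); case: (a.2); case: (l_r _) => /=; ring.
have h2 : 0 < 2 * h ^+ 2 by rewrite mulr_gt0// exprn_gt0.
have h4 : 0 < 4 * h by rewrite mulr_gt0.
have pa0 : 0 < a.1 - l_p (lay j) by rewrite subr_gt0.
have aq0 : 0 < l_q (lay j) - a.1 by rewrite subr_gt0.
have lev : \forall t \near 0^'+, level (j.*2.+1%:R + t * (if l_r (lay j) then - (4 * h) else 4 * h)) =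
    if l_r (lay j) then j else j.+1.
  apply: filterS (near_scale h4 (near_level_row jN)) => t [l1 l2].
  by case: (l_r _); rewrite ?mulrN.
have near_x : \forall t \near 0^'+, [/\ 0 < t, t < a.1 - l_p (lay j) & t < l_q (lay j) - a.1].
  by apply: filterS3 (nbhs_right_gt 0) (nbhs_right_lt pa0) (nbhs_right_lt aq0).
apply: filterS2 lev (near_scale h2 near_x) => t lt [t0 tp tq].
rewrite vE plane_pointD /point_colour plane_pointX plane_pointY lt.
set x := a.1 + _.
have xI : l_p (lay j) < x <= l_q (lay j).
  by rewrite /x; case: (a.2); rewrite ?mulrN; apply/andP; split; lra.
rewrite action_middle// acts_cat -/(below_or_above _ _) am /x /left_of /=.
case aE : (a.2).
  by rewrite mulrN ltNge gerBl (ltW t0).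
by rewrite ltrDl t0 /= /colour_letter aE.
Qed.

End RegionColour.

(** * The shadow class of a stack *)

Section PresentedHom.
Local Open Scope quotient_scope.
Variables (A : pointedType) (rel : qterm A -> qterm A -> Prop) (X : quandleType).
Variable g : A -> X.

Fixpoint qeval (t : qterm A) : X :=
  match t with
  | QGen a => g a
  | QOp s t => qeval s ◁ qeval t
  | QOpV s t => qeval s ◀ qeval t
  end.

Hypothesis g_rel : forall s t, rel s t -> qeval s = qeval t.

Lemma qeval_cong s t : qcong rel s t -> qeval s = qeval t.
Proof.
elim=> //=.
- by move=> {}s {}t u _ -> _ ->.
- by move=> {}s s' {}t t' _ -> _ ->.
- by move=> {}s s' {}t t' _ -> _ ->.
- by move=> ? ?; rewrite qopK.
- by move=> ? ?; rewrite qopVK.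
- by move=> ? ? ?; rewrite qopD.
- by move=> ?; rewrite qopxx.
- by move=> ?; rewrite qopVxx.
Qed.

Definition presented_map (x : presented rel) : X := qeval (repr x).

Lemma presented_mapE t : presented_map (\pi_(presented rel) t) = qeval t.
Proof. exact/qeval_cong/repr_qcong. Qed.

Lemma presented_map_hom a b : presented_map (a ◁ b) = presented_map a ◁ presented_map b.
Proof.
elim/quotW: a => s; elim/quotW: b => t; rewrite -[_ ◁ _]/(pop _ _) popE.
by rewrite !presented_mapE.
Qed.

Lemma presented_hom : exists f : quandleHom (presented rel) X,
  forall a, f (pgen rel a) = g a.
Proof.
have m := isQuandleHom.Build _ _ presented_map presented_map_hom.
by exists (HB.pack_for (quandleHom (presented rel) X) presented_map m) => a /=; rewrite /pgen presented_mapE.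
Qed.

End PresentedHom.

Section Hom.
Variables (X Y : quandleType) (f : quandleHom X Y).

Lemma qhomV a b : f (a ◀ b) = f a ◀ f b.
Proof. by apply: (@qop_inj _ (f b)); rewrite /= -qhomE !qopVK. Qed.

Lemma qhom_act y l : f (act y l) = act (f y) (f l.1, l.2).
Proof. by case: l => a []; rewrite /act /= ?qhomE ?qhomV. Qed.

Lemma qhom_acts y w : f (acts y w) = acts (f y) [seq (f l.1, l.2) | l <- w].
Proof. by elim: w y => //= l w IH y; rewrite IH qhom_act. Qed.

End Hom.

Lemma pmap_uniq_in (S T : eqType) (g : S -> option T) (s : seq S) :
  (forall i j x, i \in s -> j \in s -> g i = Some x -> g j = Some x -> i = j) ->
  uniq s -> uniq (pmap g s).
Proof.
elim: s => //= i s IH gi /andP[is_ us]; have {}IH : uniq (pmap g s).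
  by apply: IH => // j k x js ks; apply: gi; rewrite inE ?js ?ks orbT.
case giE : (g i) => [x|] //=; rewrite IH andbT mem_pmap; apply/mapP => -[j js gj].
move: is_; rewrite (gi i j x) ?js//; first exact: mem_head.
by rewrite inE js orbT.
Qed.

Lemma big_pmap (V : nmodType) (S T : Type) (g : S -> option T) (s : seq S) (F : T -> V) :
  \sum_(x <- pmap g s) F x = \sum_(i <- s) oapp F 0 (g i).
Proof.
elim: s => [|i s IH]; first by rewrite !big_nil.
by rewrite big_cons /=; case: (g i) => [x|] /=; rewrite ?big_cons ?add0r IH.
Qed.

Section Realise.
Variables (R : realType) (ls : seq (layer R)) (D : diagram R).
Hypothesis stackedL : stacked ls.
Hypothesis DE : perm_eq (link_edges D) (stack_edges ls).
Local Notation n := (size ls).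
Local Notation lay := (lay ls).
Implicit Types (z : 'rV[R]_3) (a b : R * bool) (i j : nat) (p : 'rV[R]_2).

Let sortedL j : (j < n)%N -> layer_sorted (lay j).
Proof. by case: stackedL => _ + _ _; exact. Qed.

Definition stack_crossings : seq (edge R * edge R) :=
  pmap (fun j => omap (layer_crossing ls j) (l_m (lay j))) (iota 0 n).

Lemma perm_stack_crossings : perm_eq (crossings D) stack_crossings.
Proof.
apply: uniq_perm; first exact: uniq_crossings.
  apply: pmap_uniq_in; last exact: iota_uniq.
  move=> i j x _ _; case: (l_m (lay i)) => //= a [<-]; case: (l_m (lay j)) => //= b.
  move=> [_ h]; have := congr1 (tip true) h; rewrite !tip_grid.
  by case: ifP => _; case: ifP => _ /grid_vertex_inj[_]; lia.
move=> c; rewrite mem_pmap; apply/idP/mapP => [cD|[j]].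
  have [j [a [jN am cE _]]] := crossing_height stackedL DE cD.
  by exists j; rewrite ?mem_iota// am cE.
rewrite mem_iota add0n /= => jN; case am : (l_m _) => [a|]//= -[->].
exact: middle_crossing.
Qed.

Lemma row_point_colour j z : (j < n)%N -> segment (row_edge j (lay j)) z ->
  (forall a, l_m (lay j) = Some a -> proj z 0 0 != a.1) ->
  canonical_colouring (arc_at D z) = row_colour ls (column_colour ls D) j (proj z 0 0).
Proof.
move=> jN jz zm; have sl := sortedL jN.
have colC := column_colouring stackedL DE.
have zA : (link_set D `\` under_points D) z.
  split; first by exists (row_edge j (lay j)) => //; exact: (row_in DE).
  by move=> /(row_under stackedL DE jN jz)[a /zm /eqP].
(* the point is joined along the row to an end on the same side of the middle
   column *)
have side x0 (a0 : R * bool) : a0 \in strands (lay j) -> x0 = grid_vertex a0.1 j.*2.+1 ->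
    segment (column_edge j (lay j) a0) x0 -> segment (row_edge j (lay j)) x0 ->
    (forall b, l_m (lay j) = Some b -> (proj z 0 0 < b.1) = (a0.1 < b.1) /\ a0.1 != b.1) ->
    canonical_colouring (arc_at D z) = column_colour ls D j a0.1.
  move=> aS x0E cx0 rx0 hb; rewrite -(column_colourE stackedL DE jN aS cx0).
  congr canonical_colouring; move: jz rx0 => /segmentP[s sI zE] /segmentP[t tI tE].
  rewrite zE tE; apply: arc_at_free => //; first exact: (row_in DE).
  move=> l lI; have wI := conv01 sI tI lI.
  move=> /(row_under stackedL DE jN (segment_pt _ wI))[b bm].
  have convX (f g : 'rV[R]_2) k : (f + k *: (g - f)) 0 0 = f 0 0 + k * (g 0 0 - f 0 0).
    by rewrite !mxE.
  rewrite proj_pt_conv convX -zE -tE x0E proj_grid_vertex plane_pointX => lb.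
  have [h1 h2] := hb b bm; have h3 := zm b bm.
  move: lI => /andP[l0 l1]; move: h1 h2 h3 lb; move: (proj z 0 0) a0.1 b.1 => x y w.
  move: l0; rewrite le_eqVlt !neq_lt; clear - l1 => /predU1P[<-|l0].
    by rewrite mul0r addr0 => _ _ /orP[] + xw; rewrite xw ltxx.
  move=> h /orP[yw|wy] /orP[xw|wx] xyw; move: h.
  - have : 0 < l * (w - y) by rewrite mulr_gt0 ?subr_gt0.
    by rewrite yw xw => ? _; nra.
  - by rewrite yw ltNge (ltW wx).
  - by rewrite xw ltNge (ltW wy).
  - have : 0 < l * (y - w) by rewrite mulr_gt0 ?subr_gt0.
    by move=> ? _; nra.
have [_ pq _ hm] := strands_order sl.
have rowE x : l_p (lay j) <= x <= l_q (lay j) ->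
    segment (row_edge j (lay j)) (grid_vertex x j.*2.+1).
  move=> xI; apply/(row_edgeP _ sl); rewrite proj_grid_vertex plane_pointX plane_pointY.
  by rewrite height_grid_vertex /= odd_double.
have segp := grid_vertex_p ls j; have segq := grid_vertex_q stackedL jN.
rewrite /row_colour; case am : (l_m _) => [a|]; last first.
  apply: side segp _ _ => //; first exact: p_strand.
    by apply: rowE; rewrite lexx ltW.
  by move=> b; rewrite am.
have /andP[pa aq] := hm _ am.
case: ltP => za.
  apply: side segp _ _ => //; first exact: p_strand.
    by apply: rowE; rewrite lexx ltW.
  by move=> b; rewrite am => -[<-]; rewrite za pa lt_eqF.
apply: side segq _ _ => //; first exact: q_strand.
  by apply: rowE; rewrite lexx ltW.
by move=> b; rewrite am => -[<-] /=; rewrite ltNge za ltNge (ltW aq) gt_eqF.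
Qed.

Section RegionColouring.
Variable al : knot_quandle D.
Local Notation pc := (point_colour ls (column_colour ls D) al).
Let colC := column_colouring stackedL DE.

Definition region_colour (r : region D) : knot_quandle D :=
  xget al [set c | exists2 p, component_set r p & c = pc p].

Lemma region_colourE r p : component_set r p -> region_colour r = pc p.
Proof.
move=> rp; have [q rq ->] : [set c | exists2 p, component_set r p & c = pc p]
    (region_colour r).
  by apply: (@xgetPex _ al [set c | exists2 p, component_set r p & c = pc p]);
    exists (pc p), p.
apply: (region_colour_uniq _ rq rp) => w wB.
exact: (point_colour_locally_constant stackedL DE al colC).
Qed.

Lemma base_point : (~` (@proj R @` link_set D)) (plane_point 0 (-1)).
Proof.
move=> [z [e eE ez] zE].
have zy : proj z 0 1 = -1 by rewrite zE plane_pointY.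
move: eE; rewrite /= (DP DE) => /stack_edgesP[j jN [eR|[a aS eC]]].
  rewrite eR in ez; have [_ + _] := (row_edgeP j (sortedL jN) z).1 ez.
  by rewrite zy; have := ler0n R j.*2.+1; lra.
rewrite eC in ez; have [_ + _] := (column_edgeP j (lay j) a z).1 ez.
by rewrite zy; have := ler0n R (lo j (lay j) a.1); lra.
Qed.

Lemma base_colour : pc (plane_point 0 (-1)) = al.
Proof.
rewrite /point_colour plane_pointY (@levelE _ ls 0)//; last first.
  by move=> _; have := ler0n R 0.*2.+1; lra.
by rewrite /state_action; case: stackedL => _ _ -> _.
Qed.

Lemma region_colouring (r0 : region D) : component_set r0 (plane_point 0 (-1)) ->
  is_region_colouring r0 al region_colour.
Proof.
move=> r0P; split; first by rewrite (region_colourE r0P) base_colour.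
move=> e x eE ex only; set nv := left_normal _.
have near_pm := region_near_edge r0 eE ex only.
have np : \forall t \near 0^'+,
    component_set (region_near r0 (fun t => proj x + t *: nv)) (proj x + t *: nv).
  by have := near_pm 1 (oner_neq0 _); rewrite /= scale1r.
have nm : \forall t \near 0^'+,
    component_set (region_near r0 (fun t => proj x - t *: nv)) (proj x - t *: nv).
  have := near_pm (-1); rewrite oppr_eq0 oner_eq0 /= => /(_ isT).
  have -> : (fun t => proj x + t *: (-1 *: nv)) = (fun t => proj x - t *: nv).
    by apply/funext => t; rewrite scaleN1r scalerN.
  by apply: filterS => t; rewrite scaleN1r scalerN.
suff col : \forall t \near 0^'+,
    pc (proj x - t *: nv) ◁ canonical_colouring (arc_at D x) = pc (proj x + t *: nv).
  have [t [[tp tm] tc]] : exists t, (component_set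
      (region_near r0 (fun t => proj x + t *: nv)) (proj x + t *: nv) /\
      component_set (region_near r0 (fun t => proj x - t *: nv)) (proj x - t *: nv)) /\
      pc (proj x - t *: nv) ◁ canonical_colouring (arc_at D x) = pc (proj x + t *: nv).
    by apply: (@filter_ex _ (0 : R)^'+); apply: filterI => //; exact: filterI.
  by rewrite /= (region_colourE tp) (region_colourE tm).
move: (eE); rewrite (DP DE) => /stack_edgesP[j jN [eR|[a aS eC]]]; last first.
  clear np nm near_pm; rewrite {}/nv eC in ex *.
  have segx : segment (column_edge j (lay j) a) x.
    by move: ex => /openP[t /andP[t0 t1] ->]; apply: segment_pt; rewrite !ltW.
  rewrite (column_colourE stackedL DE jN aS segx).
  exact: (point_colour_column stackedL al colC).
clear np nm near_pm; rewrite {}/nv {}eR in eE ex *.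
have sl := sortedL jN; have [_ pq _ _] := strands_order sl.
have xpq : l_p (lay j) < proj x 0 0 < l_q (lay j).
  move: ex => /openP[t /andP[t0 t1] ->]; rewrite /row_edge; case: (l_r _) => /=.
    have [-> _ _] := grid_edge_pt (l_p (lay j)) j.*2.+1 (l_q (lay j)) j.*2.+1 t.
    by apply/andP; split; nra.
  have [-> _ _] := grid_edge_pt (l_q (lay j)) j.*2.+1 (l_p (lay j)) j.*2.+1 t.
  by apply/andP; split; nra.
have segx : segment (row_edge j (lay j)) x.
  by move: ex => /openP[t /andP[t0 t1] ->]; apply: segment_pt; rewrite !ltW.
have xm a : l_m (lay j) = Some a -> proj x 0 0 != a.1.
  move=> am; apply/eqP => xa; have xE := row_under_eq stackedL DE jN am segx xa.
  have cD := middle_crossing stackedL DE jN am.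
  have /eqP[] := over_under_neq cD; rewrite -xE; apply: only; first exact: over_link.
  by have [_ _ -> _] := crosses_atP cD; rewrite -xE.
rewrite (row_point_colour jN segx xm).
exact: (point_colour_row stackedL al colC jN segx xpq xm).
Qed.

End RegionColouring.

Variables (X : quandleType) (CX : nat -> R -> X).
Hypothesis colX : stack_colouring ls CX.

Lemma stack_hom : exists f : quandleHom (knot_quandle D) X,
  (forall c : arc D, f (canonical_colouring c) = arc_colour ls CX c).
Proof.
apply: presented_hom => s t [c cD [-> ->]] /=.
exact: (arc_colour_crossing stackedL DE colX cD).
Qed.

Variables (j0 : nat) (a0 : R * bool).
Hypothesis j0N : (j0 < n)%N.
Hypothesis a0S : a0 \in strands (lay j0).
Let al := CX j0 a0.1.

(** The knot quandle of the link colours the link itself, so the regions can be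
    coloured from any base colour; to obtain the chain with the base colour [al],
    this colour has to be lifted along [f], which is possible as it is the
    colour of a column. *)
Theorem stack_realises : exists (f : quandleHom (knot_quandle D) X)
    (Lsh : chain_class_group (knot_quandle D) 3),
  shadow_fundamental_class Lsh /\
  class_push f Lsh = chain_class (rho
    (\sum_(j <- iota 0 n) event_chain (layer_left ls CX al j) (layer_event ls CX j))).
Proof.
have [f fE] := stack_hom.
have colC := column_colouring stackedL DE.
have fC j a : (j < n)%N -> a \in strands (lay j) ->
    f (column_colour ls D j a.1) = CX j a.1.
  move=> jN aS; rewrite /column_colour fE.
  by apply: (arc_colour_column stackedL DE colX jN aS); exact: grid_vertex_lo.
pose alD := column_colour ls D j0 a0.1.
have falD : f alD = al by exact: fC.
have [r0 r0P] := component_of base_point.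
exists f, (chain_class (rho (shadow_chain r0 (region_colour alD)))); split.
  exists r0, alD, (region_colour alD); split => //; exact: region_colouring.
rewrite class_push_class quandle_push_rho; congr (chain_class (rho _)).
rewrite /shadow_chain raddf_sum (perm_big _ perm_stack_crossings) big_pmap.
rewrite !big_seq; apply: eq_bigr => j; rewrite mem_iota add0n => /= jN.
case am : (l_m (lay j)) => [a|] /=; last first.
  by rewrite /event_chain /crossing_tuple /layer_event am.
have cD := middle_crossing stackedL DE jN am; rewrite -/(layer_crossing ls j a) in cD.
rewrite rack_pushZ rack_pushU.
have [_ _ px _] := crosses_atP cD.
have pu : proj (under_point (layer_crossing ls j a)) = plane_point a.1 j.*2.+1%:R.
  have [i [b [iN bm [e1 e2] ->]]] := crossing_height stackedL DE cD.
  have ij : i = j.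
    have := congr1 (tip true) e2; rewrite !tip_grid.
    by case: ifP => _; case: ifP => _ /grid_vertex_inj[_]; lia.
  by rewrite ij in bm *; move: bm; rewrite am => -[->].
pose boa (Z : quandleType) (C : nat -> R -> Z) (y : Z) :=
  below_or_above ls C y (l_r (lay j)) j.
have reg : region_colour alD (region_ini (layer_crossing ls j a) r0) =
    if a.2 then boa _ (column_colour ls D) alD
    else act (boa _ (column_colour ls D) alD) (column_colour ls D j a.1, a.2).
  have h1 := region_iniP r0 cD.
  have h2 := point_colour_crossing stackedL alD colC jN am.
  rewrite /= pu in h1 h2.
  have [t [t1 t2]] := @filter_ex _ (0 : R)^'+ _ _ (filterI h1 h2).
  by rewrite (region_colourE alD t1) t2.
have fleft : f (layer_left ls (column_colour ls D) alD j) = layer_left ls CX al j.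
  rewrite /layer_left qhom_acts falD /strand_word -map_comp; congr acts.
  apply/eq_in_map => b bU; rewrite /colour_letter /= fC//.
  by rewrite /strands mem_cat bU.
have fp : f (column_colour ls D j (l_p (lay j))) = CX j (l_p (lay j)).
  exact: (fC _ _ jN (p_strand (lay j))).
have fq : f (column_colour ls D j (l_q (lay j))) = CX j (l_q (lay j)).
  exact: (fC _ _ jN (q_strand (lay j))).
have fa : f (column_colour ls D j a.1) = CX j a.1 by apply: fC => //; exact: m_strand.
have fboa : f (boa _ (column_colour ls D) alD) = boa _ CX al.
  rewrite /boa /below_or_above qhom_acts fleft; congr acts.
  by rewrite map_nseq /left_letter /= fp.
have fini : f (canonical_colouring (under_ini D (layer_crossing ls j a))) =
    if a.2 then CX j (l_p (lay j)) else CX j (l_q (lay j)).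
  rewrite -fp -fq -(column_colourE stackedL DE jN (p_strand _) (grid_vertex_p ls j)).
  rewrite -(column_colourE stackedL DE jN (q_strand _) (grid_vertex_q stackedL jN)).
  by have := row_arcs stackedL DE jN am; case: (a.2) => -[-> _].
have fover : f (canonical_colouring (over_arc D (layer_crossing ls j a))) = CX j a.1.
  by rewrite (over_colour stackedL DE jN am).
rewrite crossing_signE// /event_chain /crossing_tuple /layer_event /= am /=.
have tupE : map_tuple f [tuple region_colour alD (region_ini (layer_crossing ls j a) r0);
     canonical_colouring (under_ini D (layer_crossing ls j a));
     canonical_colouring (over_arc D (layer_crossing ls j a))] =
   [tuple if a.2 then boa _ CX al else boa _ CX al ◀ CX j a.1;
      if a.2 then CX j (l_p (lay j)) else CX j (l_p (lay j)) ◀ CX j a.1; CX j a.1].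
  have qE := colX.1 _ jN; rewrite /right_end_colour am in qE.
  apply/val_inj; rewrite /= reg fini fover; move: qE; rewrite /act.
  case: (a.2) => /= qE; first by rewrite fboa.
  by rewrite qhomV fboa fa qE.
rewrite tupE /boa /below_or_above /left_letter /=.
clear; case: (a.2) (l_r (lay j)) => [] []; case: (l_dp _) => /=;
  by rewrite ?scale1r ?scaleN1r /act /= ?qopVK.
Qed.

End Realise.

(** * From movies to stacks *)

(** Between two columns there is room for a further one. *)
Lemma sorted_insert (R : realType) (s t : seq R) :
  sorted <%R (s ++ t) -> exists x, sorted <%R (s ++ x :: t).
Proof.
rewrite (sorted_pairwise lt_trans) pairwise_cat => /and3P[/allrelP st ps pt].
suff [x [sx xt]] : exists x, (forall a, a \in s -> a < x) /\ (forall b, b \in t -> x < b).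
  exists x; rewrite (sorted_pairwise lt_trans) pairwise_cat /= ps pt andbT /=.
  apply/andP; split; last by apply/allP.
  apply/allrelP => a b aS; rewrite inE => /predU1P[->|bt]; first exact: sx.
  exact: st.
case/lastP: s st ps => [|s a] st ps.
  case: t pt {st} => [|b t] /=; first by exists 0.
  move=> /andP[/allP bt _]; exists (b - 1); split => // c.
  by rewrite inE => /predU1P[->|/bt]; lra.
have sa c : c \in rcons s a -> c <= a.
  rewrite mem_rcons inE => /predU1P[->//|cs].
  move: ps; rewrite -cats1 pairwise_cat => /andP[/allrelP h _].
  by apply/ltW/h => //; rewrite mem_head.
case: t pt st => [|b t] pt st.
  by exists (a + 1); split => // c /sa; lra.
have ab : a < b by apply: st; rewrite ?mem_head// mem_rcons mem_head.
exists ((a + b) / 2); split => c.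
  by move=> /sa; lra.
move: pt; rewrite /= => /andP[/allP bt _].
by rewrite inE => /predU1P[->|/bt]; lra.
Qed.

Section MovieToStack.
Variables (R : realType) (X : quandleType) (al : X).
Implicit Types (C : R -> X) (S : seq (R * bool)) (l : layer R)
  (cls : seq (layer R * (R -> X))).

Definition coloured_word C S : seq (letter X) := [seq (C a.1, a.2) | a <- S].

Definition coloured_event C l : event X :=
  Event (l_r l) (l_dp l) (l_dq l) (C (l_p l)) (omap (fun a => (C a.1, a.2)) (l_m l)).

(** Each layer has a colouring of its own, so that columns of different layers may
    use the same abscissa with different colours. *)
Fixpoint coherent cls S C : Prop :=
  if cls is (l, C') :: cls' then
    [/\ layer_sorted l, below l = S, {in S, forall a, C' a.1 = C a.1},
        C' (l_q l) = right_colour (coloured_event C' l) & coherent cls' (above l) C']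
  else S = [::].

Definition layers_chain cls : rack_chain X 3 :=
  \sum_(x <- cls) event_chain (acts al (coloured_word x.2 (l_U x.1)))
    (coloured_event x.2 x.1).

Lemma split_word C S u v w : coloured_word C S = u ++ v ++ w ->
  exists SU SV SW, [/\ S = SU ++ SV ++ SW, coloured_word C SU = u,
    coloured_word C SV = v & coloured_word C SW = w].
Proof.
move=> h; exists (take (size u) S), (take (size v) (drop (size u) S)),
  (drop (size v) (drop (size u) S)).
rewrite !cat_take_drop /coloured_word !map_take !map_drop -/(coloured_word C S) h.
by rewrite take_size_cat// drop_size_cat// take_size_cat// drop_size_cat.
Qed.

(** Each event becomes a layer. A column that is born at the row is placed at an
    unoccupied abscissa, and the colouring is changed there. *)
Lemma movie_layers w w' d : movie al w w' d -> w' = [::] ->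
  forall S C, sorted <%R (map fst S) -> coloured_word C S = w ->
  exists cls, coherent cls S C /\ layers_chain cls = d.
Proof.
elim=> [{}w -> S C _ Sw|u [r dl dr a m] v {}w' {}d _ IH w0 S C sS Sw].
  exists [::]; split; last by rewrite /layers_chain big_nil.
  by case: S Sw.
pose e := Event r dl dr a m; rewrite -/e in Sw IH *.
have [SU [SM [SV [SE SUu SMe SVv]]]] := split_word Sw.
have {}SMe : coloured_word C SM =
  nseq dl (left_letter e) ++ seq_of_opt m ++ nseq dr (right_letter e) := SMe.
(* the abscissas of the columns of the event: those of dying columns are given *)
have [p [mS [q [full [SME mSm]]]]] : exists p (mS : option (R * bool)) q,
    [/\ sorted <%R (map fst (SU ++ (p, true) :: seq_of_opt mS ++ (q, true) :: SV)),
      SM = nseq dl (p, (left_letter e).2) ++ seq_of_opt mS ++ nseq dr (q, (right_letter e).2)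
    & [/\ omap (fun b => (C b.1, b.2)) mS = m, dl -> C p = a & dr -> C q = right_colour e]].
  have [p [SM' [SME1 sp SM'e pa]]] : exists p SM',
      [/\ SM = nseq dl (p, (left_letter e).2) ++ SM',
        sorted <%R (map fst SU ++ p :: map fst (SM' ++ SV)),
        coloured_word C SM' = seq_of_opt m ++ nseq dr (right_letter e) & dl -> C p = a].
    move: SMe sS; rewrite SE; case: (dl) => /=.
      case: SM {SE} => [//|[p s] SM'] /= [pa sp SM'e] sS; exists p, SM'; split => //.
      - by rewrite /left_letter /= sp.
      - by move: sS; rewrite !map_cat /= map_cat.
    move=> SMe; rewrite map_cat => /sorted_insert[p sp]; exists p, SM; split => //.
  have [mS [SM'' [SME2 mSm SM''e]]] : exists (mS : option (R * bool)) SM'',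
      [/\ SM' = seq_of_opt mS ++ SM'', omap (fun b => (C b.1, b.2)) mS = m
        & coloured_word C SM'' = nseq dr (right_letter e)].
    move: SM'e; case: (m) => [[b s]|] /=; last by exists None, SM'.
    case: SM' {SME1 sp} => [//|b' SM''] /= [b1 b2 SM''e]; exists (Some b'), SM''; split => //.
    by rewrite /= b1 b2.
  have [q [SME3 sq qa]] : exists q, [/\ SM'' = nseq dr (q, (right_letter e).2),
      sorted <%R (map fst (SU ++ (p, true) :: seq_of_opt mS ++ (q, true) :: SV))
      & dr -> C q = right_colour e].
    move: sp SM''e; rewrite SME2; case: (dr) => /=.
      case: SM'' {SME2} => [//|[q s] [|//]] /= sp [qa qs]; exists q; split => //.
        by rewrite qs.
      by move: sp; rewrite !map_cat /= !map_cat -!catA.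
    case: SM'' {SME2} => //=; rewrite cats0 map_cat => sp _.
    move: sp; rewrite -cat_cons catA => /sorted_insert[q sq]; exists q; split => //.
    by move: sq; rewrite !map_cat /= map_cat -cat_cons catA.
  exists p, mS, q; split => //.
  by rewrite SME1 SME2 SME3.
have {mSm} [mSm pa qa] := mSm.
pose l := Layer SU SV p q r dl dr mS.
have sl : layer_sorted l.
  by move: full; rewrite /layer_sorted /strands !map_cat /= !map_cat.
have [hU pq hV hm] := strands_order sl; rewrite /= in hU pq hV hm.
pose C' x := if x == p then a else if x == q then right_colour e else C x.
have Cp : C' p = a by rewrite /C' eqxx.
have Cq : C' q = right_colour e by rewrite /C' (gt_eqF pq) eqxx.
have Cother x : x != p -> x != q -> C' x = C x.
  by move=> /negbTE xp /negbTE xq; rewrite /C' xp xq.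
have CU : coloured_word C' SU = u.
  rewrite -SUu; apply/eq_in_map => b /hU bp; congr (_, _); apply: Cother.
    by rewrite lt_eqF.
  by rewrite lt_eqF// (lt_trans bp).
have CV : coloured_word C' SV = v.
  rewrite -SVv; apply/eq_in_map => b /hV qb; congr (_, _); apply: Cother.
    by rewrite gt_eqF// (lt_trans pq).
  by rewrite gt_eqF.
have Cm : omap (fun b => (C' b.1, b.2)) mS = m.
  rewrite -mSm; case: (mS) hm => //= b /(_ _ erefl)/andP[pb bq].
  by rewrite Cother// ?(gt_eqF pb) ?(lt_eqF bq).
have evE : coloured_event C' l = e by rewrite /coloured_event /= Cp Cm.
have wordE d' : coloured_word C' (kept_strands d' l) =
    u ++ (if d' then below_word e else above_word e) ++ v.
  rewrite kept_strandsE//= /coloured_word !map_cat !map_nseq /= Cp Cq.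
  rewrite -/(coloured_word C' SU) -/(coloured_word C' SV) CU CV.
  have -> : [seq (C' b.1, b.2) | b <- seq_of_opt mS] = seq_of_opt m.
    by rewrite -Cm; case: (mS).
  rewrite -[(right_colour e, _)]/(right_letter e) -[(a, l_sp l)]/(left_letter e).
  by congr (_ ++ _); case: d'; rewrite /below_word /above_word /= -!catA;
    case: (dl); case: (dr).
have [] := IH w0 (above l) C' _ _.
- by apply: subseq_sorted sl; [exact: lt_trans|exact/map_subseq/filter_subseq].
- exact: (wordE false).
move=> cls [coh tot]; exists ((l, C') :: cls); split; last first.
  by rewrite /layers_chain big_cons /= evE CU -/(layers_chain cls) tot.
have belowE : below l = S.
  rewrite SE SME -[below l]/(kept_strands true l) kept_strandsE//= -!catA.
  have tb b : (true == b) = b by case: b.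
  by rewrite !tb.
split => //; last by rewrite evE.
move=> b; rewrite -belowE mem_filter => /andP[bb bS].
have [bp|bp] := eqVneq b.1 p.
  move: bb; rewrite bp /is_below /= eqxx => /pa ->; exact: Cp.
have [bq|bq] := eqVneq b.1 q.
  move: bb; rewrite bq /is_below /= (gt_eqF pq) eqxx => /qa ->; exact: Cq.
exact: Cother.
Qed.

Lemma nth_coherent cls S C j : coherent cls S C -> (j < size cls)%N ->
  let x i := nth (Layer [::] [::] 0 0 true true true None, C) cls i in
  let ls := map fst cls in
  [/\ layer_sorted (x j).1, state ls 0 = S, above (x j).1 = state ls j.+1,
     (x j).2 (l_q (x j).1) = right_colour (coloured_event (x j).2 (x j).1)
   & (j.+1 < size cls)%N ->
     {in above (x j).1, forall a, (x j).2 a.1 = (x j.+1).2 a.1}].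
Proof.
elim: cls S C j => // -[l C'] cls IH S C [|j] /= [sl bS CC Cq coh] jN.
  split=> //.
    case: cls coh {IH jN} => [->//|[l' C''] cls /=].
    by case=> _ <-.
  rewrite ltnS => cls0 a aA; case: cls coh cls0 {IH jN} => //= -[l' C''] cls.
  by move=> [_ _ h _ _] _; exact/esym/h.
have [h1 h2 h3 h4 h5] := IH _ _ j coh jN.
have xE i : (i < size cls)%N ->
  nth (Layer [::] [::] 0 0 true true true None, C) cls i =
  nth (Layer [::] [::] 0 0 true true true None, C') cls i.
  by move=> iN; exact: set_nth_default.
rewrite xE//; split => // j1N a aA; rewrite xE//; exact: h5.
Qed.

Theorem movie_realises (d : rack_chain X 3) : movie al [::] [::] d ->
  exists (L : diagram R) (f : quandleHom (knot_quandle L) X)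
    (Lsh : chain_class_group (knot_quandle L) 3),
    shadow_fundamental_class Lsh /\ class_push f Lsh = chain_class (rho d).
Proof.
move=> Md.
(* an extra circle of the colour al ensures that al is the colour of an arc *)
pose l0 : layer R := Layer [::] [::] 0 1 true false false None.
pose C0 : R -> X := fun=> al.
have sl0 : layer_sorted l0 by rewrite /layer_sorted /= ltr01.
have aboveE : above l0 = [:: (0, true); (1, false)].
  by rewrite -[above l0]/(kept_strands false l0) kept_strandsE.
have belowE : below l0 = [::].
  by rewrite -[below l0]/(kept_strands true l0) kept_strandsE.
have Mc : movie al (coloured_word C0 (above l0)) [::] d.
  rewrite aboveE -[d]add0r; apply: movie_trans Md.
  exact: (movie_cancelw al [::] [::] [:: (al, true)]).
have [|//|cls [coh tot]] := movie_layers Mc erefl (S := above l0) (C := C0).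
  by rewrite aboveE /= ltr01.
pose cls' := (l0, C0) :: cls; pose ls := map fst cls'.
have coh' : coherent cls' [::] C0 by split => //; rewrite belowE.
pose x i := nth (Layer [::] [::] 0 0 true true true None, C0) cls' i.
pose CX i : R -> X := (x i).2.
have layE i : (i < size cls')%N -> lay ls i = (x i).1.
  by move=> iN; rewrite /lay (nth_map (Layer [::] [::] 0 0 true true true None, C0)).
have szE : size ls = size cls' by rewrite size_map.
have stackedL : stacked ls.
  split => //.
  - move=> j; rewrite szE => jN; rewrite layE//.
    by have [] := nth_coherent coh' jN.
  - move=> j; rewrite szE => jN; rewrite layE//.
    by have [] := nth_coherent coh' jN.
have colX : stack_colouring ls CX.
  split=> [j jN|j a j1N].
    rewrite szE in jN; rewrite /right_end_colour !layE// /CX.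
    have [_ _ _ -> _] := nth_coherent coh' jN.
    by rewrite /right_colour /=; case: (l_m _).
  rewrite szE in j1N; rewrite layE; last exact: ltnW.
  by have [_ _ _ _ h] := nth_coherent coh' (ltnW j1N); exact: h.
have [L LE] := stack_diagram stackedL.
have a0S : (0, true) \in strands (lay ls 0) by rewrite /lay /= mem_head.
have [f [Lsh [Lshc push]]] := stack_realises stackedL LE colX (j0 := 0) (a0 := (0, true)) isT a0S.
exists L, f, Lsh; split => //; rewrite push; congr (chain_class (rho _)).
rewrite szE -tot /layers_chain.
rewrite [RHS](_ : _ = \sum_(x <- cls') event_chain (acts al (coloured_word x.2 (l_U x.1)))
    (coloured_event x.2 x.1)); last first.
  by rewrite /cls' big_cons /= /event_chain /= add0r.
rewrite [RHS](big_nth (Layer [::] [::] 0 0 true true true None, C0)).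
rewrite /index_iota subn0 !big_seq; apply: eq_bigr => j; rewrite mem_iota add0n => /= jN.
by rewrite /layer_left /layer_event layE.
Qed.

End MovieToStack.

(** * The stabiliser of a generator *)

Section WordEquivalence.
Variable Q : quandleType.
Implicit Types (al : Q) (u v w : seq (letter Q)).

(** Only the chain of a movie depends on the base colour. *)
Lemma movie_base al (be : Q) w w' d : movie al w w' d -> exists d', movie be w w' d'.
Proof.
elim=> [{}w|u e v {}w' {}d _ [d' IH]]; first by exists 0; exact: movie_nil.
by exists (event_chain (acts be u) e + d'); exact: movie_step.
Qed.

(** The base colour is immaterial by [movie_base]: this is equality in the group
    of the letters modulo the relations by which a letter passes under another. *)
Definition weq al u v : Prop := exists d, movie al u v d.

Lemma weq_refl al u : weq al u u.
Proof. by exists 0; exact: movie_nil. Qed.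

Lemma weq_sym al u v : weq al u v -> weq al v u.
Proof. by move=> [d /movie_rev uv]; exists (- d). Qed.

Lemma weq_trans al u v w : weq al u v -> weq al v w -> weq al u w.
Proof. by move=> [d uv] [d' vw]; exists (d + d'); exact: movie_trans vw. Qed.

Lemma weq_ctx al u v w w' : weq al w w' -> weq al (u ++ w ++ v) (u ++ w' ++ v).
Proof.
move=> [d ww]; have [d' ww'] := movie_base (acts al u) ww.
by exists d'; exact: movie_ctx.
Qed.

Lemma weq_catl al u w w' : weq al w w' -> weq al (u ++ w) (u ++ w').
Proof. by move=> /(weq_ctx u [::]); rewrite !cats0. Qed.

Lemma weq_catr al v w w' : weq al w w' -> weq al (w ++ v) (w' ++ v).
Proof. exact: (@weq_ctx al [::]). Qed.

Lemma weq_acts al u v y : weq al u v -> acts y u = acts y v.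
Proof. by move=> [d /movie_acts]; exact. Qed.

Lemma weq_cancel al w : weq al (w ++ winv w) [::].
Proof. by exists 0; have := movie_cancelw al [::] [::] w; rewrite cats0. Qed.

Lemma weq_cancelV al w : weq al (winv w ++ w) [::].
Proof. by rewrite -{2}[w]winvK; exact: weq_cancel. Qed.

Lemma weq_swap al a b (s t : bool) :
  weq al [:: (a, s); (b, t)] [:: (b, t); (act a (b, t), s)].
Proof.
have := movie1 al [::] (Event (~~ s) true false a (Some (b, t))) [::].
rewrite /below_word /above_word /left_letter /right_letter /right_colour /=.
by rewrite negbK; move=> h; exists (event_chain al (Event (~~ s) true false a (Some (b, t))));
  case: s h.
Qed.

Definition coset al l u v : Prop := exists2 p, peripheral al l p & weq al u (p ++ v).

Lemma coset_refl al l u : coset al l u u.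
Proof. by exists [::]; [exact: peripheral_nil|exact: weq_refl]. Qed.

Lemma coset_weq al l u v : weq al u v -> coset al l u v.
Proof. by exists [::] => //; exact: peripheral_nil. Qed.

Lemma coset_sym al l u v : coset al l u v -> coset al l v u.
Proof.
move=> [p pp uv]; exists (winv p); first exact: peripheral_winv.
apply: weq_sym; apply: weq_trans (weq_catl _ uv) _; rewrite catA.
exact: (weq_catr v (weq_cancelV al p)).
Qed.

Lemma coset_trans al l u v w : coset al l u v -> coset al l v w -> coset al l u w.
Proof.
move=> [p pp uv] [q pq vw]; exists (p ++ q); first exact: peripheral_cat.
by rewrite -catA; apply: weq_trans uv (weq_catl _ vw).
Qed.

Lemma coset_catr al l u v w : coset al l u v -> coset al l (u ++ w) (v ++ w).
Proof. by move=> [p pp uv]; exists p => //; rewrite catA; exact: weq_catr. Qed.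

(** The last letter is dragged to the front, where it has the colour [al]. *)
Lemma coset_self al l u s : coset al l (u ++ [:: (acts al u, s)]) u.
Proof.
have [d _ dM] := movie_drag al u [::] s; rewrite cats0 in dM.
exists [:: (al, s)]; first exact/peripheral_base/peripheral_nil.
by exists d.
Qed.

End WordEquivalence.

Section Stabiliser.
Local Open Scope quotient_scope.
Variables (A : pointedType) (rel : qterm A -> qterm A -> Prop).
Local Notation X := (presented rel).
Local Notation "\cl t" := (\pi_(presented rel) t) (at level 10, t at level 8).
Variables (al : X) (l : seq (letter X)) (g : A -> seq (letter X)).
Hypothesis gP : forall a, acts al (g a) = pgen rel a.

Fixpoint term_word (t : qterm A) : seq (letter X) :=
  match t with
  | QGen a => g a
  | QOp s t => term_word s ++ [:: (\cl t, true)]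
  | QOpV s t => term_word s ++ [:: (\cl t, false)]
  end.

Hypothesis g_rel : forall s t, rel s t -> coset al l (term_word s) (term_word t).

Lemma acts_term_word t : acts al (term_word t) = \cl t.
Proof.
elim: t => [a|s IHs t _|s IHs t _] /=; first exact: gP.
- by rewrite acts_cat IHs /= /act /= -[LHS]/(pop _ _) popE.
- by rewrite acts_cat IHs /= /act /= -[LHS]/(popV _ _) popVE.
Qed.

(** The second operand of a term enters its word only through the element that it
    represents; so the congruence rules concern first operands only, and the only
    axiom that is not an equality of words is idempotency. *)
Lemma term_word_cong s t : qcong rel s t -> coset al l (term_word s) (term_word t).
Proof.
elim=> {s t} /=.
- exact: g_rel.
- by move=> t; exact: coset_refl.
- by move=> s t _; exact: coset_sym.
- by move=> s t u _ st _; exact: coset_trans.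
- by move=> s s' t t' _ ss /pi_qcong -> _; exact: coset_catr.
- by move=> s s' t t' _ ss /pi_qcong -> _; exact: coset_catr.
- move=> s t; apply: coset_weq; rewrite -catA -[X in weq _ _ X]cats0.
  exact/weq_catl/(weq_cancel al [:: (\cl t, true)]).
- move=> s t; apply: coset_weq; rewrite -catA -[X in weq _ _ X]cats0.
  exact/weq_catl/(weq_cancel al [:: (\cl t, false)]).
- move=> s t u; apply: coset_weq; rewrite -!catA; apply: weq_catl.
  have := weq_swap al (\cl t) (\cl u) true true.
  by rewrite /act /= -[_ ◁ _]/(pop _ _) popE.
- by move=> t; rewrite -[\cl t]acts_term_word; exact: coset_self.
- by move=> t; rewrite -[\cl t]acts_term_word; exact: coset_self.
Qed.

Variable a0 : A.
Hypothesis al0 : al = pgen rel a0.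
Hypothesis g0 : coset al l (g a0) [::].

Lemma word_term w : exists2 t, \cl t = acts al w & coset al l w (term_word t).
Proof.
elim/last_ind: w => [|w [b s] [t tw wt]].
  by exists (QGen a0); [rewrite al0|exact: coset_sym].
rewrite -cats1 acts_cat /= -tw; exists (if s then QOp t (repr b) else QOpV t (repr b)).
  by case: s; rewrite /act /= -?popE -?popVE reprK.
by case: s => /=; rewrite reprK; exact: coset_catr.
Qed.

(** Every word is equivalent, up to peripheral words on its left, to the word of a
    term. The term of a closed word equals the base generator in the quandle, so
    that its word is peripheral. *)
Theorem stabiliser_peripheral w : acts al w = al ->
  exists p d, peripheral al l p /\ movie al w p d.
Proof.
move=> wa; have [t tw wt] := word_term w.
have /pi_qcong /term_word_cong t0 : \cl t = \cl (QGen a0) by rewrite tw wa.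
have [p pp [d]] := coset_trans (coset_trans wt t0) g0.
by rewrite cats0 => pd; exists p, d.
Qed.

Lemma presented_connected y : exists w, acts al w = y.
Proof. by exists (term_word (repr y)); rewrite acts_term_word reprK. Qed.

End Stabiliser.

(** * The letters met along an edge *)

Section UnderPasses.
Variables (R : realType) (D : diagram R).
Local Notation E := (link_edges D).
Local Notation X := (knot_quandle D).
Implicit Types (e : edge R) (c : edge R * edge R) (s t : R).

Let linkD := diagram_is_link D.

Definition under_pos c : R := xget 0 [set t | 0 < t < 1 /\ under_point c = pt c.2 t].

Lemma under_posP c : c \in crossings D ->
  0 < under_pos c < 1 /\ under_point c = pt c.2 (under_pos c).
Proof.
move=> cD; have [t tI tE] := under_param cD.
by apply: (@xgetPex _ 0 [set t | 0 < t < 1 /\ under_point c = pt c.2 t]); exists t.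
Qed.

Lemma under_pos_inj c c' : c \in crossings D -> c' \in crossings D ->
  c.2 = c'.2 -> under_pos c = under_pos c' -> c = c'.
Proof.
move=> cD c'D cc uu; apply: (crossing_inj cD c'D).
by rewrite (under_posP cD).2 (under_posP c'D).2 cc uu.
Qed.

Lemma under_pt e t : e \in E -> 0 <= t <= 1 -> under_points D (pt e t) ->
  exists c, [/\ c \in crossings D, c.2 = e & under_pos c = t].
Proof.
move=> eE tI /under_pointsP[c cD tE]; exists c; have [uI uE] := under_posP cD.
have /crossingsP[_ c2 _] := cD.
have ce : e = c.2.
  by apply: (open_unique linkD c2 eE uI); rewrite -uE -tE; exact: segment_pt.
split => //; apply: (pt_inj linkD eE).
by rewrite tE uE ce.
Qed.

Lemma vertex_not_under e : e \in E ->
  ~ under_points D (pt e 0) /\ ~ under_points D (pt e 1).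
Proof.
move=> eE; have I0 : 0 <= (0 : R) <= 1 by rewrite lexx ler01.
have I1 : 0 <= (1 : R) <= 1 by rewrite lexx ler01.
split=> [/(under_pt eE I0)|/(under_pt eE I1)] [c [cD _ u]];
  by have [] := under_posP cD; rewrite u ltxx ?andbF.
Qed.

(** At a positive crossing the lower edge follows the normal of the upper one. *)
Definition under_letter c : letter X :=
  (canonical_colouring (over_arc D c), 0 < crossing_det c).

Definition edge_crossings e : seq (edge R * edge R) :=
  sort (relpre under_pos <=%R) [seq c <- crossings D | c.2 == e].

Definition under_word e t : seq (letter X) :=
  [seq under_letter c | c <- edge_crossings e & under_pos c < t].

Lemma mem_edge_crossings e c :
  (c \in edge_crossings e) = (c.2 == e) && (c \in crossings D).
Proof. by rewrite mem_sort mem_filter. Qed.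

Lemma edge_crossings_split e c : c \in edge_crossings e -> exists S1 S2,
  [/\ edge_crossings e = S1 ++ c :: S2,
     forall c', c' \in S1 -> under_pos c' < under_pos c &
     forall c', c' \in S2 -> under_pos c < under_pos c'].
Proof.
move=> ce; have [S1 [S2 SE]] : exists S1 S2, edge_crossings e = S1 ++ c :: S2.
  by case/splitPr: ce => S1 S2; exists S1, S2.
have u : uniq (S1 ++ c :: S2).
  by rewrite -SE sort_uniq filter_uniq// uniq_crossings.
have so : pairwise (relpre under_pos <=%R) (S1 ++ c :: S2).
  rewrite -SE -sorted_pairwise; last by move=> x y z /=; exact: le_trans.
  by apply: sort_sorted => x y /=; exact: le_total.
have strict c1 c2 : c1 \in edge_crossings e -> c2 \in edge_crossings e ->
    c1 != c2 -> under_pos c1 <= under_pos c2 -> under_pos c1 < under_pos c2.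
  rewrite !mem_edge_crossings => /andP[/eqP e1 d1] /andP[/eqP e2 d2] ne.
  rewrite le_eqVlt => /predU1P[h|//]; case/eqP: ne.
  by apply: under_pos_inj => //; rewrite e1.
exists S1, S2; split => // c' c'S.
- have c'e : c' \in edge_crossings e by rewrite SE mem_cat c'S.
  apply: strict => //.
    apply: contraTneq u => c'c; rewrite cat_uniq /= -{1}c'c c'S.
    by rewrite andbC.
  by move: so; rewrite pairwise_cat => /andP[/allrelP h _]; apply: h => //; rewrite mem_head.
- have c'e : c' \in edge_crossings e by rewrite SE mem_cat inE c'S !orbT.
  apply: strict => //.
    apply: contraTneq u => cc'; rewrite cat_uniq /= cc' c'S.
    by rewrite !andbF.
  move: so; rewrite pairwise_cat /= => /and3P[_ _ /andP[/allP h _]].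
  exact: h.
Qed.

Lemma pass_under c s t : c \in crossings D -> 0 <= s -> t <= 1 ->
  s < under_pos c < t ->
  (forall c', c' \in crossings D -> c'.2 = c.2 -> s <= under_pos c' <= t -> c' = c) ->
  [/\ under_word c.2 t = rcons (under_word c.2 s) (under_letter c),
     ~ under_points D (pt c.2 s), ~ under_points D (pt c.2 t) &
     (under_ini D c, under_ter D c) =
       if 0 < crossing_det c then (arc_at D (pt c.2 s), arc_at D (pt c.2 t))
       else (arc_at D (pt c.2 t), arc_at D (pt c.2 s))].
Proof.
move=> cD s0 t1 /andP[sc ct] only; have /crossingsP[_ c2 _] := cD.
have [/andP[u0 u1] uE] := under_posP cD; set tau := under_pos c in sc ct u0 u1 uE only.
have sI : 0 <= s <= 1 by rewrite s0 (le_trans (ltW sc) (ltW u1)).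
have tI : 0 <= t <= 1 by rewrite t1 (le_trans (ltW u0) (ltW ct)).
have tauI : 0 <= tau <= 1 by rewrite !ltW.
have clear_ r : 0 <= r <= 1 -> s <= r <= t -> r != tau -> ~ under_points D (pt c.2 r).
  move=> rI rst rtau /(under_pt c2 rI)[c' [c'D c'2 c'r]].
  by case/eqP: rtau; rewrite -c'r /tau (only c') // c'r.
split.
- have ce : c \in edge_crossings c.2 by rewrite mem_edge_crossings eqxx.
  have [S1 [S2 [SE h1 h2]]] := edge_crossings_split ce.
  have memS c' : c' \in edge_crossings c.2 -> c' \in crossings D /\ c'.2 = c.2.
    by rewrite mem_edge_crossings => /andP[/eqP].
  have S1s c' : c' \in S1 -> under_pos c' < s.
    move=> c'S; have [c'D c'2] := memS c' (ltac:(by rewrite SE mem_cat c'S)).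
    rewrite ltNge; apply/negP => sc'; have c't := lt_trans (h1 _ c'S) ct.
    by have := h1 _ c'S; rewrite (only c')// ?ltxx// sc' ltW.
  have S2t c' : c' \in S2 -> t < under_pos c'.
    move=> c'S; have [c'D c'2] := memS c' (ltac:(by rewrite SE mem_cat inE c'S !orbT)).
    rewrite ltNge; apply/negP => c't; have sc' := lt_trans sc (h2 _ c'S).
    by have := h2 _ c'S; rewrite (only c')// ?ltxx// c't ltW.
  rewrite /under_word SE !filter_cat /= -/tau ct ltNge (ltW sc) /=.
  have -> : [seq x <- S1 | under_pos x < t] = S1.
    by apply/all_filterP/allP => c' /h1 h; exact: lt_trans ct.
  have -> : [seq x <- S1 | under_pos x < s] = S1 by apply/all_filterP/allP.
  have -> : [seq x <- S2 | under_pos x < t] = [::].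
    rewrite -(filter_pred0 S2); apply: eq_in_filter => c' /S2t /ltW.
    by rewrite leNgt => /negbTE.
  have -> : [seq x <- S2 | under_pos x < s] = [::].
    rewrite -(filter_pred0 S2); apply: eq_in_filter => c' /h2 h.
    by rewrite ltNge (ltW (lt_trans sc h)).
  by rewrite cats0 cats1 map_rcons.
- by apply: clear_ => //; rewrite ?lexx ?(lt_eqF sc)//= (ltW (lt_trans sc ct)).
- by apply: clear_ => //; rewrite ?lexx ?(gt_eqF ct)//= andbT (ltW (lt_trans sc ct)).
have fs l : 0 < l <= 1 -> ~ under_points D (pt c.2 (tau + l * (s - tau))).
  move=> /andP[l0 l1]; apply: clear_.
  - by apply: conv01 => //; rewrite ltW.
  - by clear - l0 l1 sc ct; apply/andP; split; nra.
  - by clear - l0 sc; rewrite lt_eqF// gtrDl pmulr_rlt0// subr_lt0.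
have ft l : 0 < l <= 1 -> ~ under_points D (pt c.2 (tau + l * (t - tau))).
  move=> /andP[l0 l1]; apply: clear_.
  - by apply: conv01 => //; rewrite ltW.
  - by clear - l0 l1 sc ct; apply/andP; split; nra.
  - by clear - l0 ct; rewrite gt_eqF// ltrDl mulr_gt0// subr_gt0.
have := crossing_det_neq0 cD; rewrite neq_lt => /orP[d0|d0].
  rewrite ltNge (ltW d0) /=; congr (_, _).
  - apply: (under_iniE cD uE tauI tI _ ft).
    by rewrite nmulr_lgt0// subr_lt0.
  - apply: (under_terE cD uE tauI sI _ fs).
    by rewrite nmulr_lgt0// subr_lt0.
rewrite d0; congr (_, _).
- by apply: (under_iniE cD uE tauI sI _ fs); rewrite mulr_gt0// subr_gt0.
- by apply: (under_terE cD uE tauI tI _ ft); rewrite mulr_gt0// subr_gt0.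
Qed.

Lemma pass_under_colour c s t : c \in crossings D -> 0 <= s -> t <= 1 ->
  s < under_pos c < t ->
  (forall c', c' \in crossings D -> c'.2 = c.2 -> s <= under_pos c' <= t -> c' = c) ->
  canonical_colouring (arc_at D (pt c.2 t)) =
  act (canonical_colouring (arc_at D (pt c.2 s))) (under_letter c).
Proof.
move=> cD s0 t1 sct only; have [_ _ _] := pass_under cD s0 t1 sct only.
have := crossing_relation cD; rewrite /act /under_letter /=.
by case: ifP => _ h [iE tE]; rewrite -iE -tE -h ?qopK.
Qed.

Lemma crossing_isolated c : c \in crossings D -> exists s t,
  [/\ 0 <= s, t <= 1, s < under_pos c < t &
   forall c', c' \in crossings D -> c'.2 = c.2 -> s <= under_pos c' <= t -> c' = c].
Proof.
move=> cD; have [/andP[u0 u1] uE] := under_posP cD.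
have : \forall d \near (0 : R)^'+, forall c', c' \in crossings D ->
    c'.2 = c.2 -> under_pos c - d <= under_pos c' <= under_pos c + d -> c' = c.
  apply: near_seq => c' c'D; have [<-|nc] := eqVneq c' c; first exact: nearW.
  have [cc|cc] := eqVneq c'.2 c.2; last first.
    by apply: nearW => d /eqP; rewrite (negbTE cc).
  have : under_pos c' != under_pos c.
    by apply: contra_neq nc => uu; exact: under_pos_inj.
  rewrite neq_lt => /orP[lt|lt].
    have d0 : 0 < under_pos c - under_pos c' by rewrite subr_gt0.
    apply: filterS (nbhs_right_lt d0) => d dlt _ /andP[h _].
    by move: h; rewrite leNgt ltrBrDl -ltrBrDr dlt.
  have d0 : 0 < under_pos c' - under_pos c by rewrite subr_gt0.
  apply: filterS (nbhs_right_lt d0) => d dlt _ /andP[_ h].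
  by move: h; rewrite leNgt -ltrBrDl dlt.
have u10 : 0 < 1 - under_pos c by rewrite subr_gt0.
move=> near_only.
have [d [[d0 du] [d1 dP]]] : exists d, (0 < d /\ d < under_pos c) /\
    (d < 1 - under_pos c /\ forall c', c' \in crossings D ->
    c'.2 = c.2 -> under_pos c - d <= under_pos c' <= under_pos c + d -> c' = c).
  apply: (@filter_ex _ (0 : R)^'+); apply: filterI; apply: filterI => //.
  - exact: nbhs_right_gt.
  - exact: nbhs_right_lt.
  - exact: nbhs_right_lt.
exists (under_pos c - d), (under_pos c + d); split => //.
- by rewrite subr_ge0 ltW.
- by rewrite -lerBrDl ltW.
- by rewrite gtrBl ltrDl d0.
Qed.

(** Induction on the number of crossings passed: behind the last one the point
    stays on the same arc. *)
Lemma under_word_colour e t : e \in E -> 0 <= t <= 1 -> ~ under_points D (pt e t) ->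
  canonical_colouring (arc_at D (pt e t)) =
  acts (canonical_colouring (arc_at D (pt e 0))) (under_word e t).
Proof.
move=> eE; have [k] := ubnP (size (under_word e t)); elim: k t => // k IH t kt tI tN.
have [h0|] := eqVneq [seq c <- edge_crossings e | under_pos c < t] [::].
  rewrite /under_word h0 /=; congr canonical_colouring; apply/esym.
  have I0 : 0 <= (0 : R) <= 1 by rewrite lexx ler01.
  apply: arc_at_free => // l lI /(under_pt eE (conv01 I0 tI lI))[c [cD ce cl]].
  have [lt|] := ltP (under_pos c) t.
    have : c \in [seq c <- edge_crossings e | under_pos c < t].
      by rewrite mem_filter lt mem_edge_crossings ce eqxx.
    by rewrite h0.
  move: lI tI => /andP[l0 l1] /andP[t0 t1]; rewrite cl subr0 add0r => tl.
  have ct : under_pos c = t.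
    by apply/eqP; rewrite cl subr0 add0r eq_le tl andbT ler_piMl.
  by apply: tN; rewrite -ct -ce -(under_posP cD).2; exact: under_points_under.
move=> F0; have [l [c E1]] : exists l c,
    [seq c <- edge_crossings e | under_pos c < t] = rcons l c.
  by move: F0; case/lastP: [seq _ <- _ | _] => // l c _; exists l, c.
have : c \in [seq c <- edge_crossings e | under_pos c < t].
  by rewrite E1 mem_rcons mem_head.
rewrite mem_filter => /andP[ct ce]; move: (ce).
rewrite mem_edge_crossings => /andP[/eqP c2 cD].
have lc c' : c' \in l -> under_pos c' <= under_pos c.
  have so : pairwise (relpre under_pos <=%R) (rcons l c).
    rewrite -E1 pairwise_filter// -sorted_pairwise; last first.
      by move=> x y z /=; exact: le_trans.
    by apply: sort_sorted => x y /=; exact: le_total.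
  move: so; rewrite -cats1 pairwise_cat => /andP[/allrelP h _] c'l.
  by apply: h => //; rewrite mem_head.
have [s [t' [s0 t'1 /andP[sc ct'] iso]]] := crossing_isolated cD.
have only c' : c' \in crossings D -> c'.2 = c.2 -> s <= under_pos c' <= t -> c' = c.
  move=> c'D c'2 /andP[sc' ]; rewrite le_eqVlt => /predU1P[c't|c't].
    case: tN; rewrite -c't -c2 -c'2 -(under_posP c'D).2.
    exact: under_points_under.
  have : c' \in [seq c <- edge_crossings e | under_pos c < t].
    by rewrite mem_filter c't mem_edge_crossings c'2 c2 eqxx.
  rewrite E1 mem_rcons inE => /predU1P[//|/lc c'c].
  by apply: iso => //; rewrite sc' (le_trans c'c (ltW ct')).
have t1 : t <= 1 by have /andP[] := tI.
have sct : s < under_pos c < t by rewrite sc.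
have [wE sN tN' _] := pass_under cD s0 t1 sct only.
have colE := pass_under_colour cD s0 t1 sct only.
rewrite c2 in wE sN tN' colE.
rewrite colE wE -cats1 acts_cat /=; congr act; apply: IH => //.
  by move: kt; rewrite wE size_rcons.
by rewrite s0 (le_trans (ltW sc) (le_trans (ltW ct) t1)).
Qed.

End UnderPasses.

(** * The tour around a knot *)

Section Traversal.
Variables (R : realType) (K : diagram R) (k : polygon R).
Hypothesis KE : diagram_link K = [:: k].
Local Notation E := (link_edges K).
Local Notation X := (knot_quandle K).
Local Notation m := (size E).
Implicit Types (z : 'rV[R]_3) (i j : nat) (s t : R).

Let linkK := diagram_is_link K.

Local Notation e_ i := (nth ((0, 0) : edge R) E i).

Lemma knot_edges : E = edges k.
Proof. by rewrite /link_edges KE /= cats0. Qed.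

Lemma knot_size : (0 < m)%N.
Proof.
have [_ /allP h _] := linkK; have k3 : (2 < size k)%N by apply: h; rewrite KE mem_head.
rewrite knot_edges /edges size_zip size_rot minnn.
exact: leq_trans k3.
Qed.

Definition next_index i := if (i.+1 < m)%N then i.+1 else 0%N.

Lemma next_index_lt i : (next_index i < m)%N.
Proof. by rewrite /next_index; case: ifP => // _; exact: knot_size. Qed.

Lemma edge_next i : (i < m)%N -> (e_ i).2 = (e_ (next_index i)).1.
Proof.
move=> im; have sz : m = size k by rewrite knot_edges /edges size_zip size_rot minnn.
have fstE j : (j < m)%N -> (e_ j).1 = nth 0 k j.
  move=> jm; rewrite -(nth_map (0, 0) 0 fst)// knot_edges edges_fst//.
have -> : (e_ i).2 = nth 0 (rot 1 k) i.
  by rewrite -(nth_map (0, 0) 0 snd)// knot_edges edges_snd.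
rewrite fstE ?next_index_lt// /next_index sz.
have k0 : (0 < size k)%N by rewrite -sz knot_size.
rewrite sz in im; case: (k) im k0 => // x q /= iq _.
rewrite rot1_cons nth_rcons ltnS; case: ltnP => iq'; first by [].
by rewrite (_ : i == size q) //; rewrite eqn_leq iq' andbT -ltnS.
Qed.

Definition edge_under_word (e : edge R) : seq (letter X) := under_word K e 1.

(** The word met from the initial vertex of the polygon to the point with the
    parameter [t] on the edge with the index [i]. *)
Definition trail_word i t : seq (letter X) :=
  flatten [seq edge_under_word e | e <- take i E] ++ under_word K (e_ i) t.

Definition longitude : seq (letter X) := flatten [seq edge_under_word e | e <- E].

Definition base_arc : arc K := arc_at K (e_ 0).1.
Local Notation al := (canonical_colouring base_arc).

Lemma under_word0 e : under_word K e 0 = [::].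
Proof.
rewrite /under_word (eq_in_filter (a2 := pred0)) ?filter_pred0// => c.
rewrite mem_edge_crossings => /andP[_ cD] /=.
by have [/andP[/ltW]] := under_posP cD; rewrite leNgt => /negbTE.
Qed.

Lemma take_edge_words i : (i < m)%N ->
  flatten [seq edge_under_word e | e <- take i.+1 E] =
  flatten [seq edge_under_word e | e <- take i E] ++ edge_under_word (e_ i).
Proof. by move=> im; rewrite (take_nth (0, 0))// map_rcons flatten_rcons. Qed.

(** From the last edge to the first one, the words differ by one tour. *)
Lemma trail_word_next i : (i < m)%N ->
  coset al longitude (trail_word i 1) (trail_word (next_index i) 0).
Proof.
move=> im; rewrite /trail_word under_word0 cats0 -take_edge_words//.
rewrite /next_index; case: ltnP => im'; first exact: coset_refl.
rewrite take_oversize// take0 /=.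
exists longitude; last by rewrite cats0; exact: weq_refl.
by have := peripheral_loop (peripheral_nil al longitude); rewrite cats0.
Qed.

Lemma edge_mem i : (i < m)%N -> e_ i \in E. Proof. exact: mem_nth. Qed.

Lemma trail_word_colour i t : (i < m)%N -> 0 <= t <= 1 ->
  ~ under_points K (pt (e_ i) t) ->
  canonical_colouring (arc_at K (pt (e_ i) t)) = acts al (trail_word i t).
Proof.
have I1 : 0 <= (1 : R) <= 1 by rewrite lexx ler01.
have start j : (j < m)%N -> canonical_colouring (arc_at K (pt (e_ j) 0)) =
    acts al (flatten [seq edge_under_word e | e <- take j E]).
  elim: j => [|j IH] jm; first by rewrite take0 /= pt0.
  have jm' := ltnW jm; rewrite take_edge_words// acts_cat -IH//.
  rewrite /edge_under_word -(under_word_colour (edge_mem jm') I1); last first.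
    by have [] := vertex_not_under (edge_mem jm').
  by rewrite pt1 edge_next// /next_index jm pt0.
move=> im tI tN; rewrite (under_word_colour (edge_mem im) tI tN) start//.
by rewrite acts_cat.
Qed.

Lemma longitude_closed : acts al longitude = al.
Proof.
have I1 : 0 <= (1 : R) <= 1 by rewrite lexx ler01.
have m1 : (m.-1 < m)%N by rewrite ltn_predL knot_size.
have tN : ~ under_points K (pt (e_ m.-1) 1).
  by have [] := vertex_not_under (edge_mem m1).
have := trail_word_colour m1 I1 tN.
rewrite /trail_word -take_edge_words// prednK ?knot_size// take_size => <-.
by rewrite pt1 edge_next// /next_index prednK ?knot_size// ltnn.
Qed.

Definition at_index z i t : Prop := [/\ (i < m)%N, 0 <= t <= 1 & z = pt (e_ i) t].

Lemma at_index_ex z : link_set K z -> exists i t, at_index z i t.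
Proof.
move=> [e /= eE /segmentP[t tI zE]]; exists (index e E), t; split => //.
  by rewrite index_mem.
by rewrite nth_index.
Qed.

Lemma at_index_half_open z i t : at_index z i t -> exists j s,
  [/\ at_index z j s, s < 1 & coset al longitude (trail_word i t) (trail_word j s)].
Proof.
move=> [im /andP[t0 t1] zE]; have [t1'|t1'] := ltP t 1.
  by exists i, t; split => //; [split => //; rewrite t0|exact: coset_refl].
have tE : t = 1 by apply/eqP; rewrite eq_le t1.
exists (next_index i), 0; split; last by rewrite tE; exact: trail_word_next.
  split; rewrite ?next_index_lt ?lexx ?ler01//.
  by rewrite zE tE pt1 edge_next// pt0.
exact: ltr01.
Qed.

Lemma at_index_coset z i t j s : at_index z i t -> at_index z j s ->
  coset al longitude (trail_word i t) (trail_word j s).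
Proof.
move=> /at_index_half_open[i' [t' [[i'm /andP[t'0 _] zi] t'1 ci]]].
move=> /at_index_half_open[j' [s' [[j'm /andP[s'0 _] zj] s'1 cj]]].
apply: coset_trans ci _; apply: coset_trans _ (coset_sym cj).
have ee : e_ i' = e_ j'.
  apply: (half_open_disjoint linkK (z := z)); try exact: edge_mem.
    by rewrite zi; apply: half_open_pt; rewrite t'0.
  by rewrite zj; apply: half_open_pt; rewrite s'0.
have ij : i' = j'.
  by apply/eqP; rewrite -(nth_uniq (0, 0) i'm j'm (uniq_link_edges linkK)) ee.
have -> : t' = s' by apply: (pt_inj linkK (edge_mem i'm)); rewrite -zi zj ee.
by rewrite ij; exact: coset_refl.
Qed.

Lemma free_under_word e s t : e \in E -> 0 <= s <= 1 -> 0 <= t <= 1 ->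
  free K e s t -> under_word K e s = under_word K e t.
Proof.
move=> eE sI tI st; rewrite /under_word; congr map; apply: eq_in_filter => c.
rewrite mem_edge_crossings => /andP[/eqP ce cD].
have no a b : a <= under_pos c < b -> free K e a b -> False.
  move=> /andP[ac cb] fr; have d0 : 0 < b - a by rewrite subr_gt0 (le_lt_trans ac).
  apply: (fr ((under_pos c - a) / (b - a))).
    rewrite ler_pdivrMr// mul1r lerD2r (ltW cb) andbT.
    by rewrite divr_ge0 ?(ltW d0)// subr_ge0.
  rewrite divfK ?gt_eqF// addrC subrK -ce -(under_posP cD).2.
  exact: under_points_under.
case: ltP => sc; case: ltP => tc //.
- by case: (no t s); rewrite ?tc ?sc//; exact: freeC.
- by case: (no s t); rewrite ?tc ?sc.
Qed.

(** The point of the arc is arbitrary; the choice matters only up to the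
    peripheral words on the left ([arc_wordP]). *)
Definition arc_word (a : arc K) : seq (letter X) :=
  xget [::] [set w | exists z i t,
    [/\ component_set a z, at_index z i t & w = trail_word i t]].

Lemma arc_wordP (a : arc K) z i t : component_set a z -> at_index z i t ->
  coset al longitude (trail_word i t) (arc_word a).
Proof.
move=> az zit.
have [z' [i' [t' [az' z'it ->]]]] : [set w | exists z i t,
    [/\ component_set a z, at_index z i t & w = trail_word i t]] (arc_word a).
  by apply: (@xgetPex _ [::] [set w | exists z i t,
    [/\ component_set a z, at_index z i t & w = trail_word i t]]);
    exists (trail_word i t), z, i, t.
pose P x := exists j s, at_index x j s /\
  coset al longitude (trail_word j s) (trail_word i' t').
have [j [s [zjs cjs]]] : P z.
  apply: (arc_label (P := P) _ az' az).
    move=> e s u eE sI uI fr [j [r [pjr cjr]]].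
    exists (index e E), u; split.
      by split; rewrite ?index_mem ?nth_index.
    apply: coset_trans _ cjr.
    have se : at_index (pt e s) (index e E) s by split; rewrite ?index_mem ?nth_index.
    have := at_index_coset se pjr; rewrite /trail_word nth_index//.
    by rewrite (free_under_word eE sI uI fr).
  by exists i', t'; split => //; exact: coset_refl.
exact: coset_trans (at_index_coset zit zjs) cjs.
Qed.

Lemma acts_arc_word (a : arc K) : acts al (arc_word a) = canonical_colouring a.
Proof.
have [z az] : exists z, component_set a z.
  case: a => C /= [z zA ->]; exists z; exact: connected_component_refl.
have [zL zN] := component_sub az; have [i [t zit]] := at_index_ex zL.
have [p pp] := arc_wordP az zit.
move: zit => [im tI zE] /(@weq_acts _ _ _ _ al); rewrite acts_cat.
rewrite (peripheral_closed longitude_closed pp) => <-.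
rewrite -(arc_atE az) zE -trail_word_colour//.
by rewrite -zE.
Qed.

Lemma arc_word_at z i t : at_index z i t -> ~ under_points K z ->
  coset al longitude (trail_word i t) (arc_word (arc_at K z)).
Proof.
move=> zit zN; apply: arc_wordP (zit); apply: arc_atP; split => //.
by have [im tI ->] := zit; apply: link_pt => //; exact: edge_mem.
Qed.

Lemma crossing_coset c : c \in crossings K ->
  coset al longitude
    (arc_word (under_ini K c) ++ [:: (canonical_colouring (over_arc K c), true)])
    (arc_word (under_ter K c)).
Proof.
move=> cD; have [s [t [s0 t1 sct iso]]] := crossing_isolated cD.
have [wE sN tN] := pass_under cD s0 t1 sct iso.
have /crossingsP[_ c2 _] := cD; have [sc ct] := andP sct.
have [/andP[u0 u1] _] := under_posP cD.
have si : at_index (pt c.2 s) (index c.2 E) s.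
  by split; rewrite ?index_mem ?nth_index// s0 (le_trans (ltW sc) (ltW u1)).
have ti : at_index (pt c.2 t) (index c.2 E) t.
  by split; rewrite ?index_mem ?nth_index// t1 (le_trans (ltW u0) (ltW ct)).
have cs := arc_word_at si sN; have ct' := arc_word_at ti tN.
have WE : trail_word (index c.2 E) t =
    trail_word (index c.2 E) s ++ [:: under_letter K c].
  by rewrite /trail_word nth_index// wE -cats1 catA.
rewrite WE /under_letter in ct'.
case: ifP ct' => d ct' [-> ->].
  exact: coset_trans (coset_catr _ (coset_sym cs)) ct'.
apply: coset_trans (coset_catr _ (coset_sym ct')) _.
apply: coset_trans _ cs; apply: coset_weq; rewrite -catA -[X in weq _ _ X]cats0.
exact/weq_catl/(weq_cancel al [:: (canonical_colouring (over_arc K c), false)]).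
Qed.

Lemma knot_cycle_movie (c : rack_chain X 3) :
  rack_boundary c \in @degenerate X 2 ->
  exists2 d, movie al [::] [::] d & d - c \in @degenerate X 3.
Proof.
have g_rel p q : @knot_quandle_rel _ K p q ->
    coset al longitude (term_word arc_word p) (term_word arc_word q).
  by move=> [x xD [-> ->]] /=; exact: crossing_coset.
have g0 : coset al longitude (arc_word base_arc) [::].
  have I0 : 0 <= (0 : R) <= 1 by rewrite lexx ler01.
  have := @arc_word_at (e_ 0).1 0 0; rewrite /trail_word take0 /= under_word0.
  move=> h; apply/coset_sym/h; first by split; rewrite ?pt0 ?knot_size.
  by rewrite -pt0; have [] := vertex_not_under (edge_mem knot_size).
apply: (cycle_movie longitude_closed).
- exact: (stabiliser_peripheral acts_arc_word g_rel erefl g0).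
- exact: (presented_connected acts_arc_word).
Qed.

End Traversal.

Theorem theorem1p3 (R : realType) (k : polygon R) (K : diagram R)
    (c : quandle_chain (knot_quandle K) 3) :
  prime_knot k ->
  diagram_of_knot k K ->
  quandle_boundary c = 0 ->
  exists (L : diagram R) (f : quandleHom (knot_quandle L) (knot_quandle K))
         (Lsh : chain_class_group (knot_quandle L) 3),
    shadow_fundamental_class Lsh /\ chain_class c = class_push f Lsh.
Proof.
move=> _ [k' KE _] c0.
have bD : rack_boundary (repr c) \in @degenerate (knot_quandle K) 2.
  have rho0 : rho 0 = 0 :> quandle_chain (knot_quandle K) 2.
    by rewrite -[0 in LHS](subrr 0) rhoB subrr.
  have : rho (rack_boundary (repr c)) = rho 0.
    by rewrite -quandle_boundary_rho rhoK c0 rho0.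
  by move=> /eqP; rewrite -Quotient.idealrBE subr0.
have [d Md dc] := knot_cycle_movie KE bD.
have [L [f [Lsh [Lshc push]]]] := movie_realises R Md.
exists L, f, Lsh; split => //; rewrite push -[in LHS](rhoK c).
by congr chain_class; apply/esym/rho_eq.
Qed.
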